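(* Let $K(\alpha)$, $\alpha\in I$, be a $\mathcal{C}^{r,r'}$ billiard deformation with $r,r'\ge2$. For all $\xi\in\Sigma$, the reflection points $p_j(\xi,\alpha)$, $j\in\mathbb{Z}$, are at least $\mathcal{C}^{\min\{r-1,\,r'-1\}}$ with respect to $\alpha$, and $$\left|\frac{d p_j(\xi,\alpha)}{d\alpha}\right|\le C_p,\qquad\text{where } C_p=\frac{1}{\cos\phi_{\max}}\,\frac{C^{(0,1)}_\varphi+C^{(1,1)}_\varphi d_{\min}}{\kappa_{\min}d_{\min}}+C^{(0,1)}_\varphi.$$
   Context: Deformations. A function $f(x,y)$ is $\mathcal{C}^{A,B}$ if $\partial^{a+b}f/\partial x^a\partial y^b$ is continuous for all $a\le A$, $b\le B$. Let $m\ge3$ and let $I\subseteq[-\infty,\infty]$ be a closed interval. $K(\alpha)=\bigcup_{i=1}^m K_i(\alpha)\subset\mathbb{R}^2$, $\alpha\in I$, is a $\mathcal{C}^{r,r'}$ billiard deformation if for each $\alpha$: the $K_i(\alpha)$ are pairwise disjoint, compact, strictly convex (boundary curvature everywhere positive) with $\mathcal{C}^r$ boundary of length $L_i(\alpha)$; the no-eclipse condition holds (for distinct $i,j,k$ the convex hull of $K_i(\alpha)\cup K_j(\alpha)$ is disjoint from $K_k(\alpha)$); $\partial K_i(\alpha)$ is parametrized counterclockwise by arclength by a $\mathcal{C}^{r,r'}$ function $\tilde\varphi_i(\tilde u,\alpha)$, $\tilde u\in[0,L_i(\alpha)]$ (extended $L_i(\alpha)$-periodically in $\tilde u$); and for all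 $0\le q\le r$, $0\le q'\le r'$, $(q,q')\ne(0,0)$, there are constants $C^{(q,q')}_\varphi$ (depending on $\alpha$) with $\left\|\partial^{q+q'}\tilde\varphi_i/\partial\tilde u^q\partial\alpha^{q'}\right\|\le C^{(q,q')}_\varphi$ for all $i$ and all $\tilde u\in[0,L_i(\alpha)]$. Only one of the obstacles depends on $\alpha$. Non-wandering set. A particle moves at unit speed in $\overline{\mathbb{R}^2\setminus K(\alpha)}$ and reflects elastically at $\partial K(\alpha)$. $M_0(\alpha)$ is the set of $x=(q,v)$, $q\in\partial K(\alpha)$, $v$ a unit (post-reflection) velocity, whose trajectory has infinitely many reflections forward and backward in time; $B:M_0(\alpha)\to M_0(\alpha)$ is the map to the next reflection, $\pi(q,v)=q$. $d_{\min}$ is the minimum over $M_0(\alpha)$ of the distance from $q$ to the next reflection point; $\kappa_{\min}>0$ the minimum over $M_0(\alpha)$ of the curvature of $\partial K(\alpha)$ at $q$; $\phi_{\max}<\pi/2$ the maximum over $M_0(\alpha)$ of the angle between $v$ and the outward normal of $K(\alpha)$ at $q$. Coding. $\Sigma=\{\xi=(\xi_j)_{j\in\mathbb{Z}}:\xi_j\in\{1,\dots,m\},\ \xi_j\ne\xi_{j+1}\}$. For $\xi\in\Sigma$ there is a unique $x=\chi_\alpha(\xi)\in M_0(\alpha)$ with $\pi B^jx\in\partial K_{\xi_j}(\alpha)$ for all $j\in\mathbb{Z}$; $p_j(\xi,\alpha)=\pi B^j\chi_\alpha(\xi)$. *)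

(* Defs.v *)
From HB Require Import structures.
From mathcomp Require Import all_boot all_order all_algebra.
From mathcomp Require Import all_classical all_reals all_analysis.

Set Implicit Arguments.
Unset Strict Implicit.
Unset Printing Implicit Defensive.

Import Order.TTheory GRing.Theory Num.Theory.
Import numFieldNormedType.Exports.

Local Open Scope classical_set_scope.
Local Open Scope ring_scope.

(* [R * R] carries the sup norm in the library (same topology); lengths and
   angles below are Euclidean. *)
Definition dot (R : realType) (x y : R * R) : R := x.1 * y.1 + x.2 * y.2.

Definition det2 (R : realType) (x y : R * R) : R := x.1 * y.2 - x.2 * y.1.

Definition enorm (R : realType) (x : R * R) : R := Num.sqrt (dot x x).

Definition frontier (T : topologicalType) (A : set T) : set T :=
  closure A `\` interior A.

Definition convex_hull (R : realType) (A : set (R * R)) : set (R * R) :=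
  smallest (@convex_set R (R * R)%type) A.

(* The real points of the closed interval [a, b] of the extended line. *)
Definition real_itv (R : realType) (a b : \bar R) : set R :=
  [set x | (a <= x%:E)%E /\ (x%:E <= b)%E].

(* The increments [h] are restricted to [x + h \in I], so the derivative is
   one-sided at an endpoint of [I] and the usual one in the interior. *)
Definition diff_quot_in (R : realType) (V : normedModType R)
    (I : set R) (f : R -> V) (x : R) :=
  (h^-1 *: (f (h + x) - f x)) @[h --> within [set h | I (h + x)] 0^'].

Definition derivable_in (R : realType) (V : normedModType R)
    (I : set R) (f : R -> V) (x : R) : Prop :=
  cvg (diff_quot_in I f x).

Definition derive_in (R : realType) (V : normedModType R)
    (I : set R) (f : R -> V) (x : R) : V :=
  lim (diff_quot_in I f x).

Definition derive_in_n (R : realType) (V : normedModType R)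
    (I : set R) (n : nat) (f : R -> V) : R -> V :=
  iter n (derive_in I) f.

Definition Ck_in (R : realType) (V : normedModType R)
    (I : set R) (k : nat) (f : R -> V) : Prop :=
  (forall n x, (n < k)%N -> I x -> derivable_in I (derive_in_n I n f) x) /\
  (forall n, (n <= k)%N -> {within I, continuous (derive_in_n I n f)}).

(* d^(p+q) f / du^p dalpha^q, for [u] in R and [alpha] in [I] *)
Definition pderiv (R : realType) (V : normedModType R) (I : set R)
    (p q : nat) (f : R -> R -> V) (u alpha : R) : V :=
  derive1n p (fun s => derive_in_n I q (f s) alpha) u.

Definition CAB (R : realType) (V : normedModType R) (I : set R)
    (A B : nat) (f : R -> R -> V) : Prop :=
  [/\ forall q u alpha, (q < B)%N -> I alpha ->
        derivable_in I (derive_in_n I q (f u)) alpha,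
      forall p q u alpha, (p < A)%N -> (q <= B)%N -> I alpha ->
        derivable (fun s => pderiv I p q f s alpha) u 1
    & forall p q, (p <= A)%N -> (q <= B)%N ->
        {within [set z : R * R | I z.2],
          continuous (fun z : R * R => pderiv I p q f z.1 z.2)}].

Definition tangent (R : realType) (c : R -> R * R) (u : R) : R * R := derive1 c u.

(* The tangent rotated by -pi/2: the outward normal when [c] is the
   counterclockwise boundary of a convex body. *)
Definition normal (R : realType) (c : R -> R * R) (u : R) : R * R :=
  ((tangent c u).2, - (tangent c u).1).

(* Signed curvature; this formula presupposes unit speed. *)
Definition curvature (R : realType) (c : R -> R * R) (u : R) : R :=
  det2 (tangent c u) (derive1n 2 c u).

Record arclength_ccw (R : realType) (A : set (R * R)) (l : R)
    (c : R -> R * R) : Prop := ArclengthCcw {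
  ac_length_gt0 : 0 < l;
  ac_periodic : forall u, c (u + l) = c u;
  ac_simple : forall u v, 0 <= u < l -> 0 <= v < l -> c u = c v -> u = v;
  ac_frontier : range c = frontier A;
  ac_unit_speed : forall u, enorm (tangent c u) = 1;
  (* counterclockwise: [A] lies to the left of each oriented tangent *)
  ac_ccw : forall u y, A y -> 0 <= det2 (tangent c u) (y - c u)
}.

(* The obstacles are [K i], with boundaries parametrized by [c i]; a phase
   point is a pair (position, velocity). [y] is the phase point just after the
   next reflection of the particle leaving [x.1] with velocity [x.2]. *)
Definition next_reflection (R : realType) (m : nat)
    (K : 'I_m -> set (R * R)) (c : 'I_m -> R -> R * R)
    (x y : (R * R) * (R * R)) : Prop :=
  exists t i u,
    [/\ 0 < t,
        y.1 = x.1 + t *: x.2,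
        forall s, 0 < s -> s < t -> forall k, ~ K k (x.1 + s *: x.2),
        y.1 = c i u
      & y.2 = x.2 - (2 * dot x.2 (normal (c i) u)) *: normal (c i) u].

Definition nonwandering (R : realType) (m : nat)
    (K : 'I_m -> set (R * R)) (c : 'I_m -> R -> R * R) :
    set ((R * R) * (R * R)) :=
  [set x | [/\ exists i u, x.1 = c i u /\ 0 <= dot x.2 (normal (c i) u),
               enorm x.2 = 1
             & exists o : int -> (R * R) * (R * R),
                 o 0 = x /\
                 forall j : int, next_reflection K c (o j) (o (j + 1))]].

Definition billiard_map (R : realType) (m : nat)
    (K : 'I_m -> set (R * R)) (c : 'I_m -> R -> R * R)
    (x : (R * R) * (R * R)) : (R * R) * (R * R) :=
  xget x [set y | nonwandering K c y /\ next_reflection K c x y].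

Definition billiard_map_inv (R : realType) (m : nat)
    (K : 'I_m -> set (R * R)) (c : 'I_m -> R -> R * R)
    (y : (R * R) * (R * R)) : (R * R) * (R * R) :=
  xget y [set x | nonwandering K c x /\ next_reflection K c x y].

Definition billiard_iter (R : realType) (m : nat)
    (K : 'I_m -> set (R * R)) (c : 'I_m -> R -> R * R) (j : int)
    (x : (R * R) * (R * R)) : (R * R) * (R * R) :=
  match j with
  | Posz n => iter n (billiard_map K c) x
  | Negz n => iter n.+1 (billiard_map_inv K c) x
  end.

(* The extrema over the non-wandering set are attained; they are written as
   [inf] and [sup]. *)
Definition d_min (R : realType) (m : nat)
    (K : 'I_m -> set (R * R)) (c : 'I_m -> R -> R * R) : R :=
  inf [set d | exists2 x, nonwandering K c x &
                 d = enorm ((billiard_map K c x).1 - x.1)].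

Definition kappa_min (R : realType) (m : nat)
    (K : 'I_m -> set (R * R)) (c : 'I_m -> R -> R * R) : R :=
  inf [set k | exists x i u, [/\ nonwandering K c x, x.1 = c i u
                               & k = curvature (c i) u]].

Definition phi_max (R : realType) (m : nat)
    (K : 'I_m -> set (R * R)) (c : 'I_m -> R -> R * R) : R :=
  sup [set a | exists x i u, [/\ nonwandering K c x, x.1 = c i u
                               & a = acos (dot x.2 (normal (c i) u))]].

Definition Sigma (m : nat) : set (int -> 'I_m) :=
  [set xi | forall j : int, xi j != xi (j + 1)].

(* The phase point coded by [xi]: such a point exists and is unique. *)
Definition chi (R : realType) (m : nat)
    (K : 'I_m -> set (R * R)) (c : 'I_m -> R -> R * R)
    (xi : int -> 'I_m) : (R * R) * (R * R) :=
  xget 0 [set x | nonwandering K c x /\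
                  forall j : int, frontier (K (xi j)) (billiard_iter K c j x).1].

Definition reflection_point (R : realType) (m : nat)
    (K : 'I_m -> set (R * R)) (c : 'I_m -> R -> R * R)
    (xi : int -> 'I_m) (j : int) : R * R :=
  (billiard_iter K c j (chi K c xi)).1.

(* [C q q' alpha] bounds the (q, q')-th partial derivative at [alpha]. *)
Record billiard_deformation (R : realType) (m r r' : nat) (I : set R)
    (K : 'I_m -> R -> set (R * R)) (L : 'I_m -> R -> R)
    (phi : 'I_m -> R -> R -> R * R) (C : nat -> nat -> R -> R) : Prop :=
  BilliardDeformation {
  bd_disjoint : forall alpha i j, I alpha -> i != j ->
    K i alpha `&` K j alpha = set0;
  bd_compact : forall alpha i, I alpha -> compact (K i alpha);
  bd_convex : forall alpha i, I alpha -> @convex_set R (R * R)%type (K i alpha);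
  bd_no_eclipse : forall alpha i j k, I alpha ->
    i != j -> j != k -> i != k ->
    convex_hull (K i alpha `|` K j alpha) `&` K k alpha = set0;
  bd_arclength : forall alpha i, I alpha ->
    arclength_ccw (K i alpha) (L i alpha) (phi i ^~ alpha);
  bd_smooth : forall i, CAB I r r' (phi i);
  bd_curvature : forall alpha i u, I alpha ->
    0 < curvature (phi i ^~ alpha) u;
  bd_bound : forall alpha q q' i u, I alpha ->
    (q <= r)%N -> (q' <= r')%N -> (q, q') != (0%N, 0%N) ->
    0 <= u <= L i alpha ->
    enorm (pderiv I q q' (phi i) u alpha) <= C q q' alpha;
  bd_one_moves : exists i0, forall i alpha beta,
    i != i0 -> I alpha -> I beta -> K i alpha = K i beta
}.

Definition obstacles_at (R : realType) (m : nat)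
    (K : 'I_m -> R -> set (R * R)) (alpha : R) : 'I_m -> set (R * R) :=
  fun i => K i alpha.

Definition boundaries_at (R : realType) (m : nat)
    (phi : 'I_m -> R -> R -> R * R) (alpha : R) : 'I_m -> R -> R * R :=
  fun i u => phi i u alpha.

Definition C_p (R : realType) (m : nat)
    (K : 'I_m -> R -> set (R * R)) (phi : 'I_m -> R -> R -> R * R)
    (C : nat -> nat -> R -> R) (alpha : R) : R :=
  let Ka := obstacles_at K alpha in
  let ca := boundaries_at phi alpha in
  (cos (phi_max Ka ca))^-1 *
    ((C 0%N 1%N alpha + C 1%N 1%N alpha * d_min Ka ca)
       / (kappa_min Ka ca * d_min Ka ca))
  + C 0%N 1%N alpha.

(* Main.v *)
(* The orbit coded by [xi] is characterised by a variational inequality at each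
   reflection: existence follows by compactness from minimising the length of
   finite orbit segments, uniqueness from a monotonicity (energy) argument.  Its
   boundary parameters solve a chain of nearest-neighbour equations
   [dot T_j (e_(j-1) - e_j) = 0], where [T_j] is the tangent and [e_j] the unit
   direction from the j-th to the next reflection point.  In the unknowns
   [s_j * u_j], with [s_j] the cosine of the angle of reflection, the linearised
   chain is tridiagonal and diagonally dominant with gap [2 * kappa_j], hence
   uniformly invertible in the sup norm; a contraction gives a solution near a
   given parameter, and its derivatives solve chains with the same matrix.
   For the explicit constant, the parametrizations of the obstacles that do not
   move are frozen at the given parameter: the inhomogeneity is then at most
   [2 * (C11 + C01 / d_min)], so that [|s_j * u_j'|] is at most
   [(C01 + C11 * d_min) / (kappa_min * d_min)]. *)
Require Import Defs.
From HB Require Import structures.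
From mathcomp Require Import all_boot all_order all_algebra.
From mathcomp Require Import all_classical all_reals all_analysis.
From mathcomp Require Import zify ring lra.

Set Implicit Arguments.
Unset Strict Implicit.
Unset Printing Implicit Defensive.

Import Order.TTheory GRing.Theory Num.Theory.
Import numFieldNormedType.Exports.

Local Open Scope classical_set_scope.
Local Open Scope ring_scope.

(** * Diagonally dominant rows *)

(** Bounds are uniform over all indices in Z, whereas limits of coefficients and of difference
    quotients are available one row at a time. The two are reconciled by the decay of the inverse of
    a dominant matrix: distant rows of a bounded sequence contribute a geometrically small amount,
    so rowwise convergence gives convergence of each entry.

    The chain equation cannot tell a reflection from a straight passage, since both make the
    tangential components of the two directions agree. Its solution is recognised as an orbit by the
    signs of the normal components, which persist by continuity, and is then the orbit chosen in
    [reflection_point] by uniqueness, a statement about the sets alone.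

    This is what permits freezing: an obstacle fixed as a set may carry a parametrization that
    slides along it, and replacing that parametrization changes no reflection point. Consecutive
    obstacles differ, so after freezing each flight has at most one moving end and contributes a
    single [C01]. *)

Definition dominant (R : realType) (k B : R) (a b c : int -> R) : Prop :=
  forall j, `|a j| + `|c j| + k <= b j <= B.

Definition row (R : realType) (a b c w : int -> R) (j : int) : R :=
  a j * w (j - 1) + b j * w j + c j * w (j + 1).

(** Solving the row for [w j] damps the excess [M] of the neighbours over [E] by (b j - k) / b j, at
    most 1 - k / B. The level [E] is reproduced exactly because the right-hand side is measured as
    [k * E]. *)
Lemma row_le (R : realType) (k B : R) (a b c w : int -> R) (E M : R) (j : int) :
  0 < k -> dominant k B a b c -> 0 <= M ->
  `|row a b c w j| <= k * E ->
  `|w (j - 1)| <= E + M -> `|w (j + 1)| <= E + M ->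
  `|w j| <= E + (1 - k / B) * M.
Proof.
move=> k0 dom M0 rj wl wr.
have /andP[d1 d2] := dom j.
have b0 : 0 < b j.
  by apply: lt_le_trans d1; rewrite ltr_pwDr// addr_ge0.
have B0 : 0 < B by apply: lt_le_trans d2.
have E0 : 0 <= E by rewrite -(pmulr_rge0 _ k0); apply: le_trans rj.
have h : b j * `|w j| <= k * E + (`|a j| + `|c j|) * (E + M).
  rewrite -{1}(gtr0_norm b0) -normrM.
  have -> : b j * w j = row a b c w j - a j * w (j - 1) - c j * w (j + 1).
    by rewrite /row; ring.
  apply: le_trans (ler_normB _ _) _; rewrite mulrDl addrA.
  apply: lerD; last by rewrite normrM ler_wpM2l.
  apply: le_trans (ler_normB _ _) _; apply: lerD => //.
  by rewrite normrM ler_wpM2l.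
have h2 : b j * `|w j| <= b j * (E + (1 - k / b j) * M).
  have -> : b j * (E + (1 - k / b j) * M) = k * E + (b j - k) * (E + M).
    by field; rewrite gt_eqF.
  apply: le_trans h _; rewrite lerD2l ler_wpM2r ?addr_ge0//.
  by rewrite lerBrDr.
rewrite ler_pM2l// in h2; apply: le_trans h2 _.
rewrite lerD2l ler_wpM2r// lerD2l lerN2 ler_wpM2l ?(ltW k0)//.
by rewrite lef_pV2 ?posrE.
Qed.

(* Only the rows within distance [n] of [j] matter, up to a geometrically small
   remainder: the inverse of a diagonally dominant operator is localized. *)
Lemma dominant_local (R : realType) (k B : R) (a b c w : int -> R) (E W : R)
    (n : nat) (j : int) :
  0 < k -> dominant k B a b c -> 0 <= E ->
  (forall i, `|w i| <= W) ->
  (forall i : int, j - n%:Z <= i <= j + n%:Z -> `|row a b c w i| <= k * E) ->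
  `|w j| <= E + (1 - k / B) ^+ n * W.
Proof.
move=> k0 dom E0 hW; have W0 : 0 <= W by apply: le_trans (hW 0).
have th : 0 <= 1 - k / B.
  have /andP[d1 d2] := dom 0.
  have kb : k <= B.
    by apply: le_trans d2; apply: le_trans d1; rewrite lerDr addr_ge0.
  by rewrite subr_ge0 ler_pdivrMr ?mul1r// (lt_le_trans k0).
elim: n j => [|n IH] j hr; first by rewrite expr0 mul1r ler_wpDl.
rewrite exprS -mulrA; apply: (row_le k0 dom).
- by rewrite mulr_ge0// exprn_ge0.
- by apply: hr; lia.
- by apply: IH => i hi; apply: hr; lia.
- by apply: IH => i hi; apply: hr; lia.
Qed.

Lemma dominant_ratio (R : realType) (k B : R) (a b c : int -> R) :
  0 < k -> dominant k B a b c -> 0 < B /\ 0 <= 1 - k / B < 1.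
Proof.
move=> k0 dom; have /andP[d1 d2] := dom 0.
have kb : k <= B.
  by apply: le_trans d2; apply: le_trans d1; rewrite lerDr addr_ge0.
have B0 : 0 < B by apply: lt_le_trans kb.
split=> //; rewrite subr_ge0 ler_pdivrMr ?mul1r// kb/=.
by rewrite ltrBlDr ltrDl divr_gt0.
Qed.

Lemma expr_small (R : realType) (th W e : R) :
  0 <= th < 1 -> 0 < e -> exists n, th ^+ n * W <= e.
Proof.
move=> /andP[th0 th1] e0.
have : (fun n => th ^+ n * W) @ \oo --> (0 * W : R).
  by apply: cvgMl; apply: cvg_expr; rewrite ger0_norm.
rewrite mul0r => /cvgrPdist_le /(_ _ e0) [n _ /(_ n)] /=.
rewrite sub0r normrN => h; exists n.
by apply: le_trans (ler_norm _) _; apply: h => /=.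
Qed.

(** The a priori bound [W] excludes the exponentially growing solutions of the homogeneous
    recurrence; it gets multiplied by an arbitrarily small power and leaves no trace in the
    conclusion. *)
Lemma dominant_le (R : realType) (k B : R) (a b c w : int -> R) (E W : R) :
  0 < k -> dominant k B a b c -> 0 <= E ->
  (forall i, `|w i| <= W) ->
  (forall i, `|row a b c w i| <= k * E) ->
  forall j, `|w j| <= E.
Proof.
move=> k0 dom E0 hW hr j; apply/ler_addgt0Pr => e e0.
have [B0 th] := dominant_ratio k0 dom.
have [n hn] := expr_small W th e0.
apply: le_trans (_ : E + (1 - k / B) ^+ n * W <= _); last by rewrite lerD2l.
by apply: (dominant_local k0 dom) => // i _.
Qed.

(** A filter is closed under finite intersections; a window of indices is exactly what
    [dominant_local] asks for. *)
Lemma near_int_window (T : Type) (F : set_system T) {FF : Filter F}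
    (P : int -> T -> Prop) (j : int) (n : nat) :
  (forall i, \forall t \near F, P i t) ->
  \forall t \near F, forall i, j - n%:Z <= i <= j + n%:Z -> P i t.
Proof.
move=> h.
have : \forall t \near F, forall k : 'I_(n + n).+1, P (j - n%:Z + k%:Z) t.
  by apply: filter_forall => k; apply: h.
apply: filterS => t ht i hi.
have E : j - n%:Z + (absz (i - j + n%:Z)%R)%:Z = i by lia.
have lk : (absz (i - j + n%:Z)%R < (n + n).+1)%N by lia.
have := ht (Ordinal lk) => /=.
by rewrite E.
Qed.

(** The rows may converge at rates depending on [j]: localization needs finitely many of them for
    each entry, and the uniform bound [W] controls the rest. *)
Lemma dominant_cvg0 (R : realType) (k B : R) (a b c : int -> R) (T : Type)
    (F : set_system T) {FF : Filter F} (y : T -> int -> R) (W : R) :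
  0 < k -> dominant k B a b c ->
  (\forall t \near F, forall j, `|y t j| <= W) ->
  (forall j, (fun t => row a b c (y t) j) @ F --> (0 : R)) ->
  forall j, (fun t => y t j) @ F --> (0 : R).
Proof.
move=> k0 dom hW hr j; apply/cvgrPdist_le => e e0.
have [B0 th] := dominant_ratio k0 dom.
have e20 : 0 < e / 2 by rewrite divr_gt0.
have [n hn] := expr_small W th e20.
have hrow i : \forall t \near F, `|row a b c (y t) i| <= k * (e / 2).
  have /cvgrPdist_le/(_ (k * (e / 2))) := hr i.
  move=> /(_ (mulr_gt0 k0 e20)); apply: filterS => t.
  by rewrite sub0r normrN.
have hw := @near_int_window _ F FF _ j n hrow.
near=> t; rewrite sub0r normrN.
apply: le_trans (dominant_local (n := n) (E := e / 2) (W := W) k0 dom _ _ _) _.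
- exact: ltW.
- by near: t.
- by near: t.
- by rewrite {2}(splitr e) lerD2l.
Unshelve. all: by end_near. Qed.

(** Since [b <= B], the moduli of the three weights add up to (B - b) + |a| + |c|, at most B - k. *)
Lemma relaxation_le (R : realType) (k B M a b c x1 x2 x3 : R) :
  0 < B -> `|a| + `|c| + k <= b <= B ->
  `|x1| <= M -> `|x2| <= M -> `|x3| <= M ->
  `|((B - b) * x2 - a * x1 - c * x3) / B| <= (1 - k / B) * M.
Proof.
move=> B0 /andP[d1 d2] h1 h2 h3.
rewrite normrM normfV (gtr0_norm B0) ler_pdivrMr//.
have M0 : 0 <= M by apply: le_trans h1.
apply: le_trans (ler_normB _ _) _; apply: le_trans (lerD (ler_normB _ _) (lexx _)) _.
rewrite !normrM (ger0_norm (_ : 0 <= B - b)) ?subr_ge0//.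
apply: (@le_trans _ _ ((B - b) * M + `|a| * M + `|c| * M)).
  by rewrite !lerD// ler_wpM2l// subr_ge0.
have -> : (1 - k / B) * M * B = (B - k) * M by field; rewrite gt_eqF.
rewrite -!mulrDl ler_wpM2r//; lra.
Qed.

(* The relaxation [u <- u - F u / B] contracts the sup norm. *)
Lemma chain_solve (R : realType) (F : int -> R -> R -> R -> R) (th q B : R) :
  0 <= th < 1 -> 0 <= q -> 0 < B ->
  (forall j x1 x2 x3 y1 y2 y3 M,
     `|x1| <= q -> `|x2| <= q -> `|x3| <= q ->
     `|y1| <= q -> `|y2| <= q -> `|y3| <= q ->
     `|y1 - x1| <= M -> `|y2 - x2| <= M -> `|y3 - x3| <= M ->
     `|(y2 - F j y1 y2 y3 / B) - (x2 - F j x1 x2 x3 / B)| <= th * M) ->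
  (forall j, `|F j 0 0 0| / B <= (1 - th) * q) ->
  exists u : int -> R, (forall j, `|u j| <= q) /\
    forall j, F j (u (j - 1)) (u j) (u (j + 1)) = 0.
Proof.
move=> /andP[th0 th1] q0 B0 hc h0.
pose G (v : int -> R) (j : int) := v j - F j (v (j - 1)) (v j) (v (j + 1)) / B.
pose v n := iter n G (fun=> 0).
have vS n : v n.+1 = G (v n) by [].
have hG x y M : (forall j, `|x j| <= q) -> (forall j, `|y j| <= q) ->
    (forall j, `|y j - x j| <= M) -> forall j, `|G y j - G x j| <= th * M.
  by move=> hx hy hM j; apply: hc.
have hG0 y : (forall j, `|y j| <= q) -> forall j, `|G y j| <= q.
  move=> hy j.
  have z (i : int) : `|(0 : R)| <= q by rewrite normr0.
  have hM i : `|y i - 0| <= q by rewrite subr0.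
  have := hG (fun=> 0) y q z hy hM j; rewrite {2}/G sub0r => h.
  have -> : G y j = (G y j - - (F j 0 0 0 / B)) + - (F j 0 0 0 / B) by ring.
  apply: le_trans (ler_normD _ _) _; rewrite normrN normrM normfV (gtr0_norm B0).
  by apply: le_trans (lerD h (h0 j)) _; rewrite -mulrDl addrC subrK mul1r.
have vq n : forall j, `|v n j| <= q.
  by elim: n => [|n IH] j; [rewrite /v /= normr0|rewrite vS; exact: hG0].
have step n : forall j, `|v n.+1 j - v n j| <= th ^+ n * q.
  elim: n => [|n IH] j; first by rewrite expr0 mul1r /v [X in _ - X]/= subr0; exact: (vq 1%N).
  by rewrite exprS -mulrA; apply: hG; [exact: vq|exact: (vq n.+1)|exact: IH].
have far n p : forall j, `|v (n + p)%N j - v n j| <= th ^+ n * q / (1 - th).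
  have t1 : 0 < 1 - th by rewrite subr_gt0.
  elim: p n => [|p IH] n j.
    by rewrite addn0 subrr normr0 divr_ge0 ?mulr_ge0 ?exprn_ge0 ?(ltW t1).
  rewrite -addSnnS -(subrK (v n.+1 j) (v (n.+1 + p)%N j)) -addrA.
  apply: le_trans (ler_normD _ _) _.
  apply: le_trans (lerD (IH _ _) (step _ _)) _.
  rewrite le_eqVlt; apply/orP; left; apply/eqP; rewrite exprS.
  by field; rewrite gt_eqF.
have cv j : cvgn (fun n => v n j).
  apply/cauchy_cvgP/cauchy_exP => e e0.
  have e20 : 0 < e / 2 by rewrite divr_gt0.
  have [n hn] := expr_small (q / (1 - th)) (introT andP (conj th0 th1)) e20.
  exists (v n j); exists n => // m /= nm; rewrite /ball /= distrC.
  have b1 := far n (m - n)%N j; rewrite -mulrA subnKC// in b1.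
  apply: le_lt_trans (le_trans b1 hn) _.
  by rewrite [ltRHS](splitr e) ltrDl.
pose u (j : int) : R := lim ((fun n => v n j) @ \oo).
(* The rate does not depend on [j], so the limit taken coordinate by coordinate is a sup norm limit,
   to which the contraction [hG] applies. *)
have vu j n : `|u j - v n j| <= th ^+ n * q / (1 - th).
  have : (fun p => `|v (p + n)%N j - v n j|) @ \oo --> `|u j - v n j|.
    apply: cvg_norm; apply: cvgB; last exact: cvg_cst.
    have := cv j; rewrite -(cvg_shiftn n); exact.
  by move=> /cvgr_to_le; apply; apply: nearW => p; rewrite addnC; exact: far.
have uq j : `|u j| <= q.
  have : (fun n => `|v n j|) @ \oo --> `|u j| by apply: cvg_norm; exact: cv.
  by move=> /cvgr_to_le; apply; apply: nearW => p; apply: vq.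
exists u; split=> // j.
suff E : u j = G u j.
  have /eqP : F j (u (j - 1)) (u j) (u (j + 1)) / B = 0.
    by rewrite -(subKr (u j) (_ / B)) -/(G u j) -E subrr.
  by rewrite mulf_eq0 invr_eq0 (gt_eqF B0) orbF => /eqP.
apply/eqP; rewrite -subr_eq0 -normr_le0.
apply/ler_addgt0Pr => e e0; rewrite add0r.
have [n hn] := expr_small (2 * q / (1 - th)) (introT andP (conj th0 th1)) e0.
have -> : u j - G u j = (u j - v n.+1 j) - (G u j - v n.+1 j) by ring.
apply: le_trans (ler_normB _ _) _.
have g1 : `|G u j - v n.+1 j| <= th * (th ^+ n * q / (1 - th)).
  by rewrite vS; apply: hG.
apply: le_trans (lerD (vu j n.+1) g1) _.
apply: le_trans hn.
have -> : th ^+ n.+1 * q / (1 - th) + th * (th ^+ n * q / (1 - th)) =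
  th * (th ^+ n * (2 * q / (1 - th))).
  by rewrite exprS; ring.
have t1 : 0 <= 1 - th by rewrite subr_ge0 ltW.
by rewrite ler_piMl ?(ltW th1)// mulr_ge0 ?exprn_ge0 ?divr_ge0 ?mulr_ge0.
Qed.

(** The affine case of [chain_solve]: the contraction holds globally and the right-hand side
    dictates the radius [Y]. *)
Lemma dominant_solve (R : realType) (k B Y : R) (a b c y : int -> R) :
  0 < k -> dominant k B a b c -> 0 <= Y -> (forall j, `|y j| <= k * Y) ->
  exists w : int -> R, (forall j, `|w j| <= Y) /\
    forall j, row a b c w j + y j = 0.
Proof.
move=> k0 dom Y0 hy.
have [B0 th] := dominant_ratio k0 dom.
pose F j x1 x2 x3 := a j * x1 + b j * x2 + c j * x3 + y j.
have [] := @chain_solve R F (1 - k / B) Y B th Y0 B0.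
- move=> j x1 x2 x3 y1 y2 y3 M _ _ _ _ _ _ h1 h2 h3.
  have -> : y2 - F j y1 y2 y3 / B - (x2 - F j x1 x2 x3 / B) =
    ((B - b j) * (y2 - x2) - a j * (y1 - x1) - c j * (y3 - x3)) / B.
    by rewrite /F; field; rewrite gt_eqF.
  exact: (relaxation_le B0 (dom j)).
- move=> j; rewrite /F !mulr0 !add0r ler_pdivrMr//.
  have -> : (1 - (1 - k / B)) * Y * B = k * Y by field; rewrite gt_eqF.
  exact: hy.
by move=> w [w1 w2]; exists w; split=> // j; apply: w2.
Qed.

(** * Derivatives within a set *)

(** A relation rather than a function, so that no uniqueness of limits is involved: at a point
    isolated in [S] every [l] qualifies. Uniqueness is supplied by [perfect_in] once [derive_in] has
    to be evaluated. *)
Definition slope_lim (R : realType) (S : set R) (f : R -> R) (x l : R) : Prop :=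
  (f y - f x) / (y - x) @[y --> within S x^'] --> l.

Definition is_der (R : realType) (S : set R) (f g : R -> R) : Prop :=
  forall x, S x -> slope_lim S f x (g x).

Definition cont_in (R : realType) (S : set R) (f : R -> R) : Prop :=
  forall x, S x -> f y @[y --> within S (nbhs x)] --> f x.

Definition cont2_in (R : realType) (S : set R) (f : R -> R -> R) : Prop :=
  forall u a, S a -> forall e, 0 < e -> exists2 d, 0 < d &
    forall v b, S b -> `|v - u| < d -> `|b - a| < d -> `|f v b - f u a| <= e.

Lemma cvg_near_eq (R : realType) (T : Type) (F : set_system T) {FF : Filter F}
    (f g : T -> R) (l : R) :
  (\forall t \near F, f t = g t) -> f @ F --> l -> g @ F --> l.
Proof.
move=> fg /cvgrPdist_le h; apply/cvgrPdist_le => e e0.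
by move: (h e e0); apply: filter_app; apply: filterS fg => t ->.
Qed.

Section slope.
Variable R : realType.
Implicit Types (S : set R) (f g : R -> R) (x l m : R).

Lemma slope_limP S f x l : slope_lim S f x l <->
  forall e, 0 < e -> exists2 d, 0 < d & forall y, S y -> `|y - x| < d ->
    `|f y - f x - l * (y - x)| <= e * `|y - x|.
Proof.
rewrite /slope_lim; split.
  move=> /cvgrPdist_le h e e0; have := h _ e0.
  move=> /nbhs_ballP[d d0 hd]; exists d => // y Sy yd.
  have [->|yx] := eqVneq y x; first by rewrite !subrr mulr0 subr0 normr0 mulr0.
  have yx0 : y - x != 0 by rewrite subr_eq0.
  have := hd y; rewrite /ball/= distrC => /(_ yd yx Sy) {}hd.
  have -> : f y - f x - l * (y - x) = - ((l - (f y - f x) / (y - x)) * (y - x)).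
    by field.
  by rewrite normrN normrM ler_pM2r// normr_gt0.
move=> h; apply/cvgrPdist_le => e e0; have [d d0 hd] := h _ e0.
apply/nbhs_ballP; exists d => // y; rewrite /ball/= distrC => yd yx Sy.
have yx0 : y - x != 0 by rewrite subr_eq0.
rewrite -(ler_pM2r (_ : 0 < `|y - x|)) ?normr_gt0// -normrM.
have -> : (l - (f y - f x) / (y - x)) * (y - x) = - (f y - f x - l * (y - x)).
  by field.
by rewrite normrN; exact: hd.
Qed.

Lemma cvg_withinP S f x l : f y @[y --> within S (nbhs x)] --> l <->
  forall e, 0 < e -> exists2 d, 0 < d & forall y, S y -> `|y - x| < d ->
    `|f y - l| <= e.
Proof.
split.
  move=> /cvgrPdist_le h e e0; have := h _ e0.
  move=> /nbhs_ballP[d d0 hd]; exists d => // y Sy yd.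
  by rewrite distrC; apply: hd => //; rewrite /ball/= distrC.
move=> h; apply/cvgrPdist_le => e e0; have [d d0 hd] := h _ e0.
apply/nbhs_ballP; exists d => // y; rewrite /ball/= distrC => yd Sy.
by rewrite distrC; exact: hd.
Qed.

Lemma within_dnbhs S x : within S x^' `=>` within S (nbhs x).
Proof. by move=> P; rewrite /within/= => /nbhs_dnbhs. Qed.

Lemma slope_lim_cvg S f x l : slope_lim S f x l ->
  f y @[y --> within S (nbhs x)] --> f x.
Proof.
move=> /slope_limP /(_ _ ltr01) [d d0 hd]; apply/cvg_withinP => e e0.
have l1 : 0 < `|l| + 1 by rewrite ltr_wpDl.
exists (Num.min d (e / (`|l| + 1))).
  by rewrite lt_min d0 divr_gt0.
move=> y Sy; rewrite lt_min => /andP[yd ye].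
have := hd y Sy yd; rewrite mul1r => h.
have -> : f y - f x = (f y - f x - l * (y - x)) + l * (y - x) by ring.
apply: le_trans (ler_normD _ _) _; rewrite normrM.
apply: le_trans (lerD h (lexx _)) _.
rewrite ltr_pdivlMr// in ye; apply: ltW; apply: le_lt_trans ye.
by rewrite mulrDr mulr1 addrC mulrC.
Qed.

Lemma is_der_cont S f g : is_der S f g -> cont_in S f.
Proof. by move=> h x Sx; apply: slope_lim_cvg (h x Sx). Qed.

Lemma slope_lim_dcvg S f x l : slope_lim S f x l ->
  f y @[y --> within S x^'] --> f x.
Proof.
by move=> /slope_lim_cvg; apply: cvg_trans; apply: cvg_app; exact: within_dnbhs.
Qed.

Lemma slope_lim_cst S c x : slope_lim S (fun=> c) x 0.
Proof.
apply/slope_limP => e e0; exists 1 => // y _ _.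
by rewrite subrr mul0r subr0 normr0 mulr_ge0// ltW.
Qed.

Lemma slope_lim_id S x : slope_lim S (fun y => y) x 1.
Proof.
apply/slope_limP => e e0; exists 1 => // y _ _.
by rewrite mul1r subrr normr0 mulr_ge0// ltW.
Qed.

Lemma slope_limD S f g x l m : slope_lim S f x l -> slope_lim S g x m ->
  slope_lim S (fun y => f y + g y) x (l + m).
Proof.
rewrite /slope_lim => hf hg; apply: (cvg_near_eq _ (cvgD hf hg)).
by apply: nearW => y /=; rewrite !fctE -mulrDl; congr (_ / _); ring.
Qed.

Lemma slope_limN S f x l : slope_lim S f x l ->
  slope_lim S (fun y => - f y) x (- l).
Proof.
rewrite /slope_lim => hf; apply: (cvg_near_eq _ (cvgN hf)).
by apply: nearW => y /=; rewrite !fctE -mulNr; congr (_ / _); ring.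
Qed.

Lemma slope_limB S f g x l m : slope_lim S f x l -> slope_lim S g x m ->
  slope_lim S (fun y => f y - g y) x (l - m).
Proof. by move=> hf /slope_limN; exact: slope_limD. Qed.

Lemma slope_limM S f g x l m : slope_lim S f x l -> slope_lim S g x m ->
  slope_lim S (fun y => f y * g y) x (l * g x + f x * m).
Proof.
move=> hf hg.
rewrite /slope_lim in hf hg *.
apply: (cvg_near_eq _ (cvgD (cvgM hf (slope_lim_dcvg hg)) (cvgM (cvg_cst (f x)) hg))).
apply: nearW => y; rewrite ?fctE /GRing.mul_fun /cst /=.
have [->|yx] := eqVneq y x; first by rewrite !subrr invr0 !(mulr0, mul0r) ?addr0.
by field; rewrite subr_eq0.
Qed.

Lemma slope_limV S f x l : f x != 0 -> slope_lim S f x l ->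
  slope_lim S (fun y => (f y)^-1) x (- l * (f x)^-1 * (f x)^-1).
Proof.
move=> fx0 hf; have cf := slope_lim_dcvg hf.
rewrite /slope_lim in hf *.
apply: (cvg_near_eq _ (cvgM (cvgM (cvgN hf) (cvgV fx0 cf)) (cvg_cst (f x)^-1))).
have : \forall y \near within S x^', f y != 0.
  have /cvgrPdist_lt/(_ `|f x|) := cf; rewrite normr_gt0 => /(_ fx0).
  by apply: filterS => y; apply: contraTneq => ->; rewrite subr0 ltxx.
apply: filterS => y fy0; rewrite ?fctE /GRing.mul_fun /cst /=.
have [->|yx] := eqVneq y x; first by rewrite !subrr invr0 !mulr0 oppr0 !mul0r.
by field; rewrite fx0 fy0 subr_eq0 yx.
Qed.

Lemma slope_lim_sqrt S f x l : (forall y, S y -> 0 <= f y) -> 0 < f x ->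
  slope_lim S f x l ->
  slope_lim S (fun y => Num.sqrt (f y)) x (l * (2 * Num.sqrt (f x))^-1).
Proof.
move=> f0 fx0 hf; have cf := slope_lim_dcvg hf.
have sx0 : 0 < Num.sqrt (f x) by rewrite sqrtr_gt0.
have cs : Num.sqrt (f y) @[y --> within S x^'] --> Num.sqrt (f x).
  exact: (continuous_cvg _ (@sqrt_continuous R (f x)) cf).
have dn : Num.sqrt (f x) + Num.sqrt (f x) != 0 by rewrite gt_eqF ?addr_gt0.
rewrite /slope_lim in hf *.
rewrite mulr_natl mulr2n.
apply: (cvg_near_eq _ (cvgM hf (cvgV dn (cvgD cs (cvg_cst (Num.sqrt (f x))))))).
have : \forall y \near within S x^', S y by exact: withinT.
apply: filterS => y Sy; rewrite ?fctE /GRing.mul_fun /cst /=.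
have sp : Num.sqrt (f y) + Num.sqrt (f x) != 0.
  by rewrite gt_eqF// ltr_wpDl// sqrtr_ge0.
have E : f y - f x = (Num.sqrt (f y) - Num.sqrt (f x)) *
    (Num.sqrt (f y) + Num.sqrt (f x)).
  by rewrite -subr_sqr !sqr_sqrtr ?(ltW fx0) ?f0.
have [->|yx] := eqVneq y x; first by rewrite !subrr invr0 !mulr0 !mul0r.
by rewrite E; field; rewrite sp subr_eq0 yx.
Qed.

Lemma slope_lim_eq S f g x l : S x -> (forall y, S y -> f y = g y) ->
  slope_lim S f x l -> slope_lim S g x l.
Proof.
move=> Sx fg /slope_limP h; apply/slope_limP => e /h [d d0 hd].
by exists d => // y Sy; rewrite -!fg//; exact: hd.
Qed.

Lemma interior_is_derive S f g x d : 0 < d -> (forall y, `|y - x| < d -> S y) ->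
  is_der S f g -> is_derive x 1 f (g x).
Proof.
move=> d0 hS h; have Sx : S x by apply: hS; rewrite subrr normr0.
have /slope_limP hx := h x Sx.
have c : (fun t : R => t^-1 *: (f (t *: (1 : R) + x) - f x)) @ 0^' --> g x.
  apply/cvgrPdist_le => e e0; have [d' d'0 hd] := hx _ e0.
  apply/nbhs_ballP; exists (Num.min d d'); first by rewrite /= lt_min d0.
  move=> t; rewrite /ball/= sub0r normrN lt_min => /andP[td td'] t0.
  have := hd (t + x); rewrite addrK => /(_ _ td') h2.
  have := h2 (hS _ _); rewrite addrK => /(_ td).
  move=> h3; rewrite scaler1 -(ler_pM2r (_ : 0 < `|t|)) ?normr_gt0// -normrM.
  have -> : (g x - t^-1 *: (f (t + x) - f x)) * t =
      - (f (t + x) - f x - g x * t) by rewrite /GRing.scale/=; field.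
  by rewrite normrN.
have dv : derivable f x 1 by apply/cvg_ex; exists (g x).
by apply: DeriveDef => //; exact: cvg_lim c.
Qed.

Lemma MVT_lt S f g x y : is_interval S -> is_der S f g -> S x -> S y -> x < y ->
  exists2 z, x < z < y & f y - f x = g z * (y - x).
Proof.
move=> iS h Sx Sy xy.
have [||z zi E] := @MVT R f g x y xy.
- move=> z; rewrite in_itv/= => /andP[xz zy].
  apply: (interior_is_derive (S := S) (d := Num.min (z - x) (y - z))) => //.
    by rewrite lt_min !subr_gt0 xz.
  move=> t; rewrite lt_min !ltr_norml => /andP[/andP[t1 _] /andP[_ t2]].
  apply: (iS x y) => //; apply/andP; split; lra.
- apply/subspace_continuousP => z /= zi.
  have Sz : S z.
    by move: zi; rewrite in_itv/=; exact: iS.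
  have := is_der_cont h Sz; apply: cvg_trans; apply: cvg_app.
  apply: within_subset => t /=; rewrite in_itv/=; exact: iS.
by exists z => //; rewrite in_itv/= in zi.
Qed.

(** Locating [z] by its distances to both ends treats all orders of [x] and [y] at once and suits
    neighbourhood estimates. *)
Lemma MVT_in S f g x y : is_interval S -> is_der S f g -> S x -> S y ->
  exists z, [/\ S z, `|z - x| <= `|y - x|, `|z - y| <= `|y - x| &
    f y - f x = g z * (y - x)].
Proof.
move=> iS h Sx Sy; have [xy|yx|->] := ltgtP x y.
- have [z /andP[z1 z2] E] := MVT_lt iS h Sx Sy xy.
  have Sz : S z by apply: (iS x y) => //; rewrite !ltW.
  exists z; split=> //.
    by rewrite !gtr0_norm ?subr_gt0// lerD2r ltW.
  rewrite (ltr0_norm (_ : z - y < 0)) ?subr_lt0// gtr0_norm ?subr_gt0//; lra.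
- have [z /andP[z1 z2] E] := MVT_lt iS h Sy Sx yx.
  have Sz : S z by apply: (iS y x) => //; rewrite !ltW.
  exists z; split=> //.
  + rewrite !ltr0_norm ?subr_lt0//; lra.
  + rewrite gtr0_norm ?subr_gt0// ltr0_norm ?subr_lt0//; lra.
  + by rewrite -(opprB x y) mulrN -E opprB.
- by exists y; rewrite !subrr normr0 mulr0.
Qed.

End slope.

(** * Joint differentiability and symmetry of mixed derivatives *)

Section joint.
Variable R : realType.
Implicit Types (S I : set R) (h : R -> R -> R).

Lemma is_interval_setT : is_interval [set: R].
Proof. by []. Qed.

(** It suffices that one partial derivative is jointly continuous and the other exists at the point:
    the first variable moves by the mean value theorem at the new parameter [b], the parameter moves
    with [u] held fixed. *)
Lemma joint_diff I h hu hb u a : is_interval I -> I a ->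
  (forall b, I b -> is_der setT (h ^~ b) (hu ^~ b)) ->
  is_der I (h u) (hb u) -> cont2_in I hu ->
  forall e, 0 < e -> exists2 d, 0 < d &
    forall v b, I b -> `|v - u| < d -> `|b - a| < d ->
    `|h v b - h u a - hu u a * (v - u) - hb u a * (b - a)|
      <= e * (`|v - u| + `|b - a|).
Proof.
move=> iI Ia du db cu e e0.
have [d1 d10 h1] := cu u a Ia e e0.
have /slope_limP/(_ e e0)[d2 d20 h2] := db a Ia.
exists (Num.min d1 d2); first by rewrite lt_min d10.
move=> v b Ib; rewrite !lt_min => /andP[v1 v2] /andP[b1 b2].
have [z [_ zu zv E]] := MVT_in (x := u) (y := v) is_interval_setT (du b Ib) Logic.I Logic.I.
have -> : h v b - h u a - hu u a * (v - u) - hb u a * (b - a) =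
    (hu z b - hu u a) * (v - u) + (h u b - h u a - hb u a * (b - a)).
  by rewrite mulrBl -E; ring.
apply: le_trans (ler_normD _ _) _; rewrite [leRHS]mulrDr.
apply: lerD; last exact: h2.
by rewrite normrM ler_wpM2r// h1// (le_lt_trans zu).
Qed.

Lemma slope_lim_comp2 S I h hu hb (u b : R -> R) x u' b' : is_interval I ->
  S x -> (forall y, S y -> I (b y)) ->
  (forall c, I c -> is_der setT (h ^~ c) (hu ^~ c)) ->
  (forall v, is_der I (h v) (hb v)) -> cont2_in I hu ->
  slope_lim S u x u' -> slope_lim S b x b' ->
  slope_lim S (fun y => h (u y) (b y)) x
    (hu (u x) (b x) * u' + hb (u x) (b x) * b').
Proof.
move=> iI Sx SI du db cu su sb; apply/slope_limP => e e0.
(* [A] bounds the sum of the two difference quotients near [x], each at most one more than its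
   limit; [M] bounds the gradient. Half of [e] pays for the nonlinearity of [h], half for that of
   [u] and [b]. *)
pose A := `|u'| + `|b'| + 2; pose M := `|hu (u x) (b x)| + `|hb (u x) (b x)| + 1.
have A0 : 0 < A by rewrite /A ltr_wpDl// addr_ge0.
have M0 : 0 < M by rewrite /M ltr_wpDl// addr_ge0.
have e1 : 0 < e / 2 / A by rewrite !divr_gt0.
have [d d0 hd] := joint_diff iI (SI x Sx) du (db (u x)) cu e1.
have /cvg_withinP cu' := slope_lim_cvg su.
have /cvg_withinP cb' := slope_lim_cvg sb.
have d2 : 0 < d / 2 by rewrite divr_gt0.
have [d3 d30 h3] := cu' _ d2; have [d4 d40 h4] := cb' _ d2.
pose r := Num.min 1 (e / 2 / M).
have r0 : 0 < r by rewrite /r lt_min ltr01 !divr_gt0.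
have /slope_limP/(_ r r0)[d5 d50 h5] := su.
have /slope_limP/(_ r r0)[d6 d60 h6] := sb.
exists (Num.min (Num.min d3 d4) (Num.min d5 d6)); first by rewrite !lt_min d30 d40 d50.
move=> y Sy; rewrite !lt_min => /andP[/andP[y3 y4] /andP[y5 y6]].
have {}h3 := h3 y Sy y3; have {}h4 := h4 y Sy y4.
have {}h5 := h5 y Sy y5; have {}h6 := h6 y Sy y6.
have dd : d / 2 < d by rewrite [ltRHS](splitr d) ltrDl.
have {}hd := hd (u y) (b y) (SI y Sy) (le_lt_trans h3 dd) (le_lt_trans h4 dd).
have bu : `|u y - u x| <= (`|u'| + 1) * `|y - x|.
  have -> : u y - u x = (u y - u x - u' * (y - x)) + u' * (y - x) by ring.
  apply: le_trans (ler_normD _ _) _; rewrite normrM [leRHS]mulrDl addrC lerD2l mul1r -[leRHS]mul1r.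
  by apply: le_trans h5 _; rewrite ler_wpM2r// /r ge_min lexx.
have bb : `|b y - b x| <= (`|b'| + 1) * `|y - x|.
  have -> : b y - b x = (b y - b x - b' * (y - x)) + b' * (y - x) by ring.
  apply: le_trans (ler_normD _ _) _; rewrite normrM [leRHS]mulrDl addrC lerD2l mul1r -[leRHS]mul1r.
  by apply: le_trans h6 _; rewrite ler_wpM2r// /r ge_min lexx.
set p := hu (u x) (b x) in hd M M0 r r0 h5 h6 *.
set q := hb (u x) (b x) in hd M M0 r r0 h5 h6 *.
have -> : h (u y) (b y) - h (u x) (b x) - (p * u' + q * b') * (y - x) =
  (h (u y) (b y) - h (u x) (b x) - p * (u y - u x) - q * (b y - b x)) +
  p * (u y - u x - u' * (y - x)) + q * (b y - b x - b' * (y - x)) by ring.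
have t1 : e / 2 / A * (`|u y - u x| + `|b y - b x|) <= e / 2 * `|y - x|.
  rewrite -[leLHS]mulrA ler_pM2l ?divr_gt0// mulrC ler_pdivrMr//.
  apply: le_trans (lerD bu bb) _; rewrite -mulrDl mulrC ler_wpM2l// /A; lra.
have t2 : (`|p| + `|q|) * (r * `|y - x|) <= e / 2 * `|y - x|.
  rewrite mulrA ler_wpM2r//.
  apply: (@le_trans _ _ (M * r)); first by rewrite ler_wpM2r ?(ltW r0)// /M lerDl.
  apply: (@le_trans _ _ (M * (e / 2 / M))).
    by rewrite ler_wpM2l ?(ltW M0)// /r ge_min lexx orbT.
  by rewrite mulrC divfK// gt_eqF.
rewrite [e in leRHS]splitr [leRHS]mulrDl.
apply: le_trans (ler_normD _ _) _.
apply: le_trans (lerD (ler_normD _ _) (lexx _)) _.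
rewrite -addrA lerD// ?(le_trans hd)//.
apply: le_trans t2; rewrite mulrDl !normrM.
by rewrite lerD// ler_wpM2l.
Qed.

(** Schwarz's theorem in the form that also yields existence: the mixed derivative taken parameter
    first is given, the other one is deduced. The second difference over a rectangle is the given
    derivative at an intermediate point, by two mean value theorems; the side in the first variable
    then shrinks to zero. *)
Lemma is_der_swap I h ha hu hau u : is_interval I ->
  (forall b, I b -> is_der setT (h ^~ b) (hu ^~ b)) ->
  (forall v, is_der I (h v) (ha v)) ->
  (forall b, I b -> is_der setT (ha ^~ b) (hau ^~ b)) ->
  cont2_in I hau ->
  is_der I (hu u) (hau u).
Proof.
move=> iI du da dau cau a Ia; apply/slope_limP => e e0.
have [d d0 hd] := cau u a Ia e e0; exists d => // b Ib bd.
have key v : `|v - u| < d ->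
    `|(h v b - h v a) - (h u b - h u a) - hau u a * (v - u) * (b - a)|
      <= e * `|b - a| * `|v - u|.
  move=> vd.
  have dK : is_der I (fun c => h v c - h u c) (fun c => ha v c - ha u c).
    by move=> c Ic; apply: slope_limB; exact: da.
  have [z [Iz za zb E]] := MVT_in iI dK Ia Ib.
  have [w [_ wu wv F]] :=
    MVT_in (x := u) (y := v) is_interval_setT (dau z Iz) Logic.I Logic.I.
  have -> : (h v b - h v a) - (h u b - h u a) - hau u a * (v - u) * (b - a) =
      (hau w z - hau u a) * (v - u) * (b - a).
    have -> : h v b - h v a - (h u b - h u a) = (ha v z - ha u z) * (b - a).
      by rewrite -E; ring.
    by rewrite F; ring.
  rewrite !normrM mulrAC ler_wpM2r// ler_wpM2r// hd//.
    exact: le_lt_trans wu vd.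
  exact: le_lt_trans za bd.
(* The side [t] in the first variable is chosen small with [b] fixed; the slack [n] absorbs the
   errors of the derivatives [hu] at [a] and at [b]. *)
apply/ler_addgt0Pr => n n0.
have n2 : 0 < n / 2 by rewrite divr_gt0.
have /slope_limP/(_ _ n2)[d1 d10 h1] := du a Ia u Logic.I.
have /slope_limP/(_ _ n2)[d2 d20 h2] := du b Ib u Logic.I.
pose t := Num.min d (Num.min d1 d2) / 2.
have m0 : 0 < Num.min d (Num.min d1 d2) by rewrite !lt_min d0 d10.
have t0 : 0 < t by rewrite /t divr_gt0.
have tm : t < Num.min d (Num.min d1 d2).
  by rewrite /t [ltRHS](splitr (Num.min _ _)) ltrDl divr_gt0.
have E : `|u + t - u| = t by rewrite addrC addKr gtr0_norm.
move: tm; rewrite !lt_min => /and3P[t1 t2 t3].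
have {}h1 := h1 (u + t) Logic.I; have {}h2 := h2 (u + t) Logic.I; have {}key := key (u + t).
rewrite E in h1 h2 key; have {}h1 := h1 t2; have {}h2 := h2 t3.
have {}key := key t1.
have E' : u + t - u = t by ring.
rewrite E' in h1 h2 key.
rewrite -(ler_pM2r t0) -[t in leLHS](gtr0_norm t0) -normrM.
have -> : (hu u b - hu u a - hau u a * (b - a)) * t =
  (h (u + t) b - h (u + t) a - (h u b - h u a) - hau u a * t * (b - a)) -
  (h (u + t) b - h u b - hu u b * t) + (h (u + t) a - h u a - hu u a * t).
  ring.
apply: le_trans (ler_normD _ _) _.
apply: le_trans (lerD (ler_normB _ _) (lexx _)) _.
apply: le_trans (lerD (lerD key h2) h1) _.
by rewrite -!mulrDl -addrA -splitr.
Qed.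

End joint.

(** * Families with uniformly bounded derivatives *)

Definition ubounded (R : realType) (J : Type) (S : set R) (f : J -> R -> R) :=
  exists B, forall j x, S x -> `|f j x| <= B.

(* Families of functions that are [C^k] on [S], with bounds on the derivatives
   that do not depend on the index. *)
Fixpoint UC (R : realType) (J : Type) (S : set R) (k : nat) (f : J -> R -> R) :
    Prop :=
  ubounded S f /\
  match k with
  | 0 => forall j, cont_in S (f j)
  | k'.+1 => exists2 g : J -> R -> R,
      forall j, is_der S (f j) (g j) & UC S k' g
  end.

Section UC.
Variables (R : realType) (J : Type) (S : set R).
Implicit Types f g : J -> R -> R.

Lemma UC_bounded k f : UC S k f -> ubounded S f.
Proof. by case: k => [|k] []. Qed.

Lemma UC_cont k f j : UC S k f -> cont_in S (f j).
Proof. by case: k => [|k] [_] // [g dg _]; exact: is_der_cont (dg j). Qed.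

Lemma UC_pred k f : UC S k.+1 f -> UC S k f.
Proof.
elim: k f => [|k IH] f [bf [g dg ug]]; split=> //.
  by move=> j; exact: is_der_cont (dg j).
by exists g => //; exact: IH.
Qed.

Lemma UC_eq k f g : (forall j x, S x -> f j x = g j x) -> UC S k f -> UC S k g.
Proof.
move=> fg; case: k => [|k] [[B bf] h].
- split; first by exists B => j x Sx; rewrite -fg//; exact: bf.
  move=> j x Sx; apply/cvg_withinP => e e0.
  have /cvg_withinP/(_ e e0)[d d0 hd] := h j x Sx.
  by exists d => // y Sy; rewrite -!fg//; exact: hd.
- split; first by exists B => j x Sx; rewrite -fg//; exact: bf.
  case: h => f' df uf; exists f' => // j x Sx.
  by apply: slope_lim_eq (df j x Sx) => // y Sy; exact: fg.
Qed.

Lemma ubounded_cst (c : J -> R) : (exists B, forall j, `|c j| <= B) ->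
  ubounded S (fun j _ => c j).
Proof. by move=> [B hB]; exists B. Qed.

Lemma UC_cst k (c : J -> R) : (exists B, forall j, `|c j| <= B) ->
  UC S k (fun j _ => c j).
Proof.
elim: k c => [|k IH] c hc; split; try exact: ubounded_cst.
  by move=> j x Sx; exact: cvg_cst.
exists (fun _ _ => 0); first by move=> j x Sx; exact: slope_lim_cst.
by apply: (IH (fun=> 0)); exists 0 => j; rewrite normr0.
Qed.

Lemma uboundedD f g : ubounded S f -> ubounded S g ->
  ubounded S (fun j x => f j x + g j x).
Proof.
move=> [A hA] [B hB]; exists (A + B) => j x Sx.
by apply: le_trans (ler_normD _ _) _; rewrite lerD ?hA ?hB.
Qed.

Lemma uboundedM f g : ubounded S f -> ubounded S g ->
  ubounded S (fun j x => f j x * g j x).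
Proof.
move=> [A hA] [B hB]; exists (A * B) => j x Sx.
by rewrite normrM ler_pM ?hA ?hB.
Qed.

Lemma UC_add k f g : UC S k f -> UC S k g -> UC S k (fun j x => f j x + g j x).
Proof.
elim: k f g => [|k IH] f g [bf cf] [bg cg]; split; try exact: uboundedD.
  by move=> j x Sx; apply: cvgD; [exact: cf|exact: cg].
case: cf => f' df uf; case: cg => g' dg ug.
exists (fun j x => f' j x + g' j x); last exact: IH.
by move=> j x Sx; apply: slope_limD; [exact: df|exact: dg].
Qed.

Lemma UC_mul k f g : UC S k f -> UC S k g -> UC S k (fun j x => f j x * g j x).
Proof.
elim: k f g => [|k IH] f g uf ug; split;
  try (apply: uboundedM; apply: UC_bounded; [exact: uf|exact: ug]).
  by move=> j x Sx; apply: cvgM; [exact: uf.2|exact: ug.2].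
have [_ [f' df uf']] := uf; have [_ [g' dg ug']] := ug.
exists (fun j x => f' j x * g j x + f j x * g' j x).
  by move=> j x Sx; apply: slope_limM; [exact: df|exact: dg].
by apply: UC_add; apply: IH => //; exact: UC_pred.
Qed.

Lemma UC_opp k f : UC S k f -> UC S k (fun j x => - f j x).
Proof.
move=> uf; apply: (@UC_eq k (fun j x => (fun _ _ => -1) j x * f j x)).
  by move=> j x _; rewrite mulN1r.
by apply: UC_mul => //; apply: UC_cst; exists 1 => _; rewrite normrN normr1.
Qed.

Lemma UC_sub k f g : UC S k f -> UC S k g -> UC S k (fun j x => f j x - g j x).
Proof. by move=> uf /UC_opp; exact: UC_add. Qed.

Lemma UC_inv k f m : 0 < m -> (forall j x, S x -> m <= `|f j x|) ->
  UC S k f -> UC S k (fun j x => (f j x)^-1).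
Proof.
move=> m0 hm.
have fn0 j x : S x -> f j x != 0.
  by move=> Sx; rewrite -normr_gt0; exact: lt_le_trans (hm j x Sx).
have bV : ubounded S (fun j x => (f j x)^-1).
  exists m^-1 => j x Sx; rewrite normfV lef_pV2 ?posrE ?normr_gt0 ?fn0//.
  exact: hm.
elim: k => [|k IH] uf; split=> //.
  by move=> j x Sx; apply: cvgV; [exact: fn0|exact: uf.2].
have [_ [f' df uf']] := uf.
exists (fun j x => - f' j x * (f j x)^-1 * (f j x)^-1).
  by move=> j x Sx; apply: slope_limV; [exact: fn0|exact: df].
have uV := IH (UC_pred uf).
by apply: UC_mul => //; apply: UC_mul => //; exact: UC_opp.
Qed.

Lemma UC_sqrt k f m : 0 < m -> (forall j x, S x -> m <= f j x) ->
  UC S k f -> UC S k (fun j x => Num.sqrt (f j x)).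
Proof.
move=> m0 hm.
have f0 j x : S x -> 0 < f j x by move=> Sx; exact: lt_le_trans (hm j x Sx).
have bs : ubounded S f -> ubounded S (fun j x => Num.sqrt (f j x)).
  move=> [B hB]; exists (Num.sqrt B) => j x Sx.
  rewrite ger0_norm ?sqrtr_ge0// ler_wsqrtr//.
  by apply: le_trans (hB j x Sx); exact: ler_norm.
elim: k => [|k IH] uf; split; try (apply: bs; exact: UC_bounded uf).
  move=> j x Sx.
  exact: (continuous_cvg _ (@sqrt_continuous R (f j x)) (uf.2 j x Sx)).
have [_ [f' df uf']] := uf.
exists (fun j x => f' j x * (2 * Num.sqrt (f j x))^-1).
  move=> j x Sx; apply: slope_lim_sqrt; [|exact: f0|exact: df].
  by move=> y /(f0 j)/ltW.
apply: UC_mul => //; apply: (@UC_inv k _ (2 * Num.sqrt m)).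
- by rewrite mulr_gt0 ?sqrtr_gt0.
- move=> j x Sx; rewrite ger0_norm ?mulr_ge0 ?sqrtr_ge0//.
  by rewrite ler_pM2l// ler_wsqrtr// hm.
apply: UC_mul; last by apply: IH; exact: UC_pred.
by apply: UC_cst; exists 2 => _; rewrite ger0_norm.
Qed.

End UC.

Lemma UC_reindex (R : realType) (J J' : Type) (S : set R) k (s : J' -> J)
    (f : J -> R -> R) : UC S k f -> UC S k (fun j => f (s j)).
Proof.
elim: k f => [|k IH] f [[B bf] cf]; split; try by exists B => j; exact: bf.
  by move=> j; exact: cf.
by case: cf => g dg ug; exists (fun j => g (s j)) => //; exact: IH.
Qed.

(** [H p q] stands for the partial derivative of order [p] in the first variable and [q] in the
    parameter. Differentiability in the parameter is asked at [p = 0], which is what derivatives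
    taken parameter first provide; [sf_a] extends it to all [p] by exchanging derivatives. *)
Record smooth_family (R : realType) (I : set R) (r r' : nat)
    (H : nat -> nat -> R -> R -> R) : Prop := SmoothFamily {
  sf_u : forall p q, (p < r)%N -> (q <= r')%N -> forall c, I c ->
    is_der setT (H p q ^~ c) (H p.+1 q ^~ c);
  sf_a0 : forall q v, (q < r')%N -> is_der I (H 0 q v) (H 0 q.+1 v);
  sf_cont : forall p q, (p <= r)%N -> (q <= r')%N -> cont2_in I (H p q)
}.

Lemma sf_a (R : realType) (I : set R) r r' H p q v : is_interval I ->
  @smooth_family R I r r' H -> (p <= r)%N -> (q < r')%N ->
  is_der I (H p q v) (H p q.+1 v).
Proof.
move=> iI [du da ct]; elim: p v => [|p IH] v pr qr; first exact: da.
apply: (is_der_swap (h := H p q) (ha := H p q.+1) (hu := H p.+1 q)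
  (hau := H p.+1 q.+1) (u := v) iI).
- by move=> b Ib; apply: du => //; exact: ltnW.
- by move=> w; apply: IH => //; exact: ltnW.
- by move=> b Ib; apply: du.
- exact: ct.
Qed.

(** One differentiation turns [H p q] into [H p.+1 q] times [u'] plus [H p q.+1], which costs an
    order in each variable. The partial derivatives are bounded along the graphs of [u], where
    uniformity in the index is available. *)
Lemma UC_comp (R : realType) (J : Type) (I S : set R) r r'
    (H : J -> nat -> nat -> R -> R -> R) (u : J -> R -> R) n p q :
  is_interval I -> S `<=` I ->
  (forall j, smooth_family I r r' (H j)) ->
  (forall p q, (p <= r)%N -> (q <= r')%N ->
    ubounded S (fun j y => H j p q (u j y) y)) ->
  (p + n <= r)%N -> (q + n <= r')%N ->
  UC S n u -> UC S n (fun j y => H j p q (u j y) y).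
Proof.
move=> iI SI sH bH.
elim: n p q => [|n IH] p q pr qr uu.
  rewrite !addn0 in pr qr; split; first exact: bH.
  move=> j x Sx; apply/cvg_withinP => e e0.
  have [d d0 hd] := sf_cont (sH j) pr qr (u j x) (SI _ Sx) e0.
  have d2 : 0 < d / 2 by rewrite divr_gt0.
  have /cvg_withinP/(_ _ d2)[d1 d10 h1] := uu.2 j x Sx.
  exists (Num.min d d1); first by rewrite lt_min d0.
  move=> y Sy; rewrite lt_min => /andP[y1 y2]; apply: hd => //; first exact: SI.
  by apply: le_lt_trans (h1 y Sy y2) _; rewrite [ltRHS](splitr d) ltrDl.
have pr' : (p < r)%N by rewrite (leq_trans _ pr)// -addSnnS leq_addr.
have qr' : (q < r')%N by rewrite (leq_trans _ qr)// -addSnnS leq_addr.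
split; first by apply: bH; exact: ltnW.
have [_ [u' du uu']] := uu.
exists (fun j y => H j p.+1 q (u j y) y * u' j y + H j p q.+1 (u j y) y * 1).
  move=> j x Sx.
  apply: (slope_lim_comp2 (I := I) (h := H j p q) (hu := H j p.+1 q)
    (hb := H j p q.+1) (b := fun y => y)) => //.
  - by move=> c Ic; apply: (sf_u (sH j)) => //; exact: ltnW.
  - by move=> v; apply: (sf_a (r := r) (r' := r')) => //; exact: ltnW.
  - by apply: (sf_cont (sH j)) => //; exact: ltnW.
  - exact: du.
  - exact: slope_lim_id.
have un := UC_pred uu.
apply: UC_add; apply: UC_mul => //.
- by apply: IH => //; [rewrite addSnnS|rewrite ltnW// -addnS].
- by apply: IH => //; [rewrite ltnW// -addnS|rewrite addSnnS].
- by apply: UC_cst; exists 1 => _; rewrite normr1.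
Qed.

Lemma slope_bound (R : realType) (S : set R) (f g : R -> R) (B x y : R) :
  is_interval S -> is_der S f g -> (forall z, S z -> `|g z| <= B) ->
  S x -> S y -> `|(f y - f x) / (y - x)| <= B.
Proof.
move=> iS df hB Sx Sy; have [z [Sz _ _ ->]] := MVT_in iS df Sx Sy.
have [->|yx] := eqVneq y x.
  by rewrite subrr invr0 mulr0 normr0 (le_trans _ (hB x Sx)).
by rewrite mulfK ?subr_eq0//; exact: hB.
Qed.

Lemma within_dnbhs_neq (R : realType) (S : set R) (x : R) :
  \forall y \near within S x^', S y /\ y != x.
Proof. by apply: filterS (nbhs_dnbhs_neq x) => y yx Sy. Qed.

Lemma row_sub (R : realType) (a b c v w : int -> R) j :
  row a b c (fun i => v i - w i) j = row a b c v j - row a b c w j.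
Proof. by rewrite /row; ring. Qed.

Lemma row_scale (R : realType) (a b c v : int -> R) t j :
  row a b c (fun i => v i * t) j = row a b c v j * t.
Proof. by rewrite /row; ring. Qed.

Lemma row_coef_sub (R : realType) (a b c a' b' c' v : int -> R) j :
  row (fun i => a i - a' i) (fun i => b i - b' i) (fun i => c i - c' i) v j =
  row a b c v j - row a' b' c' v j.
Proof. by rewrite /row; ring. Qed.

Lemma row_bound (R : realType) (a b c v : int -> R) A B C V j :
  `|a j| <= A -> `|b j| <= B -> `|c j| <= C -> (forall i, `|v i| <= V) ->
  `|row a b c v j| <= (A + B + C) * V.
Proof.
move=> ha hb hc hv; rewrite /row !mulrDl.
apply: le_trans (ler_normD _ _) _; apply: lerD; last by rewrite normrM ler_pM.
by apply: le_trans (ler_normD _ _) _; rewrite lerD// normrM ler_pM.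
Qed.

Lemma cvg_row (R : realType) (T : Type) (F : set_system T) {FF : Filter F}
    (a b c v : int -> T -> R) (a' b' c' v' : int -> R) j :
  a j @ F --> a' j -> b j @ F --> b' j -> c j @ F --> c' j ->
  (forall i, v i @ F --> v' i) ->
  row (a ^~ t) (b ^~ t) (c ^~ t) (v ^~ t) j @[t --> F] --> row a' b' c' v' j.
Proof.
by move=> ha hb hc hv; apply: cvgD; [apply: cvgD|]; apply: cvgM => //; exact: hv.
Qed.

(** The derivative of [w] is found as the bounded solution [g] of the formally differentiated
    system, which has the same matrix. The difference quotients of [w] satisfy that system up to
    terms vanishing row by row, so [dominant_cvg0] brings them to [g]. *)
Lemma lin_smooth (R : realType) (S : set R) (k B W : R) n
    (a b c d w : int -> R -> R) :
  is_interval S -> 0 < k ->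
  (forall x, S x -> dominant k B (a ^~ x) (b ^~ x) (c ^~ x)) ->
  UC S n a -> UC S n b -> UC S n c -> UC S n d ->
  (forall j x, S x -> `|w j x| <= W) ->
  (forall j x, S x -> row (a ^~ x) (b ^~ x) (c ^~ x) (w ^~ x) j + d j x = 0) ->
  UC S n w.
Proof.
move=> iS k0 dom; elim: n d w W => [|n IH] d w W ua ub uc ud hW hw.
- split; first by exists W.
  move=> j x Sx; rewrite -[X in _ --> X]add0r.
  suff : (fun y => w j y - w j x) @ within S (nbhs x) --> (0 : R).
    move=> /cvgD/(_ (cvg_cst (w j x))); apply: cvg_near_eq.
    by apply: nearW => y; rewrite fctE /cst subrK.
  have SS : \forall y \near within S (nbhs x), S y by exact: withinT.
  apply: (dominant_cvg0 (F := within S (nbhs x))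
    (y := fun y i => w i y - w i x) (W := W + W) k0 (dom x Sx)).
    apply: filterS SS => y Sy i.
    by apply: le_trans (ler_normB _ _) _; rewrite lerD ?hW.
  move=> {}j.
  (* M(x) (w(y) - w(x)) = - (M(y) - M(x)) w(y) - (d(y) - d(x)) *)
  apply: (@cvg_near_eq _ _ _ _ (fun y =>
    - (row (fun i => a i y - a i x) (fun i => b i y - b i x)
        (fun i => c i y - c i x) (w ^~ y) j) - (d j y - d j x))).
    apply: filterS SS => y Sy; rewrite row_coef_sub row_sub.
    by move: (hw j y Sy) (hw j x Sx) => /eqP + /eqP; rewrite !addr_eq0 => /eqP -> /eqP ->; ring.
  have dif f : UC S 0 f -> f j y - f j x @[y --> within S (nbhs x)] --> (0 : R).
    by move=> uf; rewrite -(subrr (f j x)); apply: cvgB; [exact: uf.2|exact: cvg_cst].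
  rewrite -[X in _ --> X](subrr (0 : R)) -[in X in _ --> X]oppr0.
  apply: cvgB; last by rewrite oppr0; exact: dif.
  apply: cvgN; apply/cvgrPdist_le => e e0.
  have W0 : 0 <= W by apply: le_trans (hW 0 x Sx).
  have e1 : 0 < e / (W + 1) / 3 by rewrite !divr_gt0// ltr_wpDl.
  have /cvgrPdist_le/(_ _ e1) ha := dif a ua.
  have /cvgrPdist_le/(_ _ e1) hb := dif b ub.
  have /cvgrPdist_le/(_ _ e1) hc := dif c uc.
  near=> y; rewrite sub0r normrN.
  have Sy : S y by near: y.
  apply: (@le_trans _ _ ((e / (W + 1) / 3 + e / (W + 1) / 3 + e / (W + 1) / 3) * W)).
    apply: row_bound.
    + by rewrite -normrN -sub0r; near: y.
    + by rewrite -normrN -sub0r; near: y.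
    + by rewrite -normrN -sub0r; near: y.
    + by move=> i; exact: hW.
  have -> : e / (W + 1) / 3 + e / (W + 1) / 3 + e / (W + 1) / 3 = e / (W + 1).
    by field; rewrite gt_eqF// ltr_wpDl.
  rewrite mulrAC ler_pdivrMr ?ltr_wpDl// ler_pM2l// lerDl//.
- have [_ [a' da ua']] := ua; have [_ [b' db ub']] := ub.
  have [_ [c' dc uc']] := uc; have [_ [d' dd ud']] := ud.
  (* The induction hypothesis is used twice: here on [w], so that the new right-hand side [d1] has
     class [n], and below on the derivative. *)
  have uw : UC S n w by apply: (IH d w W) => //; exact: UC_pred.
  pose d1 j x := row (a' ^~ x) (b' ^~ x) (c' ^~ x) (w ^~ x) j + d' j x.
  have ud1 : UC S n d1.
    apply: UC_add => //; apply: UC_add; first apply: UC_add.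
    + by apply: UC_mul => //; apply: (UC_reindex (fun j => j - 1)).
    + exact: UC_mul.
    + by apply: UC_mul => //; apply: (UC_reindex (fun j => j + 1)).
  have [D hD] := UC_bounded ud1.
  have [A hA] := UC_bounded ua'; have [B' hB'] := UC_bounded ub'.
  have [C hC] := UC_bounded uc'; have [D' hD'] := UC_bounded ud'.
  have solve x : S x -> exists g : int -> R, (forall j, `|g j| <= D / k) /\
      forall j, row (a ^~ x) (b ^~ x) (c ^~ x) g j + d1 j x = 0.
    move=> Sx; apply: (dominant_solve k0 (dom x Sx)) => [|j].
      by rewrite divr_ge0 ?(ltW k0)// (le_trans _ (hD 0 x Sx)).
    by rewrite mulrC divfK ?gt_eqF//; exact: hD.
  have /choice[g hg] : forall x, exists g : int -> R, S x ->
      (forall j, `|g j| <= D / k) /\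
      forall j, row (a ^~ x) (b ^~ x) (c ^~ x) g j + d1 j x = 0.
    move=> x; have [Sx|nS] := pselect (S x); last by exists (fun=> 0).
    by have [g hg] := solve x Sx; exists g.
  split; first by exists W.
  exists (fun j x => g x j); last first.
    apply: (IH d1 _ (D / k)) => //; try exact: UC_pred.
      by move=> j x Sx; have [h _] := hg x Sx; exact: h.
    by move=> j x Sx; have [_ h] := hg x Sx; exact: h.
  move=> j x Sx; have [g1 g2] := hg x Sx.
  have near_S := within_dnbhs_neq S x.
  pose sl (f : int -> R -> R) i y := (f i y - f i x) / (y - x).
  have rowsl i y : S y -> row (a ^~ x) (b ^~ x) (c ^~ x) (sl w ^~ y) i =
     - row (sl a ^~ y) (sl b ^~ y) (sl c ^~ y) (w ^~ y) i - sl d i y.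
    move=> Sy; move: (hw i y Sy) (hw i x Sx) => /eqP + /eqP.
    rewrite !addr_eq0 => /eqP e1 /eqP e2; rewrite /sl row_scale row_sub e2.
    have -> : row (fun j => (a j y - a j x) / (y - x))
       (fun j => (b j y - b j x) / (y - x)) (fun j => (c j y - c j x) / (y - x))
       (w ^~ y) i = (row (a ^~ y) (b ^~ y) (c ^~ y) (w ^~ y) i -
         row (a ^~ x) (b ^~ x) (c ^~ x) (w ^~ y) i) / (y - x).
      by rewrite -row_coef_sub /row; ring.
    by rewrite e1; ring.
  have W0 : 0 <= W by apply: le_trans (hW 0 x Sx).
  pose E := ((A + B' + C) * W + D') / k.
  have rsb i y : S y -> `|row (a ^~ x) (b ^~ x) (c ^~ x) (sl w ^~ y) i| <= k * E.
    move=> Sy; rewrite rowsl// /E mulrC divfK ?gt_eqF//.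
    apply: le_trans (ler_normB _ _) _; rewrite normrN; apply: lerD.
      apply: row_bound; last by move=> l; exact: hW.
      - by apply: slope_bound (da i) _ _ _ => // z; exact: hA.
      - by apply: slope_bound (db i) _ _ _ => // z; exact: hB'.
      - by apply: slope_bound (dc i) _ _ _ => // z; exact: hC.
    by apply: slope_bound (dd i) _ _ _ => // z; exact: hD'.
  have E0 : 0 <= E.
    by rewrite -(pmulr_rge0 _ k0); apply: le_trans (rsb 0 x Sx).
  have slb y : S y -> forall i, `|sl w i y| <= E.
    (* The obvious bound blows up as [y] approaches [x]; [dominant_le] trades it for [E]. *)
    move=> Sy; apply: (dominant_le (W := (W + W) * `|y - x|^-1) k0 (dom x Sx)) => //.
      move=> i; rewrite normrM normfV ler_wpM2r ?invr_ge0//.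
      by apply: le_trans (ler_normB _ _) _; rewrite lerD ?hW.
    by move=> i; exact: rsb.
  suff : (fun y => sl w j y - g x j) @ within S x^' --> (0 : R).
    move=> /cvgD/(_ (cvg_cst (g x j))); rewrite add0r; apply: cvg_near_eq.
    by apply: nearW => y; rewrite fctE /cst subrK.
  apply: (dominant_cvg0 (F := within S x^')
    (y := fun y i => sl w i y - g x i) (W := E + D / k) k0 (dom x Sx)).
    apply: filterS near_S => y [Sy _] i.
    by apply: le_trans (ler_normB _ _) _; rewrite lerD ?g1// slb.
  move=> i.
  apply: (@cvg_near_eq _ _ _ _ (fun y =>
    - row (sl a ^~ y) (sl b ^~ y) (sl c ^~ y) (w ^~ y) i - sl d i y + d1 i x)).
    apply: filterS near_S => y [Sy _]; rewrite row_sub rowsl//.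
    by have /eqP := g2 i; rewrite addr_eq0 => /eqP ->; ring.
  have -> : (0 : R) = - row (a' ^~ x) (b' ^~ x) (c' ^~ x) (w ^~ x) i - d' i x + d1 i x.
    by rewrite /d1; ring.
  apply: cvgD; last exact: cvg_cst.
  apply: cvgB; last exact: dd.
  apply: cvgN; apply: (cvg_row (v := w)).
  + exact: da. + exact: db. + exact: dc.
  + move=> l; have := UC_cont (j := l) uw Sx; apply: cvg_trans; apply: cvg_app.
    exact: within_dnbhs.
Unshelve. all: by end_near. Qed.

(** * Chains of equations *)

Definition cont4_in (R : realType) (q : R) (S : set R)
    (G : R -> R -> R -> R -> R) : Prop :=
  forall x1 x2 x3 al, `|x1| <= q -> `|x2| <= q -> `|x3| <= q -> S al ->
  forall e, 0 < e -> exists2 d, 0 < d & forall y1 y2 y3 be,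
    `|y1| <= q -> `|y2| <= q -> `|y3| <= q -> S be ->
    `|y1 - x1| < d -> `|y2 - x2| < d -> `|y3 - x3| < d -> `|be - al| < d ->
    `|G y1 y2 y3 be - G x1 x2 x3 al| <= e.

(* [F] is a chain of equations coupling nearest neighbours and depending on a
   parameter in [S]; [a], [b], [c], [D] are its partial derivatives. *)
Record chain_system (R : realType) (S : set R) (q k B Db al0 : R)
    (F a b c D : int -> R -> R -> R -> R -> R) : Prop := ChainSystem {
  cs_q : 0 <= q;
  cs_k : 0 < k;
  cs_al0 : S al0;
  cs_int : is_interval S;
  cs_mv : forall j x1 x2 x3 y1 y2 y3 al be,
    `|x1| <= q -> `|x2| <= q -> `|x3| <= q ->
    `|y1| <= q -> `|y2| <= q -> `|y3| <= q -> S al -> S be ->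
    exists t, 0 <= t <= 1 /\
      let z1 := x1 + t * (y1 - x1) in let z2 := x2 + t * (y2 - x2) in
      let z3 := x3 + t * (y3 - x3) in let ga := al + t * (be - al) in
      F j y1 y2 y3 be - F j x1 x2 x3 al =
        a j z1 z2 z3 ga * (y1 - x1) + b j z1 z2 z3 ga * (y2 - x2) +
        c j z1 z2 z3 ga * (y3 - x3) + D j z1 z2 z3 ga * (be - al);
  cs_dom : forall j x1 x2 x3 al,
    `|x1| <= q -> `|x2| <= q -> `|x3| <= q -> S al ->
    `|a j x1 x2 x3 al| + `|c j x1 x2 x3 al| + k <= b j x1 x2 x3 al <= B;
  cs_D : forall j x1 x2 x3 al,
    `|x1| <= q -> `|x2| <= q -> `|x3| <= q -> S al ->
    `|D j x1 x2 x3 al| <= Db;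
  cs_base : forall j, F j 0 0 0 al0 = 0;
  cs_small : forall al, S al -> Db * `|al - al0| <= k * q;
  cs_conta : forall j, cont4_in q S (a j);
  cs_contb : forall j, cont4_in q S (b j);
  cs_contc : forall j, cont4_in q S (c j);
  cs_contD : forall j, cont4_in q S (D j)
}.

Definition along (R : realType) (G : int -> R -> R -> R -> R -> R)
    (u : int -> R -> R) (j : int) (al : R) : R :=
  G j (u (j - 1) al) (u j al) (u (j + 1) al) al.

Lemma between_le (R : realType) (q x y t : R) : 0 <= t <= 1 ->
  `|x| <= q -> `|y| <= q -> `|x + t * (y - x)| <= q.
Proof.
move=> /andP[t0 t1] hx hy.
have -> : x + t * (y - x) = (1 - t) * x + t * y by ring.
apply: le_trans (ler_normD _ _) _; rewrite !normrM (ger0_norm t0).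
rewrite ger0_norm ?subr_ge0//.
have -> : q = (1 - t) * q + t * q by ring.
by apply: lerD; rewrite ler_wpM2l// subr_ge0.
Qed.

Lemma between_S (R : realType) (S : set R) (x y t : R) : is_interval S ->
  0 <= t <= 1 -> S x -> S y -> S (x + t * (y - x)).
Proof.
move=> iS /andP[t0 t1] Sx Sy; have [xy|yx] := leP x y.
  by apply: (iS x y) => //; apply/andP; split; nra.
by apply: (iS y x) => //; apply/andP; split; nra.
Qed.

Lemma between_close (R : realType) (x y t d : R) : 0 <= t <= 1 ->
  `|y - x| < d -> `|x + t * (y - x) - x| < d.
Proof.
move=> /andP[t0 t1]; apply: le_lt_trans.
have -> : x + t * (y - x) - x = t * (y - x) by ring.
by rewrite normrM (ger0_norm t0) ler_piMl.
Qed.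

Section chain.
Variables (R : realType) (S : set R) (q k B Db al0 : R).
Variables F a b c D : int -> R -> R -> R -> R -> R.
Hypothesis cs : chain_system S q k B Db al0 F a b c D.

Definition chain_sol (u : int -> R -> R) : Prop :=
  forall al, S al -> forall j, `|u j al| <= q /\ along F u j al = 0.

Lemma chain_B : 0 < B.
Proof.
have q0 := cs_q cs; have k0 := cs_k cs.
have z0 : `|0 : R| <= q by rewrite normr0.
have /andP[h1 h2] := cs_dom cs 0 z0 z0 z0 (cs_al0 cs).
by apply: lt_le_trans h2; apply: lt_le_trans h1; rewrite ltr_wpDl// addr_ge0.
Qed.

(** At a fixed parameter the relaxation starts from the zero sequence, which solves the chain at
    [al0]. The residual it leaves at [al] is at most [k * q] by [cs_small], which keeps the iterates
    in the ball of radius [q]. *)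
Lemma chain_exists : exists u, chain_sol u.
Proof.
have q0 := cs_q cs; have k0 := cs_k cs; have B0 := chain_B.
have z0 : `|0 : R| <= q by rewrite normr0.
have dom0 : dominant k B (fun j => a j 0 0 0 al0) (fun j => b j 0 0 0 al0)
    (fun j => c j 0 0 0 al0).
  by move=> j; exact: (cs_dom cs j z0 z0 z0 (cs_al0 cs)).
have [_ th] := dominant_ratio k0 dom0.
have sol al : S al -> exists v : int -> R, (forall j, `|v j| <= q) /\
    forall j, F j (v (j - 1)) (v j) (v (j + 1)) al = 0.
  move=> Sal.
  apply: (@chain_solve R (fun j x1 x2 x3 => F j x1 x2 x3 al) _ q B th q0 B0).
  - move=> j x1 x2 x3 y1 y2 y3 M hx1 hx2 hx3 hy1 hy2 hy3 h1 h2 h3.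
    have [t [t01]] := cs_mv cs j hx1 hx2 hx3 hy1 hy2 hy3 Sal Sal.
    cbv zeta; rewrite subrr !mulr0 addr0 => E.
    have := cs_dom cs j (between_le t01 hx1 hy1) (between_le t01 hx2 hy2)
      (between_le t01 hx3 hy3) Sal.
    rewrite addr0 in E.
    set a' := a j _ _ _ _ in E *; set b' := b j _ _ _ _ in E *.
    set c' := c j _ _ _ _ in E * => dj.
    have -> : y2 - F j y1 y2 y3 al / B - (x2 - F j x1 x2 x3 al / B) =
        ((B - b') * (y2 - x2) - a' * (y1 - x1) - c' * (y3 - x3)) / B.
      have -> : F j y1 y2 y3 al = F j x1 x2 x3 al +
        (a' * (y1 - x1) + b' * (y2 - x2) + c' * (y3 - x3)) by rewrite -E; ring.
      by field; rewrite gt_eqF.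
    exact: (relaxation_le B0 dj).
  - move=> j.
    have [t [t01]] := cs_mv cs j z0 z0 z0 z0 z0 z0 (cs_al0 cs) Sal.
    cbv zeta; rewrite subrr !mulr0 !add0r (cs_base cs) subr0 => ->.
    rewrite ler_pdivrMr// normrM.
    have -> : (1 - (1 - k / B)) * q * B = k * q by field; rewrite gt_eqF.
    apply: le_trans (cs_small cs Sal); rewrite ler_wpM2r//.
    by apply: (cs_D cs) => //; apply: between_S t01 _ _ => //;
      [exact: cs_int cs|exact: cs_al0 cs].
have /choice[v hv] : forall al, exists v : int -> R, S al ->
    (forall j, `|v j| <= q) /\
    forall j, F j (v (j - 1)) (v j) (v (j + 1)) al = 0.
  move=> al; have [Sa|nS] := pselect (S al); last by exists (fun=> 0).
  by have [v hv] := sol al Sa; exists v.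
exists (fun j al => v al j) => al Sal j; have [h1 h2] := hv al Sal.
by split; [exact: h1|exact: h2].
Qed.

Definition mid (u : int -> R -> R) (al be : R) (t : int -> R)
    (H : int -> R -> R -> R -> R -> R) (j : int) : R :=
  H j (u (j - 1) al + t j * (u (j - 1) be - u (j - 1) al))
      (u j al + t j * (u j be - u j al))
      (u (j + 1) al + t j * (u (j + 1) be - u (j + 1) al))
      (al + t j * (be - al)).

(** The mean value theorem, with an intermediate point for each row, makes the difference of two
    values of the solution an exact solution of a linear dominant system. *)
Lemma chain_mv u : chain_sol u -> forall al be, S al -> S be ->
  exists t : int -> R, [/\ forall j, 0 <= t j <= 1,
    dominant k B (mid u al be t a) (mid u al be t b) (mid u al be t c),
    forall j, `|mid u al be t D j| <= Db
  & forall j, row (mid u al be t a) (mid u al be t b) (mid u al be t c)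
      (fun i => u i be - u i al) j = - mid u al be t D j * (be - al)].
Proof.
move=> hu al be Sal Sbe.
have /choice[t ht] := fun j => cs_mv cs j (hu al Sal (j - 1)).1 (hu al Sal j).1
  (hu al Sal (j + 1)).1 (hu be Sbe (j - 1)).1 (hu be Sbe j).1
  (hu be Sbe (j + 1)).1 Sal Sbe.
have t01 j : 0 <= t j <= 1 by have [] := ht j.
have bd i j : `|u i al + t j * (u i be - u i al)| <= q.
  by apply: between_le (t01 j) (hu al Sal i).1 (hu be Sbe i).1.
have Sb j : S (al + t j * (be - al)).
  exact: between_S (cs_int cs) (t01 j) Sal Sbe.
exists t; split=> // [j|j|j].
- by apply: (cs_dom cs).
- by apply: (cs_D cs).
- have [_] := ht j; cbv zeta.
  have [_ e1] := hu al Sal j; have [_ e2] := hu be Sbe j.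
  rewrite /along in e1 e2; rewrite e1 e2 subrr.
  rewrite -!/(mid u al be t _ j) => /esym/eqP; rewrite addr_eq0 => /eqP h.
  by rewrite mulNr -h.
Qed.

Lemma chain_lipschitz u : chain_sol u -> forall j al be, S al -> S be ->
  `|u j be - u j al| <= Db / k * `|be - al|.
Proof.
move=> hu j al be Sal Sbe; have k0 := cs_k cs.
have [t [t01 dom hD hr]] := chain_mv hu Sal Sbe.
have Db0 : 0 <= Db by apply: le_trans (hD 0).
apply: (dominant_le (w := fun i => u i be - u i al) (W := q + q) k0 dom).
- by rewrite mulr_ge0// divr_ge0// ltW.
- move=> i; apply: le_trans (ler_normB _ _) _.
  by rewrite lerD ?(hu _ Sal i).1 ?(hu _ Sbe i).1.
- move=> i; rewrite hr normrM normrN mulrA (mulrC k) divfK ?gt_eqF//.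
  by rewrite ler_wpM2r.
Qed.

(** Uniqueness at the base parameter: [u] is compared with the zero solution given by [cs_base]. *)
Lemma chain_sol0 u : chain_sol u -> forall j, u j al0 = 0.
Proof.
move=> hu; have q0 := cs_q cs.
have z0 : `|0 : R| <= q by rewrite normr0.
have Sal0 := cs_al0 cs.
have /choice[t ht] := fun j => cs_mv cs j z0 z0 z0 (hu _ Sal0 (j - 1)).1
  (hu _ Sal0 j).1 (hu _ Sal0 (j + 1)).1 Sal0 Sal0.
have t01 j : 0 <= t j <= 1 by have [] := ht j.
pose G (H : int -> R -> R -> R -> R -> R) j := H j
  (0 + t j * (u (j - 1) al0 - 0)) (0 + t j * (u j al0 - 0))
  (0 + t j * (u (j + 1) al0 - 0)) (al0 + t j * (al0 - al0)).
have bd i j : `|0 + t j * (u i al0 - 0)| <= q.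
  by apply: between_le (t01 j) z0 (hu al0 Sal0 i).1.
have Sb j : S (al0 + t j * (al0 - al0)).
  exact: (between_S (cs_int cs) (t01 j) Sal0 Sal0).
have dom : dominant k B (G a) (G b) (G c)
  by move=> j; apply: (cs_dom cs j (bd _ _) (bd _ _) (bd _ _) (Sb j)).
move=> j; apply/eqP; rewrite -normr_le0.
apply: (dominant_le (w := u ^~ al0) (W := q) (cs_k cs) dom) => //.
  by move=> i; exact: (hu _ Sal0 i).1.
move=> i; rewrite mulr0; have [_] := ht i; cbv zeta.
have [_ e1] := hu al0 Sal0 i; rewrite /along in e1.
rewrite e1 (cs_base cs) => E.
have -> : row (G a) (G b) (G c) (u ^~ al0) i = 0 - 0.
  by rewrite E /row /G; ring.
by rewrite subr0 normr0.
Qed.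

(** The intermediate points converge because solutions are Lipschitz in the parameter uniformly in
    the index; the modulus [d] belongs to the single row [j]. *)
Lemma chain_cont (H : int -> R -> R -> R -> R -> R) u j x :
  cont4_in q S (H j) -> chain_sol u -> S x ->
  forall e, 0 < e -> exists2 d, 0 < d & forall y (t : int -> R), S y ->
    (forall j, 0 <= t j <= 1) -> `|y - x| < d ->
    `|mid u x y t H j - along H u j x| <= e.
Proof.
move=> cH hu Sx e e0; have k0 := cs_k cs.
have [d d0 hd] := cH _ _ _ _ (hu x Sx (j - 1)).1 (hu x Sx j).1
  (hu x Sx (j + 1)).1 Sx e e0.
pose L := `|Db / k| + 1.
have L1 : 1 <= L by rewrite /L lerDr.
have L0 : 0 < L by apply: lt_le_trans L1.
exists (d / L); first by rewrite divr_gt0.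
move=> y t Sy t01; rewrite ltr_pdivlMr// => yd.
have yd' : `|y - x| < d by apply: le_lt_trans yd; rewrite ler_peMr.
have lip i : `|u i y - u i x| < d.
  apply: le_lt_trans (chain_lipschitz hu i Sx Sy) _.
  apply: le_lt_trans yd; rewrite mulrC ler_wpM2l//.
  by apply: le_trans (ler_norm _) _; rewrite /L lerDl.
apply: hd; try exact: between_close.
- exact: between_le (t01 j) (hu x Sx _).1 (hu y Sy _).1.
- exact: between_le (t01 j) (hu x Sx _).1 (hu y Sy _).1.
- exact: between_le (t01 j) (hu x Sx _).1 (hu y Sy _).1.
- exact: between_S (cs_int cs) (t01 j) Sx Sy.
Qed.

Lemma chain_dom u x : chain_sol u -> S x ->
  dominant k B (along a u ^~ x) (along b u ^~ x) (along c u ^~ x).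
Proof.
by move=> hu Sx j; exact: (cs_dom cs j (hu x Sx _).1 (hu x Sx _).1 (hu x Sx _).1 Sx).
Qed.

(** The candidate derivative solves the linearised chain. The difference quotients solve the system
    with coefficients [mid] exactly, and these tend, row by row, to the coefficients along the
    solution. *)
Lemma chain_derivable u : chain_sol u ->
  exists u' : int -> R -> R, [/\ forall j, is_der S (u j) (u' j),
    forall j x, S x -> `|u' j x| <= Db / k
  & forall j x, S x ->
      row (along a u ^~ x) (along b u ^~ x) (along c u ^~ x) (u' ^~ x) j
        + along D u j x = 0].
Proof.
move=> hu; have k0 := cs_k cs.
have hD j x : S x -> `|along D u j x| <= Db.
  by move=> Sx; exact: (cs_D cs j (hu x Sx _).1 (hu x Sx _).1 (hu x Sx _).1 Sx).
have Db0 : 0 <= Db by apply: le_trans (hD 0 _ (cs_al0 cs)).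
have E0 : 0 <= Db / k by rewrite divr_ge0// ltW.
have /choice[g hg] : forall x, exists g : int -> R, S x ->
    (forall j, `|g j| <= Db / k) /\
    forall j, row (along a u ^~ x) (along b u ^~ x) (along c u ^~ x) g j
      + along D u j x = 0.
  move=> x; have [Sx|nS] := pselect (S x); last by exists (fun=> 0).
  have [|g hg] := dominant_solve (y := fun j => along D u j x)
    k0 (chain_dom hu Sx) E0; last by exists g.
  by move=> j; rewrite mulrC divfK ?gt_eqF//; exact: hD.
exists (fun j x => g x j); split; last 2 first.
- by move=> j x Sx; have [h _] := hg x Sx; exact: h.
- by move=> j x Sx; have [_ h] := hg x Sx; exact: h.
move=> j x Sx; have [g1 g2] := hg x Sx.
have near_S := within_dnbhs_neq S x.
pose sl i y := (u i y - u i x) / (y - x).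
have slb i y : S y -> y != x -> `|sl i y| <= Db / k.
  move=> Sy yx; rewrite normrM normfV ler_pdivrMr ?normr_gt0 ?subr_eq0//.
  exact: chain_lipschitz.
suff : (fun y => sl j y - g x j) @ within S x^' --> (0 : R).
  move=> /cvgD/(_ (cvg_cst (g x j))); rewrite add0r; apply: cvg_near_eq.
  by apply: nearW => y; rewrite fctE /cst subrK.
apply: (dominant_cvg0 (F := within S x^')
  (y := fun y i => sl i y - g x i) (W := Db / k + Db / k) k0 (chain_dom hu Sx)).
  apply: filterS near_S => y [Sy yx] i.
  by apply: le_trans (ler_normB _ _) _; rewrite lerD ?g1// slb.
move=> i; apply/cvgrPdist_le => e e0.
(* Three coefficient errors act on quotients bounded by [Db / k] and the drift error counts once;
   with [e / M] for each the total is [e]. *)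
pose M := 3 * (Db / k) + 1.
have M0 : 0 < M by rewrite /M ltr_wpDl// mulr_ge0.
have e1 : 0 < e / M by rewrite divr_gt0.
have [da da0 hda] := chain_cont (cs_conta cs i) hu Sx e1.
have [db db0 hdb] := chain_cont (cs_contb cs i) hu Sx e1.
have [dc dc0 hdc] := chain_cont (cs_contc cs i) hu Sx e1.
have [dd dd0 hdd] := chain_cont (cs_contD cs i) hu Sx e1.
pose d := Num.min (Num.min da db) (Num.min dc dd).
have d0 : 0 < d by rewrite /d !lt_min da0 db0 dc0.
have near_d : \forall y \near within S x^', `|y - x| < d.
  apply: (cvg_within (F := x^')); apply: nbhs_dnbhs.
  by apply/nbhs_ballP; exists d => // y; rewrite /ball/= distrC.
apply: filterS2 near_S near_d => y [Sy yx].
rewrite !lt_min => /andP[/andP[ya yb] /andP[yc yd]].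
rewrite sub0r normrN row_sub.
have [t [t01 _ _ hr]] := chain_mv hu Sx Sy.
have -> : row (along a u ^~ x) (along b u ^~ x) (along c u ^~ x) (g x) i =
  - along D u i x by have /eqP := g2 i; rewrite addr_eq0 => /eqP.
have hr' : row (mid u x y t a) (mid u x y t b) (mid u x y t c) (sl ^~ y) i =
    - mid u x y t D i.
  by rewrite row_scale hr mulfK ?subr_eq0.
have -> : row (along a u ^~ x) (along b u ^~ x) (along c u ^~ x) (sl ^~ y) i
    - - along D u i x =
  - (row (fun i => mid u x y t a i - along a u i x)
      (fun i => mid u x y t b i - along b u i x)
      (fun i => mid u x y t c i - along c u i x) (sl ^~ y) i) -
  (mid u x y t D i - along D u i x).
  by rewrite row_coef_sub hr'; ring.
apply: le_trans (ler_normB _ _) _; rewrite normrN.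
apply: (@le_trans _ _ ((e / M + e / M + e / M) * (Db / k) + e / M)).
  apply: lerD; last exact: hdd.
  apply: row_bound; [exact: hda|exact: hdb|exact: hdc|].
  by move=> l; exact: slb.
have -> : (e / M + e / M + e / M) * (Db / k) + e / M = e / M * M.
  by rewrite /M; ring.
by rewrite divfK// gt_eqF.
Qed.

(** A bootstrap: the coefficients along [u] inherit the class of [u], and [lin_smooth] applied to
    [u'] gains one order. *)
Lemma chain_smooth u K : chain_sol u ->
  (forall n, (n < K)%N -> UC S n u ->
    [/\ UC S n (along a u), UC S n (along b u), UC S n (along c u)
      & UC S n (along D u)]) ->
  UC S K u.
Proof.
move=> hu hs; have [u' [du bu' hr]] := chain_derivable hu.
have bu : ubounded S u by exists q => j x Sx; have [] := hu x Sx j.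
elim: K hs => [|K IH] hs.
  by split=> // j; exact: is_der_cont (du j).
split=> //; exists u' => //.
have uK : UC S K u by apply: IH => n nK; apply: hs; exact: ltnW.
have [ua ub uc uD] := hs K (ltnSn K) uK.
apply: (lin_smooth (cs_int cs) (cs_k cs) _ ua ub uc uD bu' hr).
by move=> x Sx; exact: chain_dom.
Qed.

End chain.

(** * Plane geometry *)

Lemma cvg_fst_comp (T : Type) (U V : topologicalType) (F : set_system T)
    {FF : Filter F} (f : T -> U * V) (l : U * V) :
  f @ F --> l -> (fun t => (f t).1) @ F --> l.1.
Proof. by move=> h; apply: (cvg_comp _ _ h); exact: cvg_fst. Qed.

Lemma cvg_snd_comp (T : Type) (U V : topologicalType) (F : set_system T)
    {FF : Filter F} (f : T -> U * V) (l : U * V) :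
  f @ F --> l -> (fun t => (f t).2) @ F --> l.2.
Proof. by move=> h; apply: (cvg_comp _ _ h); exact: cvg_snd. Qed.

Section plane.
Variable R : realType.
Implicit Types x y z : R * R.

Lemma enorm_ge0 x : 0 <= enorm x. Proof. exact: sqrtr_ge0. Qed.

Lemma dot_ge0 x : 0 <= dot x x.
Proof. by rewrite /dot -!expr2 addr_ge0 ?sqr_ge0. Qed.

Lemma enorm_sqr x : enorm x ^+ 2 = dot x x.
Proof. by rewrite sqr_sqrtr ?dot_ge0. Qed.

Lemma dotC x y : dot x y = dot y x.
Proof. by rewrite /dot; ring. Qed.

Lemma dotDl x y z : dot (x + y) z = dot x z + dot y z.
Proof. by rewrite /dot /=; ring. Qed.

Lemma dotNl x y : dot (- x) y = - dot x y.
Proof. by rewrite /dot /=; ring. Qed.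

Lemma dotBl x y z : dot (x - y) z = dot x z - dot y z.
Proof. by rewrite dotDl dotNl. Qed.

Lemma dotZl (t : R) x y : dot (t *: x) y = t * dot x y.
Proof. by rewrite /dot /= /GRing.scale /=; ring. Qed.

Lemma dotDr x y z : dot z (x + y) = dot z x + dot z y.
Proof. by rewrite /dot /=; ring. Qed.

Lemma dotNr x y : dot y (- x) = - dot y x.
Proof. by rewrite /dot /=; ring. Qed.

Lemma dotBr x y z : dot z (x - y) = dot z x - dot z y.
Proof. by rewrite dotDr dotNr. Qed.

Lemma dotZr (t : R) x y : dot y (t *: x) = t * dot y x.
Proof. by rewrite /dot /= /GRing.scale /=; ring. Qed.

Lemma dot_eq0 x : dot x x = 0 -> x = 0.
Proof.
rewrite /dot -!expr2 => /eqP; rewrite paddr_eq0 ?sqr_ge0// !sqrf_eq0.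
by case: x => x1 x2 /= /andP[/eqP -> /eqP ->].
Qed.

Lemma enorm_eq0 x : enorm x = 0 -> x = 0.
Proof. by move=> h; apply: dot_eq0; rewrite -enorm_sqr h expr0n. Qed.

Lemma enorm_gt0 x : x != 0 -> 0 < enorm x.
Proof.
by move=> x0; rewrite lt0r enorm_ge0 andbT; apply: contra_neq x0; exact: enorm_eq0.
Qed.

Lemma enormZ (t : R) x : enorm (t *: x) = `|t| * enorm x.
Proof.
by rewrite /enorm dotZl dotZr mulrA -expr2 sqrtrM ?sqr_ge0// sqrtr_sqr.
Qed.

Lemma enormN x : enorm (- x) = enorm x.
Proof. by rewrite /enorm dotNl dotNr opprK. Qed.

Lemma dot_le x y : `|dot x y| <= enorm x * enorm y.
Proof.
rewrite -(ler_pXn2r (_ : 0 < 2)%N) ?nnegrE ?mulr_ge0 ?enorm_ge0//.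
rewrite exprMn !enorm_sqr -normrX ger0_norm ?sqr_ge0//.
have -> : dot x x * dot y y = dot x y ^+ 2 + det2 x y ^+ 2.
  by rewrite /dot /det2; ring.
by rewrite lerDl sqr_ge0.
Qed.

Lemma det2_le x y : `|det2 x y| <= enorm x * enorm y.
Proof.
rewrite -(ler_pXn2r (_ : 0 < 2)%N) ?nnegrE ?mulr_ge0 ?enorm_ge0//.
rewrite exprMn !enorm_sqr -normrX ger0_norm ?sqr_ge0//.
have -> : dot x x * dot y y = det2 x y ^+ 2 + dot x y ^+ 2.
  by rewrite /dot /det2; ring.
by rewrite lerDl sqr_ge0.
Qed.

Lemma enormD x y : enorm (x + y) <= enorm x + enorm y.
Proof.
rewrite -(ler_pXn2r (_ : 0 < 2)%N) ?nnegrE ?addr_ge0 ?enorm_ge0//.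
rewrite sqrrD !enorm_sqr dotDl !dotDr (dotC y x) addrA lerD2r -addrA lerD2l.
by rewrite -mulr2n ler_wMn2r// (le_trans (ler_norm _) (dot_le _ _)).
Qed.

Lemma det2Z (t : R) x y : det2 x (t *: y) = t * det2 x y.
Proof. by rewrite /det2 /= /GRing.scale /=; ring. Qed.

Lemma det2C x y : det2 x y = - det2 y x.
Proof. by rewrite /det2; ring. Qed.

Lemma det2xx x : det2 x x = 0.
Proof. by rewrite /det2; ring. Qed.

Lemma det2Zl (t : R) x y : det2 (t *: x) y = t * det2 x y.
Proof. by rewrite /det2 /= /GRing.scale /=; ring. Qed.

Lemma det2Br x y z : det2 z (x - y) = det2 z x - det2 z y.
Proof. by rewrite /det2 /=; ring. Qed.

Lemma det20r x : det2 x 0 = 0.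
Proof. by rewrite /det2 /=; ring. Qed.

Lemma det20l x : det2 0 x = 0.
Proof. by rewrite /det2 /=; ring. Qed.

Lemma dot0r x : dot x 0 = 0.
Proof. by rewrite /dot /=; ring. Qed.

Lemma dot0l x : dot 0 x = 0.
Proof. by rewrite /dot /=; ring. Qed.

Lemma dot_rot x y : dot x (y.2, - y.1) = det2 x y.
Proof. by rewrite /dot /det2 /=; ring. Qed.

Lemma dot_rot_rot x y : dot (x.2, - x.1) (y.2, - y.1) = dot x y.
Proof. by rewrite /dot /=; ring. Qed.

Lemma unit_decomp x y : dot y y = 1 ->
  x = dot x y *: y + det2 x y *: (y.2, - y.1).
Proof.
rewrite /dot => h; rewrite [x]surjective_pairing; congr pair.
  rewrite /det2 /= /GRing.scale /=.
  transitivity (x.1 * (y.1 * y.1 + y.2 * y.2)); last by ring.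
  by rewrite h mulr1.
rewrite /det2 /= /GRing.scale /=.
transitivity (x.2 * (y.1 * y.1 + y.2 * y.2)); last by ring.
by rewrite h mulr1.
Qed.

Lemma triangle_combination (P Q s : R) x y z : P + Q != 0 ->
  s *: (P *: (x - z) + Q *: (y - z)) =
  (s * (P + Q)) *: (x + (Q / (P + Q)) *: (y - x) - z).
Proof.
move=> PQ; rewrite [LHS]surjective_pairing [RHS]surjective_pairing.
by congr pair; rewrite /= /GRing.scale /=; field.
Qed.

Lemma cvg_dot (T : Type) (F : set_system T) {FF : Filter F} (f g : T -> R * R)
    (a b : R * R) : f @ F --> a -> g @ F --> b ->
  (fun t => dot (f t) (g t)) @ F --> dot a b.
Proof.
by move=> hf hg; apply: cvgD; apply: cvgM;
  (apply: cvg_fst_comp || apply: cvg_snd_comp).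
Qed.

Lemma cvg_det2 (T : Type) (F : set_system T) {FF : Filter F} (f g : T -> R * R)
    (a b : R * R) : f @ F --> a -> g @ F --> b ->
  (fun t => det2 (f t) (g t)) @ F --> det2 a b.
Proof.
by move=> hf hg; apply: cvgB; apply: cvgM;
  (apply: cvg_fst_comp || apply: cvg_snd_comp).
Qed.

Lemma cvg_enorm (T : Type) (F : set_system T) {FF : Filter F} (f : T -> R * R)
    (a : R * R) : f @ F --> a -> (fun t => enorm (f t)) @ F --> enorm a.
Proof.
move=> hf; exact: (continuous_cvg _ (@sqrt_continuous R _) (cvg_dot hf hf)).
Qed.

Lemma cvg_pairP (T : Type) (F : set_system T) {FF : Filter F} (f : T -> R * R)
    (l : R * R) : (fun t => (f t).1) @ F --> l.1 -> (fun t => (f t).2) @ F --> l.2 ->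
  f @ F --> l.
Proof.
move=> h1 h2.
have -> : f = (fun t => ((f t).1, (f t).2)).
  by apply/funext => t; exact: surjective_pairing.
by rewrite [l]surjective_pairing; exact: cvg_pair h1 h2.
Qed.

Lemma compact_bounds (T : topologicalType) (A : set T) (f : T -> R) :
  compact A -> {within A, continuous f} ->
  exists B, forall t, A t -> `|f t| <= B.
Proof.
move=> cA cf; have [->|/set0P A0] := eqVneq A set0; first by exists 0.
have [c1 _ h1] := compact_EVT_max A0 cA cf.
have [c2 _ h2] := compact_EVT_min A0 cA cf.
exists (`|f c1| + `|f c2|) => x /mem_set Ax.
have := h1 x Ax; have := h2 x Ax; have := ler_norm (f c1).
have := ler_norm (- f c2); rewrite normrN => *.
rewrite ler_norml; apply/andP; split.
  by have := normr_ge0 (f c1); lra.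
by have := normr_ge0 (f c2); lra.
Qed.

Lemma compact_gt0 (T : topologicalType) (A : set T) (f : T -> R) :
  compact A -> {within A, continuous f} -> (forall t, A t -> 0 < f t) ->
  exists2 d, 0 < d & forall t, A t -> d <= f t.
Proof.
move=> cA cf f0; have [->|/set0P A0] := eqVneq A set0; first by exists 1.
have [c cA' h] := compact_EVT_min A0 cA cf.
exists (f c); first by apply: f0; exact: set_mem.
by move=> x /mem_set; exact: h.
Qed.

End plane.

Definition vslope_lim (R : realType) (S : set R) (f : R -> R * R) (x : R)
    (l : R * R) : Prop :=
  slope_lim S (fun y => (f y).1) x l.1 /\ slope_lim S (fun y => (f y).2) x l.2.

Section vslope.
Variables (R : realType) (S : set R).
Implicit Types f g : R -> R * R.

Lemma slope_lim_val (f : R -> R) x l l' : slope_lim S f x l -> l = l' ->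
  slope_lim S f x l'.
Proof. by move=> h <-. Qed.

Lemma vslope_limB f g x v w : vslope_lim S f x v -> vslope_lim S g x w ->
  vslope_lim S (fun y => f y - g y) x (v - w).
Proof. by move=> [f1 f2] [g1 g2]; split; exact: slope_limB. Qed.

Lemma vslope_lim_cst v x : vslope_lim S (fun=> v) x 0.
Proof. by split; exact: slope_lim_cst. Qed.

Lemma vslope_limZ (s : R -> R) f x (t : R) v : slope_lim S s x t ->
  vslope_lim S f x v -> vslope_lim S (fun y => s y *: f y) x (t *: f x + s x *: v).
Proof. by move=> hs [f1 f2]; split; exact: slope_limM. Qed.

Lemma slope_lim_dot f g x v w : vslope_lim S f x v -> vslope_lim S g x w ->
  slope_lim S (fun y => dot (f y) (g y)) x (dot v (g x) + dot (f x) w).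
Proof.
move=> [f1 f2] [g1 g2].
apply: slope_lim_val (slope_limD (slope_limM f1 g1) (slope_limM f2 g2)) _.
by rewrite /dot; ring.
Qed.

Lemma slope_lim_det2 f g x v w : vslope_lim S f x v -> vslope_lim S g x w ->
  slope_lim S (fun y => det2 (f y) (g y)) x (det2 v (g x) + det2 (f x) w).
Proof.
move=> [f1 f2] [g1 g2].
apply: slope_lim_val (slope_limB (slope_limM f1 g2) (slope_limM f2 g1)) _.
by rewrite /det2; ring.
Qed.

End vslope.

Lemma slope_lim_min (R : realType) (f : R -> R) x l :
  slope_lim setT f x l -> (forall y, f x <= f y) -> l = 0.
Proof.
move=> /slope_limP h fm; apply/eqP; rewrite -normr_le0.
apply/ler_addgt0Pr => e e0; rewrite add0r.
have [d d0 hd] := h e e0.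
have d2 : 0 < d / 2 by rewrite divr_gt0.
have dd : d / 2 < d by rewrite [ltRHS](splitr d) ltrDl.
have := hd (x + d / 2) Logic.I; have := hd (x - d / 2) Logic.I.
have -> : x + d / 2 - x = d / 2 by ring.
have -> : x - d / 2 - x = - (d / 2) by ring.
rewrite normrN gtr0_norm// => /(_ dd) + /(_ dd); rewrite !ler_norml.
have := fm (x + d / 2); have := fm (x - d / 2).
move=> h1 h2 /andP[h3 h4] /andP[h5 h6].
apply/andP; split.
  rewrite -(ler_pM2r d2); nra.
rewrite -(ler_pM2r d2); nra.
Qed.

(** * A single obstacle *)

Definition rot (R : realType) (x : R * R) : R * R := (x.2, - x.1).

(* [T] and [Q] are the first two derivatives of [c], kept abstract so that they
   do not unfold to limits. *)
Record obstacle (R : realType) (A : set (R * R)) (l : R) (c T Q : R -> R * R) :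
    Prop := Obstacle {
  ob_arc : arclength_ccw A l c;
  ob_tangent : forall u, tangent c u = T u;
  ob_second : forall u, derive1n 2 c u = Q u;
  ob_compact : compact A;
  ob_convex : forall x y t, A x -> A y -> 0 <= t <= 1 -> A (x + t *: (y - x));
  ob_d1 : forall u, vslope_lim setT c u (T u);
  ob_d2 : forall u, vslope_lim setT T u (Q u);
  ob_curv : forall u, 0 < det2 (T u) (Q u);
  ob_cont : continuous T;
  ob_curv_cont : continuous (fun u => det2 (T u) (Q u))
}.

Section obstacle.
Variables (R : realType) (A : set (R * R)) (l : R) (c T Q : R -> R * R).
Hypothesis ob : obstacle A l c T Q.
Notation n u := (rot (T u)).

Lemma ob_normal u : normal c u = n u.
Proof. by rewrite /normal (ob_tangent ob). Qed.

Lemma ob_curvature u : curvature c u = det2 (T u) (Q u).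
Proof. by rewrite /curvature (ob_tangent ob) (ob_second ob). Qed.

Lemma ob_ccw u y : A y -> 0 <= det2 (T u) (y - c u).
Proof. by move=> Ay; rewrite -(ob_tangent ob); exact: (ac_ccw (ob_arc ob)). Qed.

Lemma dot_TT u : dot (T u) (T u) = 1.
Proof. by rewrite -enorm_sqr -(ob_tangent ob) (ac_unit_speed (ob_arc ob)) expr1n. Qed.

Lemma dot_nn u : dot (n u) (n u) = 1.
Proof. by rewrite /rot dot_rot_rot dot_TT. Qed.

Lemma enorm_n u : enorm (n u) = 1.
Proof. by rewrite /enorm dot_nn sqrtr1. Qed.

Lemma dot_n w u : dot w (n u) = det2 w (T u).
Proof. exact: dot_rot. Qed.

Lemma decomp w u : w = dot w (T u) *: T u + dot w (n u) *: n u.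
Proof.
by rewrite dot_n; exact: (unit_decomp w (dot_TT u)).
Qed.

Lemma frontier_sub p : frontier A p -> A p.
Proof.
move=> [+ _].
have /closure_id <- // : closed A.
by apply: compact_closed; [exact: norm_hausdorff|exact: ob_compact ob].
Qed.

Lemma c_frontier u : frontier A (c u).
Proof. by rewrite -(ac_frontier (ob_arc ob)); exists u. Qed.

Lemma c_in u : A (c u).
Proof. by apply: frontier_sub; exact: c_frontier. Qed.

Lemma ccw_n u y : A y -> dot (n u) (y - c u) <= 0.
Proof.
by move=> /(ob_ccw u); rewrite -oppr_ge0 dotC dot_n -det2C.
Qed.

(* If the determinant vanished, [h |-> det2 (T h) (y - c h)] would have a minimum
   at [u]; its derivative there is the curvature times [- dot (T u) (y - c u)]. *)
Lemma strict_det u y : A y -> y != c u -> 0 < det2 (T u) (y - c u).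
Proof.
move=> Ay yc; rewrite lt0r ob_ccw// andbT.
apply: contra_neq yc => h0.
have hs : slope_lim setT (fun h => det2 (T h) (y - c h)) u
    (det2 (Q u) (y - c u) + det2 (T u) (0 - T u)).
  apply: slope_lim_det2; first exact: ob_d2 ob u.
  by apply: vslope_limB; [exact: vslope_lim_cst|exact: ob_d1 ob u].
have /(slope_lim_min hs) : forall h,
    det2 (T u) (y - c u) <= det2 (T h) (y - c h).
  by move=> h; rewrite h0; exact: ob_ccw.
rewrite [X in _ + X](_ : _ = 0) ?addr0; last first.
  by rewrite det2Br det20r det2xx subr0.
rewrite [y - c u](decomp _ u) dot_n.
have -> : det2 (y - c u) (T u) = 0 by rewrite det2C h0 oppr0.
rewrite scale0r addr0 det2Z.
have -> : det2 (Q u) (T u) = - det2 (T u) (Q u).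
  exact: det2C.
move=> /eqP; rewrite mulrN oppr_eq0 mulf_eq0 (gt_eqF (ob_curv ob u)) orbF.
move=> /eqP h1.
apply/eqP; rewrite -subr_eq0; apply/eqP; rewrite [LHS](decomp _ u) h1 dot_n.
have -> : det2 (y - c u) (T u) = 0 by rewrite det2C h0 oppr0.
by rewrite !scale0r addr0.
Qed.

Lemma strict_n u y : A y -> y != c u -> dot (n u) (y - c u) < 0.
Proof.
move=> Ay yc; rewrite -oppr_gt0; have := strict_det Ay yc.
by rewrite dotC dot_n -det2C.
Qed.

Lemma other_point u : exists2 y, A y & y != c u.
Proof.
have l0 := ac_length_gt0 (ob_arc ob).
have l2 : 0 < l / 2 by rewrite divr_gt0.
have ne : c 0 != c (l / 2).
  apply/eqP => /(ac_simple (ob_arc ob)) h.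
  have : 0 = l / 2.
    apply: h; first by rewrite lexx.
    by rewrite ltW// [ltRHS](splitr l) ltrDl.
  by move=> E; rewrite -E ltxx in l2.
have [E|E] := eqVneq (c 0) (c u); last by exists (c 0) => //; exact: c_in.
by exists (c (l / 2)); [exact: c_in|rewrite -E eq_sym].
Qed.

(** The curve stays to the left of the tangent at [v] and touches it at parameter [u], so the two
    unit tangents are parallel. Opposite tangents would put a second point of the obstacle strictly
    on both sides of one line. *)
Lemma tangent_unique u v : c u = c v -> T u = T v.
Proof.
move=> E.
have hs : slope_lim setT (fun s => det2 (T v) (c s - c v)) u
    (det2 0 (c u - c v) + det2 (T v) (T u - 0)).
  apply: slope_lim_det2; first exact: vslope_lim_cst.
  by apply: vslope_limB; [exact: ob_d1 ob u|exact: vslope_lim_cst].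
have /(slope_lim_min hs) : forall s,
    det2 (T v) (c u - c v) <= det2 (T v) (c s - c v).
  move=> s; rewrite E subrr det20r.
  by apply: ob_ccw; exact: c_in.
rewrite det20l add0r subr0 => h0.
have h1 : dot (T u) (n v) = 0 by rewrite dot_n det2C h0 oppr0.
have Tu := decomp (T u) v; rewrite h1 scale0r addr0 in Tu.
set s := dot (T u) (T v) in Tu.
have s2 : s ^+ 2 = 1.
  by have := dot_TT u; rewrite Tu dotZl dotZr dot_TT mulr1 -expr2.
have /eqP := s2; rewrite sqrf_eq1 => /orP[/eqP s1|/eqP s1].
  by rewrite Tu s1 scale1r.
have [y Ay yc] := other_point u.
have := strict_det Ay yc; rewrite E in yc; have := strict_det Ay yc.
rewrite Tu s1 E => p1 p2.
rewrite det2Zl mulN1r in p2.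
by have := addr_gt0 p1 p2; rewrite subrr ltxx.
Qed.

(** Frenet's formula: the constant [dot (T h) (T h)] has derivative zero, so [Q u] is normal; the
    sign is negative because [n] points outward. *)
Lemma curv_vec u : Q u = - det2 (T u) (Q u) *: n u.
Proof.
have hs : slope_lim setT (fun h => dot (T h) (T h)) u
    (dot (Q u) (T u) + dot (T u) (Q u)).
  by apply: slope_lim_dot; exact: ob_d2 ob u.
have /(slope_lim_min hs) : forall h, dot (T u) (T u) <= dot (T h) (T h).
  by move=> h; rewrite !dot_TT.
rewrite (dotC (T u)) -mulr2n => /eqP; rewrite mulrn_eq0 /= => /eqP h0.
rewrite [LHS](decomp _ u) h0 scale0r add0r dot_n; congr (_ *: _).
exact: det2C.
Qed.

Lemma c_periodic_int u (k : int) : c (u + k%:~R * l) = c u.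
Proof.
have per v (j : nat) : c (v + j%:R * l) = c v.
  elim: j => [|j IH]; first by rewrite mul0r addr0.
  by rewrite -addn1 natrD mulrDl mul1r addrA (ac_periodic (ob_arc ob)).
case: k => [j|j]; first exact: per.
rewrite -(per (u + _) j.+1); congr c.
by rewrite NegzE mulrNz mulNr; rewrite subrK.
Qed.

Lemma frontier_param p : frontier A p -> exists2 u, 0 <= u < l & c u = p.
Proof.
rewrite -(ac_frontier (ob_arc ob)) => -[v _ <-].
have l0 := ac_length_gt0 (ob_arc ob).
pose k := Num.floor (v / l).
exists (v + (- k)%:~R * l); last exact: c_periodic_int.
have /andP[k1 k2] := floor_itv (v / l); rewrite -/k in k1 k2.
rewrite ler_pdivlMr// in k1; rewrite ltr_pdivrMr// in k2.
rewrite mulrNz mulNr subr_ge0 k1/= ltrBlDr.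
by rewrite intrD mulrDl mul1r addrC in k2.
Qed.

(* The tangent cone of a convex body with smooth boundary is a half-plane. *)
Lemma tangent_cone u w : 0 < det2 (T u) w ->
  exists2 s0, 0 < s0 & forall s, 0 < s -> s < s0 -> A (c u + s *: w).
Proof.
move=> wn0; set wn := det2 (T u) w in wn0; pose wt := dot (T u) w.
have T1 := dot_TT u.
have sa : slope_lim setT (fun s => dot (T u) (c s - c u)) u 1.
  apply: slope_lim_val (slope_lim_dot (vslope_lim_cst _ _ _)
    (vslope_limB (ob_d1 ob u) (vslope_lim_cst _ _ _))) _.
  by rewrite subr0 T1 dot0l add0r.
have sb : slope_lim setT (fun s => det2 (T u) (c s - c u)) u 0.
  apply: slope_lim_val (slope_lim_det2 (vslope_lim_cst _ _ _)
    (vslope_limB (ob_d1 ob u) (vslope_lim_cst _ _ _))) _.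
  by rewrite subr0 det20l det2xx addr0.
(* The chords [X] and [Y] from [c u] to [c (u + h)] and [c (u - h)] will reach at least [h / 2]
   along the tangent in opposite directions, at height at most [e * h]. This [e] makes [w] steeper
   than both. *)
pose e := wn / (2 * (`|wt| + 1)).
have p0 : 0 < `|wt| + 1 by rewrite ltr_wpDl.
have e0 : 0 < e by rewrite divr_gt0// mulr_gt0.
have he : e * (2 * (`|wt| + 1)) = wn by rewrite divfK// gt_eqF// mulr_gt0.
have h20 : 0 < (2^-1 : R) by rewrite invr_gt0.
have /slope_limP/(_ _ h20)[d1 d10 h1] := sa.
have /slope_limP/(_ _ e0)[d2 d20 h2] := sb.
pose h := Num.min d1 d2 / 2.
have m0 : 0 < Num.min d1 d2 by rewrite lt_min d10.
have h0 : 0 < h by rewrite divr_gt0.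
have hm : h < Num.min d1 d2 by rewrite [ltRHS](splitr (Num.min _ _)) ltrDl.
move: hm; rewrite lt_min => /andP[hd1 hd2].
have E1 : u + h - u = h by ring.
have E2 : u - h - u = - h by ring.
have := h1 (u + h) Logic.I; have := h2 (u + h) Logic.I.
have := h1 (u - h) Logic.I; have := h2 (u - h) Logic.I.
rewrite !subrr E1 E2 normrN gtr0_norm// {h1 h2}.
have z1 := dot0r (T u); have z2 := det20r (T u).
rewrite z1 z2 !subr0 !mul0r !subr0.
move=> /(_ hd2) b2 /(_ hd1) a2 /(_ hd2) b1 /(_ hd1) a1.
set X := c (u + h) - c u in a1 b1; set Y := c (u - h) - c u in a2 b2.
have neq v : c v - c u != 0 -> 0 < det2 (T u) (c v - c u).
  by rewrite subr_eq0 => ?; apply: strict_det => //; exact: c_in.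
have bX : 0 < det2 (T u) X.
  apply: neq; apply/eqP => E; rewrite -/X in E; move: a1; rewrite E z1.
  rewrite sub0r normrN mul1r gtr0_norm//; lra.
have bY : 0 < det2 (T u) Y.
  apply: neq; apply/eqP => E; rewrite -/Y in E; move: a2; rewrite E z1.
  rewrite sub0r normrN mul1r normrN gtr0_norm//; lra.
rewrite !ler_norml in a1 a2 b1 b2.
set aX := dot (T u) X in a1; set aY := dot (T u) Y in a2.
set dX := det2 (T u) X in b1 bX; set dY := det2 (T u) Y in b2 bY.
have aX0 : h / 2 <= aX by move/andP: a1 => [q1 q2]; lra.
have aY0 : aY <= - (h / 2) by move/andP: a2 => [q1 q2]; lra.
have Dl : 0 < aX * dY - dX * aY by nra.
have wb : `|wt| * e <= wn / 2 by rewrite -he; have := normr_ge0 wt; nra.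
have wt1 := ler_norm wt; have wt2 : - wt <= `|wt| by rewrite -normrN ler_norm.
have P0 : 0 <= wt * dY - wn * aY.
  have : - (wt * dY) <= `|wt| * (e * h).
    rewrite -mulNr; apply: le_trans (ler_norm _) _; rewrite normrM normrN.
    by rewrite ler_wpM2l// gtr0_norm//; move/andP: b2 => [].
  by nra.
have Q0 : 0 <= aX * wn - dX * wt.
  have : dX * wt <= `|wt| * (e * h).
    apply: le_trans (ler_norm _) _; rewrite normrM mulrC.
    by rewrite ler_wpM2l// gtr0_norm//; move/andP: b1 => [].
  by nra.
(* Cramer's rule for the coordinates of [w] in the basis [X], [Y]; [P0], [Q0] and [Dl] make them
   nonnegative. *)
pose P1 := (wt * dY - wn * aY) / (aX * dY - dX * aY).
pose P2 := (aX * wn - dX * wt) / (aX * dY - dX * aY).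
have P10 : 0 <= P1 by rewrite divr_ge0// ltW.
have Q1 : 0 <= P2 by rewrite divr_ge0// ltW.
have wE : w = P1 *: X + P2 *: Y.
  have dec v : v = dot (T u) v *: T u - det2 (T u) v *: n u.
    rewrite [LHS](decomp v u) dotC dot_n -scaleNr; congr (_ + _ *: _).
    by rewrite det2C.
  rewrite [LHS]dec [X in P1 *: X]dec [X in P2 *: X]dec -/aX -/aY -/dX -/dY -/wt -/wn.
  rewrite !scalerBr !scalerA addrACA -scalerDl -opprD -scalerDl.
  by congr (_ *: _ - _ *: _); rewrite /P1 /P2; field; rewrite gt_eqF.
have PQ0 : 0 < P1 + P2 + 1 by rewrite ltr_wpDl// addr_ge0.
(* Below this bound s * (P1 + P2) <= 1, so the point stays in the triangle spanned by [c u],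
   [c (u + h)] and [c (u - h)]; the added 1 covers P1 + P2 = 0. *)
exists (P1 + P2 + 1)^-1; first by rewrite invr_gt0.
move=> s s0 ss.
have sPQ : s * (P1 + P2) <= 1.
  have : s * (P1 + P2 + 1) < 1 by rewrite -ltr_pdivlMr// mul1r.
  nra.
have [PQ|PQ] := eqVneq (P1 + P2) 0.
  have Pz : P1 = 0 by lra.
  have Qz : P2 = 0 by lra.
  by rewrite wE Pz Qz !scale0r addr0 scaler0 addr0; exact: c_in.
have PQp : 0 < P1 + P2 by rewrite lt0r PQ addr_ge0.
pose z := c (u + h) + (P2 / (P1 + P2)) *: (c (u - h) - c (u + h)).
have Az : A z.
  apply: (ob_convex ob); [exact: c_in|exact: c_in|].
  by rewrite divr_ge0 ?(ltW PQp)//= ler_pdivrMr// mul1r lerDr.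
rewrite wE triangle_combination -/z//.
apply: (ob_convex ob) => //; first exact: c_in.
by rewrite sPQ andbT mulr_ge0// ltW.
Qed.

End obstacle.

(** * Coded orbits *)

Record table (R : realType) (m : nat) (K : 'I_m -> set (R * R)) (L : 'I_m -> R)
    (c T Q : 'I_m -> R -> R * R) : Prop := Table {
  tb_ob : forall i, obstacle (K i) (L i) (c i) (T i) (Q i);
  tb_disj : forall i j p, i != j -> K i p -> ~ K j p;
  tb_ecl : forall i j k x y t, i != j -> j != k -> i != k ->
    K i x -> K j y -> 0 <= t <= 1 -> ~ K k (x + t *: (y - x))
}.

(** Compactness gives constants obstacle by obstacle; monotonicity lets the least of finitely many
    serve for all. *)
Lemma fin_uniform (R : realType) (T : finType) (P : T -> R -> Prop) :
  (forall i, exists2 d, 0 < d & P i d) ->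
  (forall i d d', 0 < d' -> d' <= d -> P i d -> P i d') ->
  exists2 d, 0 < d & forall i, P i d.
Proof.
move=> h mono.
have /choice[f hf] : forall i, exists d, 0 < d /\ P i d.
  by move=> i; have [d d0 Pd] := h i; exists d.
pose d := \big[Num.min/(1 : R)]_i f i.
have d0 : 0 < d.
  rewrite /d; elim/big_ind : _ => // [x y x0 y0|i _]; first by rewrite lt_min x0.
  by have [] := hf i.
exists d => // i; apply: (mono _ (f i)) => //; last by have [] := hf i.
exact: bigmin_le_cond.
Qed.

Definition dir (R : realType) (x y : R * R) : R * R :=
  (enorm (y - x))^-1 *: (y - x).

Lemma enorm_dir (R : realType) (x y : R * R) : y != x -> enorm (dir x y) = 1.
Proof.
move=> yx; have n0 : 0 < enorm (y - x) by rewrite enorm_gt0// subr_eq0.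
by rewrite enormZ gtr0_norm ?invr_gt0// mulVf// gt_eqF.
Qed.

Lemma dirE (R : realType) (x y : R * R) : y != x -> y - x = enorm (y - x) *: dir x y.
Proof.
move=> yx; have n0 : 0 < enorm (y - x) by rewrite enorm_gt0// subr_eq0.
by rewrite scalerA mulfV ?scale1r// gt_eqF.
Qed.

Definition orbit_dir (R : realType) (p : int -> R * R) (j : int) : R * R :=
  dir (p j) (p (j + 1)).

(* The variational form of the reflection law: it does not mention any
   parametrization of the boundaries. *)
Definition coded_orbit (R : realType) (m : nat) (K : 'I_m -> set (R * R))
    (xi : int -> 'I_m) (p : int -> R * R) : Prop :=
  forall j, K (xi j) (p j) /\ forall y, K (xi j) y ->
    dot (orbit_dir p j - orbit_dir p (j - 1)) (y - p j) <= 0.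

Section table.
Variables (R : realType) (m : nat) (K : 'I_m -> set (R * R)) (L : 'I_m -> R).
Variables c T Q : 'I_m -> R -> R * R.
Hypothesis tb : table K L c T Q.
Notation n i u := (rot (T i u)).

Lemma table_neq i j x y : i != j -> K i x -> K j y -> y != x.
Proof. by move=> ij Kx Ky; apply/eqP => E; apply: (tb_disj tb ij Kx); rewrite -E. Qed.

Lemma table_gap : exists2 d, 0 < d & forall i j k, i != j -> j != k ->
  forall x y z t, K i x -> K j y -> K k z -> 0 <= t <= 1 ->
  d <= enorm (y - (x + t *: (z - x))).
Proof.
pose P (w : 'I_m * 'I_m * 'I_m) (d : R) := w.1.1 != w.1.2 -> w.1.2 != w.2 ->
  forall x y z t, K w.1.1 x -> K w.1.2 y -> K w.2 z -> 0 <= t <= 1 ->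
  d <= enorm (y - (x + t *: (z - x))).
have [||d d0 hd] := @fin_uniform R _ P.
- move=> [[i j] k]; rewrite /P /=.
  have [ij|] := boolP (i != j); last by exists 1.
  have [jk|] := boolP (j != k); last by exists 1.
  pose f (w : ((R * R) * (R * R)) * ((R * R) * R)) :=
    enorm (w.1.2 - (w.1.1 + w.2.2 *: (w.2.1 - w.1.1))).
  have cf : continuous f.
    move=> w; apply: cvg_enorm.
    have c1 : (fun w : ((R * R) * (R * R)) * ((R * R) * R) => w.1) @ w --> w.1.
      exact: cvg_fst.
    have c2 : (fun w : ((R * R) * (R * R)) * ((R * R) * R) => w.2) @ w --> w.2.
      exact: cvg_snd.
    apply: cvgB; first exact: cvg_snd_comp c1.
    apply: cvgD; first exact: cvg_fst_comp c1.
    apply: cvgZ; first exact: cvg_snd_comp c2.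
    by apply: cvgB; [exact: cvg_fst_comp c2|exact: cvg_fst_comp c1].
  have cA : compact ((K i `*` K j) `*` (K k `*` (`[(0 : R), (1 : R)]%classic : set R))).
    by do ?apply: compact_setX; try exact: ob_compact (tb_ob tb _);
      exact: segment_compact.
  have [|d d0 hd] := compact_gt0 cA (continuous_subspaceT cf).
    move=> [[x y] [z t]] [[/= Kx Ky] [/= Kz]]; rewrite in_itv/= => t01.
    rewrite /f /=; apply: enorm_gt0; rewrite subr_eq0; apply/eqP => E.
    have [ik|ik] := eqVneq i k.
      subst k; apply: (tb_disj tb ij (p := y)) => //.
      by rewrite E; exact: (ob_convex (tb_ob tb i)).
    have kj : k != j by rewrite eq_sym.
    by apply: (tb_ecl tb ik kj ij Kx Kz t01); rewrite -E.
  exists d => // _ _ x y z t Kx Ky Kz t01.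
  by apply: (hd ((x, y), (z, t))); do 2?split => //=; rewrite in_itv.
- move=> i d d' _ dd' Pd h1 h2 x y z t Kx Ky Kz t01.
  exact: le_trans dd' (Pd h1 h2 x y z t Kx Ky Kz t01).
by exists d => // i j k; exact: (hd ((i, j), k)).
Qed.

Lemma table_diam : exists2 D, 0 < D & forall i j x y, K i x -> K j y ->
  enorm (y - x) <= D.
Proof.
(* [fin_uniform] produces small constants, so the diameter is bounded by an inverse. *)
pose P (w : 'I_m * 'I_m) (d : R) := forall x y, K w.1 x -> K w.2 y ->
  enorm (y - x) <= d^-1.
have [||d d0 hd] := @fin_uniform R _ P.
- move=> [i j]; rewrite /P /=.
  pose f (w : (R * R) * (R * R)) := enorm (w.2 - w.1).
  have cf : continuous f.
    by move=> w; apply: cvg_enorm; apply: cvgB; [exact: cvg_snd|exact: cvg_fst].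
  have cA : compact (K i `*` K j).
    by apply: compact_setX; exact: ob_compact (tb_ob tb _).
  have [B hB] := compact_bounds cA (continuous_subspaceT cf).
  have B0 : 0 < `|B| + 1 by rewrite ltr_wpDl.
  exists (`|B| + 1)^-1; first by rewrite invr_gt0.
  move=> x y Kx Ky; rewrite invrK; have := hB (x, y) (conj Kx Ky).
  rewrite /f /= ger0_norm ?enorm_ge0// => h.
  by apply: le_trans h _; apply: le_trans (ler_norm _) _; rewrite lerDl.
- move=> i d d' d'0 dd' Pd x y Kx Ky; apply: le_trans (Pd x y Kx Ky) _.
  by rewrite lef_pV2 ?posrE// (lt_le_trans d'0).
exists d^-1; first by rewrite invr_gt0.
by move=> i j; exact: (hd (i, j)).
Qed.

(* Eclipse-freeness bounds the change of direction at a reflection from below: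
   a grazing reflection would put the middle point on the segment joining its
   neighbours. *)
Lemma turn_gap : exists2 s, 0 < s & forall i j k, i != j -> j != k ->
  forall x y z, K i x -> K j y -> K k z ->
  2 * s <= enorm (dir y z - dir x y).
Proof.
have [d d0 hd] := table_gap; have [D D0 hD] := table_diam.
exists (d / D); first by rewrite divr_gt0.
move=> i j k ij jk x y z Kx Ky Kz.
have yx : y != x by apply: table_neq ij Kx Ky.
have zy : z != y by apply: table_neq jk Ky Kz.
pose a := enorm (y - x); pose b := enorm (z - y).
have a0 : 0 < a by rewrite enorm_gt0// subr_eq0.
have b0 : 0 < b by rewrite enorm_gt0// subr_eq0.
have ab0 : 0 < a + b by rewrite addr_gt0.
have aD : a <= D by exact: hD Kx Ky.
have bD : b <= D by exact: hD Ky Kz.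
(* Cutting the segment from [x] to [z] in the ratio of the two flight lengths makes [y] minus the
   cut point a multiple of the turn, with factor of modulus a b / (a + b), at most D / 2. *)
have t01 : 0 <= a / (a + b) <= 1.
  by rewrite divr_ge0 ?(ltW a0) ?(ltW ab0)//= ler_pdivrMr// mul1r lerDl ltW.
have := hd i j k ij jk x y z _ Kx Ky Kz t01.
have -> : y - (x + (a / (a + b)) *: (z - x)) =
    (- (a * b / (a + b))) *: (dir y z - dir x y).
  rewrite /dir -/a -/b.
  rewrite [LHS]surjective_pairing [RHS]surjective_pairing.
  congr pair; rewrite /= /GRing.scale /=; field; rewrite ?gt_eqF//.
rewrite enormZ normrN gtr0_norm ?divr_gt0 ?mulr_gt0// => h.
set E := enorm _ in h *.
have E0 : 0 <= E by exact: enorm_ge0.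
rewrite mulrA ler_pdivrMr//.
have : a * b / (a + b) <= D / 2.
  rewrite ler_pdivrMr// -(ler_pM2r (_ : 0 < 2))// [leRHS]mulrAC divfK//.
  nra.
nra.
Qed.

(** In the interior of the obstacle a displacement along the turn [g] would violate the variational
    inequality, so the point lies on the boundary. Testing along the boundary curve kills the
    tangential part of [g], and testing a second point of the obstacle shows that [g] points
    outward. *)
Lemma coded_reflect (xi : int -> 'I_m) p s : Sigma xi -> coded_orbit K xi p ->
  0 < s -> (forall i j k, i != j -> j != k ->
    forall x y z, K i x -> K j y -> K k z ->
    2 * s <= enorm (dir y z - dir x y)) ->
  forall j, exists u, [/\ 0 <= u < L (xi j), c (xi j) u = p j,
    s <= dot (orbit_dir p j) (n (xi j) u),
    dot (orbit_dir p (j - 1)) (n (xi j) u) = - dot (orbit_dir p j) (n (xi j) u)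
  & orbit_dir p j - orbit_dir p (j - 1) =
      (2 * dot (orbit_dir p j) (n (xi j) u)) *: n (xi j) u].
Proof.
move=> hxi hp s0 hs j.
have [Kp vi] := hp j.
have ne i : xi (i - 1) != xi i by have := hxi (i - 1); rewrite subrK.
have [Km _] := hp (j - 1); have [Kn _] := hp (j + 1).
have := hs _ _ _ (ne j) (hxi j) _ _ _ Km Kp Kn.
have -> : dir (p (j - 1)) (p j) = orbit_dir p (j - 1) by rewrite /orbit_dir subrK.
rewrite -/(orbit_dir p j).
have f1 : dot (orbit_dir p j) (orbit_dir p j) = 1.
  by rewrite -enorm_sqr enorm_dir ?expr1n//; exact: table_neq (hxi j) Kp Kn.
have e1 : dot (orbit_dir p (j - 1)) (orbit_dir p (j - 1)) = 1.
  rewrite -enorm_sqr /orbit_dir subrK enorm_dir ?expr1n//.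
  exact: table_neq (ne j) Km Kp.
set f := orbit_dir p j in f1 vi *; set e := orbit_dir p (j - 1) in e1 vi *.
clearbody f e.
set g := f - e => hg; rewrite -/g in vi.
have g0 : 0 < enorm g by apply: lt_le_trans hg; rewrite mulr_gt0.
have ob := tb_ob tb (xi j).
have fr : frontier (K (xi j)) (p j).
  split; first exact: subset_closure.
  move=> /= int.
  have cl : (fun t : R => p j + t *: g) @ (0 : R) --> p j + (0 : R) *: g.
    apply: cvgD; first exact: cvg_cst.
    by apply: cvgZr_tmp; exact: cvg_id.
  rewrite scale0r addr0 in cl.
  have /cl/nbhs_ballP[r r0 hr] : nbhs (p j) (K (xi j)) by exact: int.
  have r2 : 0 < r / 2 by rewrite divr_gt0.
  have /vi : K (xi j) (p j + (r / 2) *: g).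
    apply: hr; rewrite /ball/= sub0r normrN gtr0_norm//.
    by rewrite [ltRHS](splitr r) ltrDl.
  rewrite addrAC subrr add0r dotZr pmulr_rle0// -enorm_sqr.
  by rewrite leNgt exprn_gt0.
have [u u01 cu] := frontier_param ob fr; exists u.
have gT : dot g (T (xi j) u) = 0.
  have hd : slope_lim setT (fun s => - dot g (c (xi j) s - c (xi j) u)) u
     (- (dot 0 (c (xi j) u - c (xi j) u) + dot g (T (xi j) u - 0))).
    apply: slope_limN; apply: slope_lim_dot; first exact: vslope_lim_cst.
    by apply: vslope_limB; [exact: ob_d1 ob u|exact: vslope_lim_cst].
  have /(slope_lim_min hd) : forall t, - dot g (c (xi j) u - c (xi j) u) <=
      - dot g (c (xi j) t - c (xi j) u).
    move=> t; rewrite subrr {1}/dot /= !mulr0 addr0 oppr0 oppr_ge0 cu.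
    by apply: vi; exact: c_in ob t.
  rewrite subr0 /dot /= !mul0r !add0r => /eqP.
  by rewrite oppr_eq0 => /eqP.
have gE : g = dot g (n (xi j) u) *: n (xi j) u.
  by rewrite [LHS](decomp ob g u) gT scale0r add0r.
set la := dot g (n (xi j) u) in gE.
have la0 : 0 <= la.
  have [y Ky yc] := other_point ob u.
  have := vi y Ky; rewrite -cu gE dotZl; have := strict_n ob Ky yc.
  nra.
have laE : la = enorm g by rewrite gE enormZ (enorm_n ob) mulr1 ger0_norm.
have fE : f = e + la *: n (xi j) u by rewrite -gE /g addrC subrK.
have n1 := dot_nn ob u.
(* Both directions are unit vectors and differ by [la] times the normal, so their normal components
   are [- la / 2] and [la / 2]. *)
have en : dot e (n (xi j) u) = - (la / 2).
  have := f1; rewrite fE dotDl !dotDr !dotZl !dotZr e1 n1 (dotC (rot _) e).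
  have la1 : la != 0 by rewrite laE gt_eqF.
  move=> h; have : la * (2 * dot e (n (xi j) u) + la) = 0 by move: h; lra.
  move=> /eqP; rewrite mulf_eq0 (negbTE la1) /= => /eqP; lra.
have fn : dot f (n (xi j) u) = la / 2.
  by rewrite fE dotDl dotZl n1 en; lra.
split=> //.
- by rewrite fn laE; lra.
- by rewrite en fn.
- by rewrite fn mulrC divfK// -gE.
Qed.

End table.

(** * Uniqueness of coded orbits *)

(** [dir x y] is the gradient of the Euclidean norm at [y - x], and the gradient of a convex
    function is monotone. *)
Lemma dir_monotone (R : realType) (x y x' y' : R * R) : y != x -> y' != x' ->
  0 <= dot (dir x' y' - dir x y) ((y' - x') - (y - x)).
Proof.
move=> yx yx'; rewrite (dirE yx) (dirE yx').
have := dot_le (dir x y) (dir x' y'); rewrite !enorm_dir// mulr1.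
move=> /(le_trans (ler_norm _)).
have e1 : dot (dir x y) (dir x y) = 1 by rewrite -enorm_sqr enorm_dir// expr1n.
have e2 : dot (dir x' y') (dir x' y') = 1 by rewrite -enorm_sqr enorm_dir// expr1n.
have := enorm_ge0 (y - x); have := enorm_ge0 (y' - x').
move: e1 e2; move: (dir x y) (dir x' y') (enorm _) (enorm _) => u u' a b e1 e2.
rewrite dotBl !dotBr !dotZr e1 e2 (dotC u' u); nra.
Qed.

Lemma cvg_rot (R : realType) (X : Type) (F : set_system X) {FF : Filter F}
    (f : X -> R * R) (v : R * R) : f @ F --> v -> rot (f t) @[t --> F] --> rot v.
Proof.
move=> h; apply: cvg_pairP; first exact: cvg_snd_comp h.
by apply: cvgN; exact: cvg_fst_comp h.
Qed.

(* An energy argument: along the difference of two orbits the quantity [a] is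
   nondecreasing, and increases by a definite amount wherever they are apart. *)
Lemma energy_zero (R : realType) (a z : int -> R) (M : R) :
  (forall j, 0 <= z j) -> (forall j, `|a j| <= 2 * z j) -> (forall j, `|a j| <= M) ->
  (forall j, a j <= a (j + 1)) ->
  (forall e, 0 < e -> exists2 h, 0 < h &
     forall j, e <= z j -> a (j - 1) + h <= a j) ->
  forall j, z j = 0.
Proof.
move=> z0 az aM mono inc.
have up j (k : nat) : a j <= a (j + k%:Z).
  elim: k => [|k IH]; first by rewrite addr0.
  apply: le_trans IH _; have -> : j + k.+1%:Z = j + k%:Z + 1 by lia.
  exact: mono.
have arch (h : R) : 0 < h -> exists k : nat, 2 * M < k%:R * h.
  move=> h0; exists (Num.bound (2 * M / h)).
  rewrite -ltr_pdivrMr//.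
  have M0 : 0 <= M by apply: le_trans (aM 0).
  by have := archi_boundP (divr_ge0 (mulr_ge0 (ler0n R 2) M0) (ltW h0)).
(* A positive value persists forward, keeps [z] above half of it and so forces a gain [h] at every
   step, against the bound [M]. Negative values are excluded in the same way backward. *)
have apos j : a j <= 0.
  rewrite leNgt; apply/negP => aj.
  have e0 : 0 < a j / 2 by rewrite divr_gt0.
  have [h h0 hinc] := inc _ e0.
  have far (k : nat) : a j + k%:R * h <= a (j + k%:Z).
    elim: k => [|k IH]; first by rewrite mul0r !addr0.
    have E : j + k%:Z = j + k.+1%:Z - 1 by lia.
    rewrite -addn1 natrD mulrDl mul1r addrA.
    have -> : j + (k + 1)%N%:Z = j + k.+1%:Z by lia.
    rewrite E in IH.
    have := hinc (j + k.+1%:Z); have := az (j + k.+1%:Z).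
    have := ler_norm (a (j + k.+1%:Z)); have := up j k.+1.
    move=> h1 h2 h3 h4.
    have : a j / 2 <= z (j + k.+1%:Z) by lra.
    by move=> /h4; lra.
  have [k hk] := arch h h0; have := far k; have := aM (j + k%:Z).
  by rewrite ler_norml => /andP[q1 q2] q3; have := aM j; rewrite ler_norml => /andP[]; lra.
have aneg j : 0 <= a j.
  rewrite leNgt; apply/negP => aj.
  have e0 : 0 < - a j / 2 by rewrite divr_gt0// oppr_gt0.
  have [h h0 hinc] := inc _ e0.
  have far (k : nat) : a (j - k%:Z) + k%:R * h <= a j.
    elim: k => [|k IH]; first by rewrite mul0r subr0 addr0.
    have E : j - k.+1%:Z = j - k%:Z - 1 by lia.
    rewrite E -addn1 natrD mulrDl mul1r.
    have := hinc (j - k%:Z); have := az (j - k%:Z).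
    have := ler_norm (- a (j - k%:Z)); have := up (j - k%:Z) k.
    rewrite subrK normrN.
    move=> h1 h2 h3 h4.
    have : - a j / 2 <= z (j - k%:Z) by lra.
    by move=> /h4; lra.
  have [k hk] := arch h h0; have := far k; have := aM (j - k%:Z).
  by rewrite ler_norml => /andP[q1 q2] q3; have := aM j; rewrite ler_norml => /andP[]; lra.
have a0 j : a j = 0 by apply/eqP; rewrite eq_le apos aneg.
move=> j; apply/eqP; rewrite eq_le z0 andbT leNgt; apply/negP => zj.
by have [h h0 /(_ j (lexx _))] := inc _ zj; rewrite !a0; lra.
Qed.

Lemma slope_lim_continuous (R : realType) (f : R -> R) x l :
  slope_lim setT f x l -> {for x, continuous f}.
Proof.
move=> /slope_lim_cvg/cvg_withinP h; apply/cvgrPdist_le => e /h[d d0 hd].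
apply/nbhs_ballP; exists d => // y; rewrite /ball/= distrC => yd.
by rewrite distrC; exact: hd.
Qed.

Lemma vslope_lim_continuous (R : realType) (f : R -> R * R) x l :
  vslope_lim setT f x l -> {for x, continuous f}.
Proof.
move=> [d1 d2]; apply: cvg_pairP; first exact: slope_lim_continuous d1.
exact: slope_lim_continuous d2.
Qed.

Section unique.
Variables (R : realType) (m : nat) (K : 'I_m -> set (R * R)) (L : 'I_m -> R).
Variables c T Q : 'I_m -> R -> R * R.
Hypothesis tb : table K L c T Q.

Lemma strict_uniform e : 0 < e -> exists2 h, 0 < h & forall i u y,
  0 <= u < L i -> K i y -> e <= enorm (y - c i u) ->
  dot (rot (T i u)) (y - c i u) <= - h.
Proof.
move=> e0.
pose P i (h : R) := forall u y, 0 <= u < L i -> K i y ->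
  e <= enorm (y - c i u) -> dot (rot (T i u)) (y - c i u) <= - h.
have [||h h0 hP] := @fin_uniform R _ P; last by exists h.
- move=> i; have ob := tb_ob tb i.
  (* The second term is positive where [y] is within [e] of the boundary point, so that [f] is
     positive on the whole compact set; it vanishes at distance at least [e]. *)
  pose f (w : R * (R * R)) := - dot (rot (T i w.1)) (w.2 - c i w.1) +
    Num.max 0 (e - enorm (w.2 - c i w.1)).
  have cc : continuous (c i) by move=> u; exact: vslope_lim_continuous (ob_d1 ob u).
  have cf : continuous f.
    move=> w.
    have c1 : (fun w : R * (R * R) => c i w.1) @ w --> c i w.1.
      by apply: (@cvg_comp _ _ _ fst (c i)); [exact: cvg_fst|exact: cc].
    have c2 : (fun w : R * (R * R) => T i w.1) @ w --> T i w.1.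
      by apply: (@cvg_comp _ _ _ fst (T i)); [exact: cvg_fst|exact: (ob_cont ob)].
    have c3 : (fun w : R * (R * R) => w.2 - c i w.1) @ w --> w.2 - c i w.1.
      by apply: cvgB => //; exact: cvg_snd.
    apply: cvgD; first by apply: cvgN; apply: cvg_dot => //; exact: cvg_rot.
    apply: (@continuous_max R (R * (R * R))%type (fun=> 0)
      (fun w => e - enorm (w.2 - c i w.1)) w); first exact: cvg_cst.
    by apply: cvgB; [exact: cvg_cst|exact: cvg_enorm].
  have cA : compact ((`[(0 : R), L i]%classic : set R) `*` K i).
    by apply: compact_setX; [exact: segment_compact|exact: ob_compact ob].
  have [|d d0 hd] := compact_gt0 cA (continuous_subspaceT cf).
    move=> [u y] [/= _ Ky]; rewrite /f /=.
    have [->|yc] := eqVneq y (c i u).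
      rewrite subrr dot0r oppr0 add0r.
      have -> : enorm (0 : R * R) = 0 by rewrite /enorm dot0r sqrtr0.
      by rewrite subr0 lt_max e0 orbT.
    apply: ltr_pwDl; last by rewrite le_max lexx.
    by rewrite oppr_gt0; exact: (strict_n ob).
  exists d => // u y /andP[u0 uL] Ky ey.
  have := hd (u, y); rewrite /f /= => h.
  have {h} := h (conj _ Ky); rewrite in_itv/= u0 (ltW uL) => /(_ isT).
  have -> : Num.max 0 (e - enorm (y - c i u)) = 0.
    by apply/max_idPl; rewrite subr_le0.
  by rewrite addr0 lerNr.
- move=> i d d' _ dd' Pd u y uL Ky ey.
  by apply: le_trans (Pd u y uL Ky ey) _; rewrite lerN2.
Qed.

(** The energy [a j] pairs the difference of outgoing directions with the difference of positions.
    Along a flight it cannot decrease, by [dir_monotone]. At a reflection each variational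
    inequality, tested at the point of the other orbit, adds a nonnegative amount, and strict
    convexity makes that of [p] at least [2 * s * h] where the points are [e] apart. *)
Lemma coded_unique (xi : int -> 'I_m) p q : Sigma xi ->
  coded_orbit K xi p -> coded_orbit K xi q -> forall j, q j = p j.
Proof.
move=> hxi hp hq.
have [s s0 hs] := turn_gap tb; have [D D0 hD] := table_diam tb.
pose z j := enorm (q j - p j).
pose g j := orbit_dir q j - orbit_dir p j.
pose a j := dot (g j) (q j - p j).
have pne j : p (j + 1) != p j by exact: (table_neq tb (hxi j) (hp j).1 (hp (j + 1)).1).
have qne j : q (j + 1) != q j by exact: (table_neq tb (hxi j) (hq j).1 (hq (j + 1)).1).
have gb j : enorm (g j) <= 2.
  rewrite /g; apply: le_trans (enormD _ _) _; rewrite enormN /orbit_dir.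
  by rewrite !enorm_dir.
have az j : `|a j| <= 2 * z j.
  by apply: le_trans (dot_le _ _) _; rewrite ler_wpM2r ?gb// enorm_ge0.
have step j : a j <= a (j + 1) - dot (g (j + 1) - g j) (q (j + 1) - p (j + 1)).
  rewrite dotBl opprB addrCA subrr addr0.
  have := dir_monotone (pne j) (qne j).
  rewrite -/(orbit_dir q j) -/(orbit_dir p j) -/(g j).
  have -> : q (j + 1) - q j - (p (j + 1) - p j) =
    (q (j + 1) - p (j + 1)) - (q j - p j).
    by rewrite !opprB addrACA [RHS]addrACA; congr (_ + _); rewrite addrC.
  by rewrite dotBr subr_ge0.
have inc j : 0 <= dot (g (j + 1) - g j) (q (j + 1) - p (j + 1)) -
    dot (orbit_dir p (j + 1) - orbit_dir p j) (p (j + 1) - q (j + 1)).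
  have [_ /(_ (p (j + 1)) (hp _).1)] := hq (j + 1).
  rewrite addrK -[q (j + 1) - p (j + 1)]opprB.
  rewrite /g !dotNr; set v := p (j + 1) - q (j + 1).
  rewrite !dotBl; lra.
have pq j : 0 <= dot (orbit_dir p (j + 1) - orbit_dir p j) (p (j + 1) - q (j + 1)).
  have [_ /(_ (q (j + 1)) (hq _).1)] := hp (j + 1).
  by rewrite addrK -[p (j + 1) - q _]opprB dotNr oppr_ge0.
suff zz : forall j, z j = 0.
  by move=> j; apply/eqP; rewrite -subr_eq0; apply/eqP; apply: enorm_eq0; exact: zz.
apply: (energy_zero (a := a) (M := 2 * D)) => //.
- by move=> j; exact: enorm_ge0.
- move=> j; apply: le_trans (az j) _; rewrite ler_pM2l//.
  exact: hD (hp j).1 (hq j).1.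
- by move=> j; have := step j; have := inc j; have := pq j; lra.
- move=> e e0; have [h h0 hh] := strict_uniform e0.
  exists (2 * s * h); first by rewrite !mulr_gt0.
  move=> j ez; have E : j - 1 + 1 = j by rewrite subrK.
  have := step (j - 1); have := inc (j - 1); rewrite !E.
  suff : 2 * s * h <= dot (orbit_dir p j - orbit_dir p (j - 1)) (p j - q j) by lra.
  have [u [uL cu sn _ ->]] := coded_reflect tb hxi hp s0 hs j.
  rewrite -[p j - q j]opprB dotNr dotZl -cu.
  have /(_ uL (hq j).1) := hh (xi j) u (q j).
  rewrite cu => /(_ ez); rewrite -cu; nra.
Qed.

End unique.

(** * Existence of coded orbits *)

Definition optimal (R : realType) (A : set (R * R)) (p : int -> R * R) (j : int) :=
  forall y, A y -> enorm (p j - p (j - 1)) + enorm (p (j + 1) - p j)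
    <= enorm (y - p (j - 1)) + enorm (p (j + 1) - y).

(** A first-order expansion with an explicit remainder in place of a derivative of the norm; it
    amounts to (|x| - |x + v|)^2 >= 0. *)
Lemma enorm_expand (R : realType) (x v : R * R) : x != 0 ->
  enorm (x + v) <= enorm x + dot x v / enorm x + dot v v / (2 * enorm x).
Proof.
move=> /enorm_gt0 x0; set a := enorm x in x0 *.
have a2 : a ^+ 2 = dot x x by exact: enorm_sqr.
have v0 := dot_ge0 v.
have -> : a + dot x v / a + dot v v / (2 * a) =
    (2 * dot x x + 2 * dot x v + dot v v) / (2 * a).
  by rewrite -a2; field; rewrite gt_eqF.
rewrite ler_pdivlMr ?mulr_gt0//.
have := enorm_sqr (x + v); rewrite dotDl !dotDr (dotC v x).
set b := enorm (x + v); move=> b2.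
have := sqr_ge0 (a - b); rewrite sqrrB a2 b2; nra.
Qed.

(** Moving [y] towards [w] by the fraction [t] shortens the path by at least [t] times this product
    minus t^2 * C; minimality and small [t] leave the sign. *)
Lemma optimal_variation (R : realType) (x y z : R * R) (A : set (R * R)) :
  y != x -> z != y -> A y ->
  (forall w t, A w -> 0 <= t <= 1 -> A (y + t *: (w - y))) ->
  (forall w, A w -> enorm (y - x) + enorm (z - y) <= enorm (w - x) + enorm (z - w)) ->
  forall w, A w -> dot (dir y z - dir x y) (w - y) <= 0.
Proof.
move=> yx zy Ay cA opt w Aw.
have a0 : 0 < enorm (y - x) by rewrite enorm_gt0// subr_eq0.
have b0 : 0 < enorm (z - y) by rewrite enorm_gt0// subr_eq0.
set v := w - y.
pose C := dot v v / (2 * enorm (y - x)) + dot v v / (2 * enorm (z - y)).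
have C0 : 0 <= C by rewrite addr_ge0// divr_ge0 ?dot_ge0 ?mulr_ge0 ?enorm_ge0.
have key t : 0 < t -> t <= 1 -> dot (dir y z - dir x y) v <= t * C.
  move=> t0 t1.
  have t01 : 0 <= t <= 1 by rewrite ltW.
  have := opt _ (cA w t Aw t01); rewrite -/v.
  have -> : y + t *: v - x = (y - x) + t *: v by rewrite addrAC.
  have -> : z - (y + t *: v) = (z - y) + (- t) *: v by rewrite opprD scaleNr addrA.
  move=> h; have yx0 : y - x != 0 by rewrite subr_eq0.
  have zy0 : z - y != 0 by rewrite subr_eq0.
  have := le_trans h (lerD (enorm_expand (t *: v) yx0) (enorm_expand ((- t) *: v) zy0)).
  have -> : dot (dir y z - dir x y) v =
      (enorm (z - y))^-1 * dot (z - y) v - (enorm (y - x))^-1 * dot (y - x) v.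
    by rewrite dotBl /dir !dotZl.
  rewrite /C !dotZl !dotZr.
  set a := enorm (y - x) in a0 *; set b := enorm (z - y) in b0 *.
  set p := dot (y - x) v; set q := dot (z - y) v; set d := dot v v => h2.
  rewrite -(ler_pM2l t0).
  have E : t * (t * (d / (2 * a) + d / (2 * b))) - t * (b^-1 * q - a^-1 * p) =
   a + t * p / a + t * (t * d) / (2 * a) +
    (b + - t * q / b + - t * (- t * d) / (2 * b)) - (a + b).
    by field; rewrite !gt_eqF.
  by rewrite -subr_ge0 E subr_ge0.
apply/ler_addgt0Pr => e e0; rewrite add0r.
have C1 : 0 < C + 1 by rewrite ltr_wpDl.
pose t := Num.min 1 (e / (C + 1)).
have t0 : 0 < t by rewrite lt_min ltr01 divr_gt0.
have t1 : t <= 1 by rewrite ge_min lexx.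
apply: le_trans (key t t0 t1) _.
apply: (@le_trans _ _ (e / (C + 1) * (C + 1))); last by rewrite divfK// gt_eqF.
by apply: ler_pM; rewrite ?(ltW t0) ?ge_min ?lexx ?orbT ?lerDl.
Qed.

Section existence.
Variables (R : realType) (m : nat) (K : 'I_m -> set (R * R)) (L : 'I_m -> R).
Variables c T Q : 'I_m -> R -> R * R.
Hypothesis tb : table K L c T Q.
Variable xi : int -> 'I_m.
Hypothesis hxi : Sigma xi.

Notation seqs := (prod_topology (fun _ : int => (R * R)%type)).

Definition admissible : set seqs := [set p | forall j, K (xi j) (p j)].

Lemma admissible_compact : compact admissible.
Proof.
apply: (@tychonoff int (fun _ => (R * R)%type) (fun j => K (xi j))) => j.
exact: ob_compact (tb_ob tb _).
Qed.

Lemma cvg_coord (p : seqs) j : (fun f : seqs => f j) @ p --> p j.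
Proof. exact: (@proj_continuous _ (fun _ : int => (R * R)%type) j p). Qed.

(** The length of [n] consecutive segments is minimised over all admissible sequences, with free
    ends. Changing one inner point affects two segments, so each inner point is optimal given its
    neighbours. *)
Lemma optimal_window (s : int) (n : nat) : exists2 p : seqs, admissible p &
  forall k, (k.+1 < n)%N -> optimal (K (xi (s + k.+1%:Z))) p (s + k.+1%:Z).
Proof.
pose len (f : seqs) (k : nat) := enorm (f (s + k%:Z + 1) - f (s + k%:Z)).
pose J (f : seqs) := \sum_(k < n) len f k.
have cJ : continuous J.
  apply: (continuous_big (@add_continuous R)) => k _ f.
  exact: (cvg_enorm (cvgB (@cvg_coord f (s + k%:Z + 1)) (@cvg_coord f (s + k%:Z)))).
have A0 : admissible !=set0.
  by exists (fun j => c (xi j) 0) => j; exact: c_in (tb_ob tb _) 0.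
have [p /set_mem Ap hp] :=
  compact_EVT_min A0 admissible_compact (continuous_subspaceT cJ).
exists p => // k kn y Ky; set j := s + k.+1%:Z.
pose f : seqs := fun i => if i == j then y else p i.
have Af : admissible f.
  by move=> i; rewrite /f; case: eqP => [->|_] //; exact: Ap.
have fj : f j = y by rewrite /f eqxx.
have fo i : i != j -> f i = p i by rewrite /f => /negbTE ->.
have := hp f (mem_set Af); rewrite /J.
have kn' : (k < n)%N by exact: ltnW.
rewrite (bigD1 (Ordinal kn')) // (bigD1 (Ordinal kn)) //=; last first.
  by rewrite -(inj_eq val_inj)/=; lia.
rewrite [leRHS](bigD1 (Ordinal kn')) // [in leRHS](bigD1 (Ordinal kn)) //=; last first.
  by rewrite -(inj_eq val_inj)/=; lia.
rewrite !addrA [X in _ <= _ + X](_ : _ = \sum_(i < n | (i != Ordinal kn') && (i != Ordinal kn)) len p i); last first.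
  apply: eq_bigr => i /andP[i1 i2].
  have {}i1 : (i != k :> nat) by [].
  have {}i2 : (i != k.+1 :> nat) by [].
  rewrite /len !fo//; rewrite /j; lia.
rewrite lerD2r /len.
have -> : s + k%:Z + 1 = j by rewrite /j; lia.
have -> : s + k%:Z = j - 1 by rewrite /j; lia.
have -> : s + k.+1%:Z = j by [].
rewrite fj !fo//; lia.
Qed.

(** Optimality at one index involves three coordinates, so it passes to a cluster point, in the
    product topology, of minimisers over growing windows. *)
Lemma coded_exists : exists p, coded_orbit K xi p.
Proof.
have /choice[pN hN] : forall N : nat, exists p : seqs, admissible p /\
    forall j : int, - N%:Z <= j <= N%:Z -> optimal (K (xi j)) p j.
  (* The window starts one index before [- N], which makes all of [- N, N] interior. *)
  move=> N; have [p Ap op] := optimal_window (- N%:Z - 1) (N + N + 3).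
  exists p; split=> // j hj.
  have E : (- N%:Z - 1) + (absz (j + N%:Z)%R).+1%:Z = j by lia.
  by have := op (absz (j + N%:Z)%R); rewrite E; apply; lia.
have FA : (pN @ \oo) admissible by exists 0%N => // N _; exact: (hN N).1.
have [p [Ap clp]] := admissible_compact (fmap_proper_filter pN _) FA.
exists p => j; split; first exact: Ap.
have ne i : xi (i - 1) != xi i by have := hxi (i - 1); rewrite subrK.
rewrite /orbit_dir subrK.
apply: optimal_variation.
- exact: (table_neq tb (ne j) (Ap _) (Ap _)).
- exact: (table_neq tb (hxi j) (Ap _) (Ap _)).
- exact: Ap.
- by move=> w t Kw t01; apply: (ob_convex (tb_ob tb _)) => //; exact: Ap.
move=> y Ky; rewrite leNgt; apply/negP => lt.
pose D (f : seqs) := enorm (f j - f (j - 1)) + enorm (f (j + 1) - f j) -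
  (enorm (y - f (j - 1)) + enorm (f (j + 1) - y)).
have cD : D f @[f --> p] --> D p.
  have cc i := @cvg_coord p i; have cy : (fun _ : seqs => y) @ p --> y.
    by move=> X /nbhs_singleton Xy; apply: (@filterE _ (nbhs p) (@nbhs_filter seqs p)).
  exact: (cvgB (cvgD (cvg_enorm (cvgB (cc j) (cc (j - 1))))
                     (cvg_enorm (cvgB (cc (j + 1)) (cc j))))
               (cvgD (cvg_enorm (cvgB cy (cc (j - 1))))
                     (cvg_enorm (cvgB (cc (j + 1)) cy)))).
have Dp : 0 < D p by rewrite subr_gt0.
have nD : nbhs p [set f | 0 < D f].
  have /cvgrPdist_lt/(_ _ Dp) := cD; apply: filterS => f /=.
  by rewrite ltr_distlC subrr => /andP[].
have FD : (pN @ \oo) [set f | D f <= 0].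
  exists (absz j) => // N /= hjN; rewrite /D subr_le0.
  by apply: (hN N).2 => //; lia.
have [f [/= f1 f2]] := clp _ _ FD nD.
by move: f1; rewrite leNgt f2.
Qed.

End existence.

(** * The billiard map *)

Section billiard.
Variables (R : realType) (m : nat) (K : 'I_m -> set (R * R)) (L : 'I_m -> R).
Variables c T Q : 'I_m -> R -> R * R.
Hypothesis tb : table K L c T Q.
Notation n i u := (rot (T i u)).
Notation phase := ((R * R) * (R * R))%type.

Lemma nE i u : normal (c i) u = n i u.
Proof. exact: ob_normal (tb_ob tb i) u. Qed.

Lemma c_K i u : K i (c i u).
Proof. exact: c_in (tb_ob tb i) u. Qed.

(** Makes the normal a function of the boundary point, whichever obstacle and parameter witness it
    in [next_reflection]. *)
Lemma same_point i j u v : c i u = c j v -> i = j /\ n i u = n j v.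
Proof.
move=> E; have ij : i = j.
  apply/eqP; apply: contraT => /(tb_disj tb) /(_ (c_K i u)) []; rewrite E.
  exact: c_K.
by subst j; split=> //; rewrite (tangent_unique (tb_ob tb i) E).
Qed.

Lemma reflectK (v w : R * R) : dot w w = 1 ->
  v - (2 * dot v w) *: w - (2 * dot (v - (2 * dot v w) *: w) w) *: w = v.
Proof.
move=> w1; rewrite dotBl dotZl w1 mulr1.
have -> : 2 * (dot v w - 2 * dot v w) = - (2 * dot v w) by ring.
by rewrite scaleNr opprK subrK.
Qed.

Lemma reflect_dot (v w : R * R) : dot w w = 1 ->
  dot (v - (2 * dot v w) *: w) w = - dot v w.
Proof. by move=> w1; rewrite dotBl dotZl w1 mulr1; ring. Qed.

Lemma reflect_norm (v w : R * R) : dot w w = 1 ->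
  enorm (v - (2 * dot v w) *: w) = enorm v.
Proof.
move=> w1; congr Num.sqrt; rewrite dotBr dotZr reflect_dot//.
by rewrite dotBl dotZl (dotC w v); ring.
Qed.

Lemma n1 i u : dot (n i u) (n i u) = 1.
Proof. exact: dot_nn (tb_ob tb i) u. Qed.

Lemma next_unique (x y y' : phase) : next_reflection K c x y ->
  next_reflection K c x y' -> y = y'.
Proof.
move=> [t [i [u [t0 yE free yc yv]]]] [t' [i' [u' [t0' yE' free' yc' yv']]]].
have tt : t = t'.
  apply/eqP; rewrite eq_le !leNgt; apply/andP; split; apply/negP => lt.
    by apply: (free t' t0' lt i'); rewrite -yE' yc'; exact: c_K.
  by apply: (free' t t0 lt i); rewrite -yE yc; exact: c_K.
have E1 : y.1 = y'.1 by rewrite yE yE' tt.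
have [ii nn] : i = i' /\ n i u = n i' u' by apply: same_point; rewrite -yc -yc'.
rewrite [y]surjective_pairing [y']surjective_pairing E1 yv yv' !nE nn.
by [].
Qed.

(** Reflection is an involution, so the incoming velocity is determined by [y]; free flight then
    forbids one departure point to lie strictly between the other and [y]. *)
Lemma prev_unique (x x' y : phase) : (exists i, K i x.1) -> (exists i, K i x'.1) ->
  next_reflection K c x y -> next_reflection K c x' y -> x = x'.
Proof.
move=> [k Kx] [k' Kx'] [t [i [u [t0 yE free yc yv]]]]
  [t' [i' [u' [t0' yE' free' yc' yv']]]].
have [ii nn] : i = i' /\ n i u = n i' u' by apply: same_point; rewrite -yc -yc'.
have vv : x.2 = x'.2.
  rewrite nE in yv; rewrite nE -nn in yv'.
  rewrite -(reflectK x.2 (n1 i u)) -(reflectK x'.2 (n1 i u)) -yv -yv'.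
  by [].
have tt : t = t'.
  apply/eqP; rewrite eq_le !leNgt; apply/andP; split; apply/negP => lt.
    apply: (free (t - t') _ _ k'); rewrite ?subr_gt0 ?gtrBl//.
    have -> : x.1 + (t - t') *: x.2 = y.1 - t' *: x.2.
      by rewrite yE scalerBl addrA.
    by rewrite yE' vv addrK.
  apply: (free' (t' - t) _ _ k); rewrite ?subr_gt0 ?gtrBl//.
  have -> : x'.1 + (t' - t) *: x'.2 = y.1 - t *: x'.2.
    by rewrite yE' scalerBl addrA.
  by rewrite yE vv addrK.
have : x.1 = x'.1.
  by apply: (addIr (t *: x.2)); rewrite -yE yE' vv tt.
by rewrite [x]surjective_pairing [x']surjective_pairing vv => /= ->.
Qed.

Lemma next_other (x y : phase) i j : next_reflection K c x y -> K i x.1 -> K j y.1 ->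
  i != j.
Proof.
move=> [t [k [u [t0 yE free yc yv]]]] Kx Ky; apply/eqP => ij; subst j.
have t2 : 0 < t / 2 by rewrite divr_gt0.
have th : t / 2 < t by rewrite [ltRHS](splitr t) ltrDl.
apply: (free (t / 2) t2 th i).
have -> : x.1 + (t / 2) *: x.2 = x.1 + (2^-1 : R) *: (y.1 - x.1).
  by rewrite yE addrAC subrr add0r scalerA mulrC.
apply: (ob_convex (tb_ob tb i)) => //.
by rewrite invr_ge0 ler0n/= invf_le1// ler1n.
Qed.

Lemma next_hit (x y : phase) : next_reflection K c x y -> exists i u, y.1 = c i u.
Proof. by move=> [t [i [u [_ _ _ yc _]]]]; exists i, u. Qed.

Lemma next_dir (x y : phase) : next_reflection K c x y -> enorm x.2 = 1 ->
  x.2 = dir x.1 y.1 /\ 0 < enorm (y.1 - x.1).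
Proof.
move=> [t [k [u [t0 yE _ _ _]]]] x1.
have E : y.1 - x.1 = t *: x.2 by rewrite yE addrAC subrr add0r.
have Et : enorm (y.1 - x.1) = t by rewrite E enormZ x1 mulr1 gtr0_norm.
rewrite /dir Et E scalerA mulVf ?gt_eqF// scale1r; split=> //.
Qed.

(** [next_reflection] does not prescribe the side of the incoming velocity. If it pointed outward,
    the position just before impact would lie in the obstacle by [tangent_cone], against free
    flight. *)
Lemma next_outward (x y : phase) i u : next_reflection K c x y -> y.1 = c i u ->
  0 <= dot y.2 (n i u).
Proof.
move=> [t [k [v [t0 yE free yc yv]]]] yc'.
have [ik nn] : i = k /\ n i u = n k v by apply: same_point; rewrite -yc -yc'.
rewrite yv nE nn reflect_dot ?n1// oppr_ge0 leNgt; apply/negP => xn.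
have xn' : 0 < det2 (T k v) (- x.2).
  by rewrite det2C -dot_rot dotNl opprK.
have [s0 s00 hs] := tangent_cone (tb_ob tb k) xn'.
pose s := Num.min s0 t / 2.
have m0 : 0 < Num.min s0 t by rewrite lt_min s00.
have spos : 0 < s by rewrite divr_gt0.
have : s < Num.min s0 t by rewrite [ltRHS](splitr (Num.min _ _)) ltrDl.
rewrite lt_min => /andP[s1 s2].
apply: (free (t - s) _ _ k); rewrite ?subr_gt0 ?gtrBl//.
have -> : x.1 + (t - s) *: x.2 = c k v + s *: - x.2.
  by rewrite -yc yE scalerBl scalerN addrA.
exact: hs.
Qed.

(** [nonwandering] prescribes speed and side at time 0; reflections preserve the speed in both
    directions of time, and [next_outward] gives the side. *)
Lemma nonwandering_orbit (x : phase) : nonwandering K c x ->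
  exists o : int -> phase, [/\ o 0 = x,
    forall j, next_reflection K c (o j) (o (j + 1)),
    forall j, enorm (o j).2 = 1 & forall j, nonwandering K c (o j)].
Proof.
move=> [[i [u [xc xn]]] x1 [w [w0 on]]].
have on' j : next_reflection K c (w (j - 1)) (w j) by have := on (j - 1); rewrite subrK.
have norm_step j : enorm (w (j + 1)).2 = enorm (w j).2.
  have [t [k [v [_ _ _ _ ->]]]] := on j.
  by rewrite nE reflect_norm// n1.
have norm_pos (k : nat) : enorm (w k%:Z).2 = 1.
  elim: k => [|k IH]; first by rewrite w0.
  have -> : k.+1%:Z = k%:Z + 1 by lia.
  by rewrite norm_step.
have norm_neg (k : nat) : enorm (w (- k%:Z)).2 = 1.
  elim: k => [|k IH]; first by rewrite oppr0 w0.
  rewrite -norm_step; have -> : - k.+1%:Z + 1 = - k%:Z :> int by lia.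
  exact: IH.
have norm1 j : enorm (w j).2 = 1.
  by case: j => k; [exact: norm_pos|rewrite NegzE; exact: norm_neg].
exists w; split=> // j; split=> //.
- have [k [v E]] := next_hit (on' j); exists k, v.
  by rewrite nE; split; [exact: E|exact: next_outward (on' j) E].
- exists (fun i => w (j + i)); split; first by rewrite addr0.
  by move=> i'; rewrite addrA; exact: on.
Qed.

Lemma billiard_map_next (x y : phase) : nonwandering K c y ->
  next_reflection K c x y -> billiard_map K c x = y.
Proof.
move=> ny xy; apply: (@next_unique x) => //.
by have [] : [set z | nonwandering K c z /\ next_reflection K c x z]
  (billiard_map K c x) by apply: xgetI (conj ny xy).
Qed.

Lemma nonwandering_K (x : phase) : nonwandering K c x -> exists i, K i x.1.
Proof. by move=> [[i [u [-> _]]] _ _]; exists i; exact: c_K. Qed.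

Lemma billiard_map_inv_prev (x y : phase) : nonwandering K c x ->
  next_reflection K c x y -> billiard_map_inv K c y = x.
Proof.
move=> nx xy.
have [n2 h2] : [set z | nonwandering K c z /\ next_reflection K c z y]
  (billiard_map_inv K c y) by apply: xgetI (conj nx xy).
exact: (prev_unique (nonwandering_K n2) (nonwandering_K nx) h2 xy).
Qed.

Lemma billiard_iter_orbit (o : int -> phase) :
  (forall j, nonwandering K c (o j)) ->
  (forall j, next_reflection K c (o j) (o (j + 1))) ->
  forall j, billiard_iter K c j (o 0) = o j.
Proof.
move=> no on [k|k] /=.
  elim: k => [//|k IH]; rewrite iterS IH.
  apply: billiard_map_next => //; have := on k%:Z.
  by have -> : k%:Z + 1 = k.+1%:Z by lia.
have H (k' : nat) : iter k' (billiard_map_inv K c) (o 0) = o (- k'%:Z).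
  elim: k' => [|k' IH]; first by rewrite oppr0.
  rewrite iterS IH; apply: billiard_map_inv_prev => //.
  have := on (- k'.+1%:Z).
  by have -> : - k'.+1%:Z + 1 = - k'%:Z :> int by lia.
by rewrite -[LHS]/(iter k.+1 (billiard_map_inv K c) (o 0)) H NegzE.
Qed.

Section coding.
Variable xi : int -> 'I_m.
Hypothesis hxi : Sigma xi.

Lemma frontier_K i p : frontier (K i) p -> K i p.
Proof. exact: frontier_sub (tb_ob tb i) p. Qed.

(** Where there is no successor [billiard_map] returns its argument, and likewise for the inverse.
    Such a default would repeat a position, whereas consecutive symbols name disjoint obstacles, so
    every step is a genuine reflection. The variational inequality is then the reflection law paired
    with the supporting line. *)
Lemma billiard_coded (x : phase) : nonwandering K c x ->
  (forall j, frontier (K (xi j)) (billiard_iter K c j x).1) ->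
  coded_orbit K xi (fun j => (billiard_iter K c j x).1).
Proof.
move=> nx fx; pose o j := billiard_iter K c j x.
have Ko j : K (xi j) (o j).1 by apply: frontier_K; exact: fx.
have ne j : (o j).1 <> (o (j + 1)).1.
  move=> E; apply: (@tb_disj _ _ _ _ _ _ _ tb (xi j) (xi (j + 1)) (o j).1) => //.
  by rewrite E.
have fwd (z : phase) : (billiard_map K c z).1 <> z.1 ->
    nonwandering K c (billiard_map K c z) /\
    next_reflection K c z (billiard_map K c z).
  move=> h.
  have [[y hy]|nex] := pselect (exists y,
    [set y | nonwandering K c y /\ next_reflection K c z y] y).
    by have := xgetI z hy.
  by exfalso; apply: h; rewrite /billiard_map xgetPN// => y hy; apply: nex; exists y.
have bwd (z : phase) : (billiard_map_inv K c z).1 <> z.1 ->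
    nonwandering K c (billiard_map_inv K c z) /\
    next_reflection K c (billiard_map_inv K c z) z.
  move=> h.
  have [[y hy]|nex] := pselect (exists y,
    [set y | nonwandering K c y /\ next_reflection K c y z] y).
    by have := xgetI z hy.
  by exfalso; apply: h; rewrite /billiard_map_inv xgetPN// => y hy; apply: nex; exists y.
have stepP (k : nat) : nonwandering K c (o k%:Z) /\
    next_reflection K c (o k%:Z) (o (k%:Z + 1)).
  have oS (l : nat) : o (l%:Z + 1) = billiard_map K c (o l%:Z).
    by have -> : l%:Z + 1 = l.+1%:Z by lia.
  have nxt (l : nat) : nonwandering K c (o (l%:Z + 1)) /\
      next_reflection K c (o l%:Z) (o (l%:Z + 1)).
    by rewrite oS; apply: fwd => E; apply: (ne l%:Z); rewrite oS E.
  split; last exact: (nxt k).2.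
  case: k => [//|k]; have := (nxt k).1.
  by have -> : k%:Z + 1 = k.+1%:Z by lia.
have stepN (k : nat) : nonwandering K c (o (Negz k)) /\
    next_reflection K c (o (Negz k)) (o (Negz k + 1)).
  have oS : o (Negz k) = billiard_map_inv K c (o (Negz k + 1)).
    case: k => [//|k].
    by have -> : Negz k.+1 + 1 = Negz k by lia.
  by rewrite oS; apply: bwd => E; apply: (ne (Negz k)); rewrite -E -oS.
have no j : nonwandering K c (o j) by case: j => k; [exact: (stepP k).1|exact: (stepN k).1].
have on j : next_reflection K c (o j) (o (j + 1)).
  by case: j => k; [exact: (stepP k).2|exact: (stepN k).2].
move=> j; split; first exact: Ko.
move=> y Ky; rewrite /orbit_dir -!/(o _).
have dE i : dir (o i).1 (o (i + 1)).1 = (o i).2.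
  by have [] := next_dir (on i); first by have [] := no i.
rewrite !dE.
have := on (j - 1); rewrite subrK => oj.
have [t [i [u [_ _ _ yc yv]]]] := oj.
have out := next_outward oj yc.
have ij : i = xi j.
  apply/eqP; apply: contraT => /(tb_disj tb) /(_ (c_K i u)) [].
  by rewrite -yc; exact: Ko.
rewrite ij in yc yv out; rewrite nE in yv.
rewrite yv reflect_dot ?n1// in out.
have -> : (o j).2 - (o (j - 1)).2 =
    (- (2 * dot (o (j - 1)).2 (n (xi j) u))) *: n (xi j) u.
  by rewrite yv addrAC subrr sub0r scaleNr.
rewrite dotZl yc; have := ccw_n (tb_ob tb (xi j)) u Ky.
move: out; set a := dot _ _; set b := dot _ _; nra.
Qed.

Variable p : int -> R * R.
Hypothesis hp : coded_orbit K xi p.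

Lemma coded_ne j : p (j + 1) != p j.
Proof. exact: (table_neq tb (hxi j) (hp j).1 (hp (j + 1)).1). Qed.

Lemma coded_reflect_gt0 j : exists u, [/\ 0 <= u < L (xi j), c (xi j) u = p j,
    0 < dot (orbit_dir p j) (n (xi j) u),
    dot (orbit_dir p (j - 1)) (n (xi j) u) = - dot (orbit_dir p j) (n (xi j) u)
  & orbit_dir p j - orbit_dir p (j - 1) =
      (2 * dot (orbit_dir p j) (n (xi j) u)) *: n (xi j) u].
Proof.
have [s s0 hs] := turn_gap tb.
have [u [u1 u2 u3 u4 u5]] := coded_reflect tb hxi hp s0 hs j.
by exists u; split=> //; exact: lt_le_trans u3.
Qed.

(** The flight avoids the obstacle it leaves and the one it reaches by their supporting lines, and
    all others by the no-eclipse condition. *)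
Lemma coded_next j :
  next_reflection K c (p j, orbit_dir p j) (p (j + 1), orbit_dir p (j + 1)).
Proof.
have d0 : 0 < enorm (p (j + 1) - p j) by rewrite enorm_gt0// subr_eq0 coded_ne.
have pE : p (j + 1) = p j + enorm (p (j + 1) - p j) *: orbit_dir p j.
  by rewrite -dirE ?coded_ne// [RHS]addrC subrK.
have [u [_ cu su _ _]] := coded_reflect_gt0 j.
have [v [_ cv sv ev fv]] := coded_reflect_gt0 (j + 1); rewrite addrK in ev fv.
exists (enorm (p (j + 1) - p j)), (xi (j + 1)), v; split=> //=.
- move=> s s0 sd k Kk.
  have [kj|kj] := eqVneq k (xi j).
    subst k; have := ccw_n (tb_ob tb (xi j)) u Kk.
    rewrite cu addrAC subrr add0r dotZr dotC => h.
    by have := mulr_gt0 s0 su; rewrite ltNge h.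
  have [kn|kn] := eqVneq k (xi (j + 1)).
    subst k; have := ccw_n (tb_ob tb (xi (j + 1))) v Kk.
    rewrite cv {1}pE opprD addrACA subrr add0r -scalerBl dotZr dotC ev mulrN.
    rewrite oppr_le0 pmulr_lge0// subr_ge0 => h.
    by move: sd; rewrite ltNge h.
  have Ecl := @tb_ecl _ _ _ _ _ _ _ tb (xi j) (xi (j + 1)) k (p j) (p (j + 1))
    (s / enorm (p (j + 1) - p j)).
  apply: Ecl => //; try by rewrite eq_sym.
  + exact: (hp j).1. + exact: (hp (j + 1)).1.
  + by rewrite divr_ge0 ?(ltW s0) ?(ltW d0)//= ler_pdivrMr// mul1r ltW.
  + by move: Kk; rewrite /= /orbit_dir /dir scalerA.
- rewrite nE ev mulrN scaleNr opprK -fv.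
  by rewrite [RHS]addrC subrK.
Qed.

Lemma coded_nonwandering j : nonwandering K c (p j, orbit_dir p j).
Proof.
split.
- have [u [_ cu su _ _]] := coded_reflect_gt0 j.
  by exists (xi j), u; split=> //=; rewrite nE ltW.
- by rewrite /= enorm_dir// coded_ne.
- exists (fun i => (p (j + i), orbit_dir p (j + i))); rewrite addr0; split=> // i.
  by rewrite addrA; exact: coded_next.
Qed.

Lemma coded_iter j : billiard_iter K c j (p 0, orbit_dir p 0) = (p j, orbit_dir p j).
Proof.
apply: (billiard_iter_orbit (o := fun j => (p j, orbit_dir p j))).
  exact: coded_nonwandering.
exact: coded_next.
Qed.

(** The orbit [p] shows that the set from which [chi] chooses is inhabited; whatever is chosen
    follows the code [xi], so [coded_unique] identifies it with [p]. *)
Lemma reflection_point_coded j : reflection_point K c xi j = p j.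
Proof.
have [nx fx] : [set x | nonwandering K c x /\
    forall j : int, frontier (K (xi j)) (billiard_iter K c j x).1] (chi K c xi).
  apply: (@xgetI _ _ _ (p 0, orbit_dir p 0)).
  split; first exact: coded_nonwandering.
  move=> i; rewrite coded_iter /=.
  have [u [_ <- _ _ _]] := coded_reflect_gt0 i; exact: c_frontier (tb_ob tb _) u.
exact: (coded_unique tb hxi hp (billiard_coded nx fx) j).
Qed.

End coding.
End billiard.

(** * Positivity of the extremal constants *)

Lemma slope_lim_shift (R : realType) (f : R -> R) s x l :
  slope_lim setT f (x + s) l -> slope_lim setT (fun y => f (y + s)) x l.
Proof.
move=> /slope_limP h; apply/slope_limP => e /h[d d0 hd]; exists d => // y _ yd.
have := hd (y + s) Logic.I.
have -> : y + s - (x + s) = y - x by ring.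
exact.
Qed.

Lemma slope_limT_unique (R : realType) (f : R -> R) x l l' :
  slope_lim setT f x l -> slope_lim setT f x l' -> l = l'.
Proof.
move=> /slope_limP h /slope_limP h'; apply/eqP; rewrite -subr_eq0 -normr_le0.
apply/ler_addgt0Pr => e e0; rewrite add0r.
have e2 : 0 < e / 2 by rewrite divr_gt0.
have [d d0 hd] := h _ e2; have [d' d'0 hd'] := h' _ e2.
pose t := Num.min d d' / 2.
have m0 : 0 < Num.min d d' by rewrite lt_min d0.
have t0 : 0 < t by rewrite divr_gt0.
have : t < Num.min d d' by rewrite [ltRHS](splitr (Num.min _ _)) ltrDl.
rewrite lt_min => /andP[td td'].
have E : x + t - x = t by ring.
have := hd (x + t) Logic.I; have := hd' (x + t) Logic.I.
rewrite E gtr0_norm// => /(_ td') a1 /(_ td) a2.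
rewrite -(ler_pM2r t0) -[t in leLHS](gtr0_norm t0) -normrM.
have -> : (l - l') * t = (f (x + t) - f x - l' * t) - (f (x + t) - f x - l * t) by ring.
apply: le_trans (ler_normB _ _) _; apply: le_trans (lerD a1 a2) _.
by rewrite -mulrDl -splitr.
Qed.

Section extrema.
Variables (R : realType) (m : nat) (K : 'I_m -> set (R * R)) (L : 'I_m -> R).
Variables c T Q : 'I_m -> R -> R * R.
Hypothesis tb : table K L c T Q.
Notation n i u := (rot (T i u)).
Notation phase := ((R * R) * (R * R))%type.

(** Periodicity is given for [c]; it passes to [T] by [tangent_unique] and to [Q] by uniqueness of
    the derivative. *)
Lemma curvature_periodic i u (k : int) :
  det2 (T i (u + k%:~R * L i)) (Q i (u + k%:~R * L i)) = det2 (T i u) (Q i u).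
Proof.
have ob := tb_ob tb i; set s := k%:~R * L i.
have TT v : T i (v + s) = T i v.
  by apply: (tangent_unique ob); exact: c_periodic_int ob v k.
rewrite TT; congr det2.
have [h1 h2] := ob_d2 ob (u + s); have [g1 g2] := ob_d2 ob u.
rewrite [LHS]surjective_pairing [RHS]surjective_pairing; congr pair.
  apply: slope_limT_unique g1; have := slope_lim_shift h1.
  by apply: slope_lim_eq => // v _; rewrite TT.
apply: slope_limT_unique g2; have := slope_lim_shift h2.
by apply: slope_lim_eq => // v _; rewrite TT.
Qed.

Lemma curvature_lower : exists2 k, 0 < k & forall i u, k <= det2 (T i u) (Q i u).
Proof.
pose P i (k : R) := forall u, k <= det2 (T i u) (Q i u).
have [||k k0 hk] := @fin_uniform R _ P; last by exists k.
- move=> i; have ob := tb_ob tb i.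
  have [|k k0 hk] := compact_gt0 (@segment_compact _ 0 (L i))
    (continuous_subspaceT (ob_curv_cont ob)).
    by move=> u _; exact: ob_curv ob u.
  exists k => // u.
  have [v vL cv] := frontier_param ob (c_frontier ob u).
  have l0 := ac_length_gt0 (ob_arc ob).
  pose j := Num.floor (u / L i).
  have /andP[k1 k2] := floor_itv (u / L i); rewrite -/j in k1 k2.
  rewrite ler_pdivlMr// in k1; rewrite ltr_pdivrMr// in k2.
  rewrite -(curvature_periodic i u (- j)); apply: hk; rewrite /= in_itv/=.
  rewrite mulrNz mulNr subr_ge0 k1/= lerBlDr ltW//.
  by rewrite intrD mulrDl mul1r addrC in k2.
- by move=> i d d' _ dd' Pd u; exact: le_trans dd' (Pd u).
Qed.

Lemma separation : exists2 d, 0 < d & forall i j x y, i != j -> K i x -> K j y ->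
  d <= enorm (y - x).
Proof.
have [d d0 hd] := table_gap tb; exists d => // i j x y ij Kx Ky.
have ji : j != i by rewrite eq_sym.
have := hd i j i ij ji x y x 0 Kx Ky Kx.
by rewrite subrr scaler0 addr0 lexx ler01; apply.
Qed.

Lemma d_min_gt0 : (exists x, nonwandering K c x) -> 0 < d_min K c.
Proof.
move=> [x0 nx0]; have [d d0 hd] := separation.
apply: (lt_le_trans d0); apply: lb_le_inf.
  by exists (enorm ((billiard_map K c x0).1 - x0.1)); exists x0.
move=> _ [x nx ->].
have [w [w0 on _ nw]] := nonwandering_orbit tb nx.
have nxt : next_reflection K c x (w 1) by rewrite -w0; have := on 0; rewrite add0r.
rewrite (billiard_map_next tb (nw 1) nxt).
have [i Ki] := nonwandering_K tb nx; have [j Kj] := nonwandering_K tb (nw 1).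
exact: hd (next_other tb nxt Ki Kj) Ki Kj.
Qed.

Lemma d_min_le (x y : phase) : nonwandering K c x -> nonwandering K c y ->
  next_reflection K c x y -> d_min K c <= enorm (y.1 - x.1).
Proof.
move=> nx ny xy; apply: ge_inf.
  by exists 0 => _ [z _ ->]; exact: enorm_ge0.
by exists x => //; rewrite (billiard_map_next tb ny xy).
Qed.

Lemma kappa_min_gt0 : (exists x, nonwandering K c x) -> 0 < kappa_min K c.
Proof.
move=> [x0 nx0]; have [k k0 hk] := curvature_lower.
apply: (lt_le_trans k0); apply: lb_le_inf.
  have [[i [u [xc _]]] _ _] := nx0.
  by exists (curvature (c i) u); exists x0, i, u.
by move=> _ [x [i [u [_ _ ->]]]]; rewrite (ob_curvature (tb_ob tb i)).
Qed.

Lemma kappa_min_le (x : phase) i u : nonwandering K c x -> x.1 = c i u ->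
  kappa_min K c <= det2 (T i u) (Q i u).
Proof.
move=> nx xc; have [k k0 hk] := curvature_lower; apply: ge_inf.
  by exists k => _ [y [j [v [_ _ ->]]]]; rewrite (ob_curvature (tb_ob tb j)).
by exists x, i, u; split=> //; rewrite (ob_curvature (tb_ob tb i)).
Qed.

(** The turn at [x] is twice the normal component of the velocity times the unit normal, so
    [turn_gap] bounds that component. *)
Lemma angle_lower : exists2 s, 0 < s & forall (x : phase) i u,
  nonwandering K c x -> x.1 = c i u -> s <= dot x.2 (n i u).
Proof.
have [s s0 hs] := turn_gap tb; exists s => // x i u nx xc.
have [w [w0 on w1 nw]] := nonwandering_orbit tb nx.
have prv : next_reflection K c (w (-1)) x by rewrite -w0; have := on (-1); rewrite addNr.
have nxt : next_reflection K c x (w 1) by rewrite -w0; have := on 0; rewrite add0r.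
have [a Ka] := nonwandering_K tb (nw (-1)); have [b Kb] := nonwandering_K tb (nw 1).
have Ki : K i x.1 by rewrite xc; exact: c_K tb i u.
have := hs a i b (next_other tb prv Ka Ki) (next_other tb nxt Ki Kb) _ _ _ Ka Ki Kb.
have x1 : enorm x.2 = 1 by rewrite -w0; exact: w1.
have [<- _] := next_dir nxt x1; have [<- _] := next_dir prv (w1 (-1)).
have out := next_outward tb prv xc.
have [t [k [v [_ _ _ yc yv]]]] := prv.
have [ik nn] : i = k /\ n i u = n k v by apply: (same_point tb); rewrite -yc -xc.
rewrite (nE tb) -nn in yv.
have E : dot x.2 (n i u) = - dot (w (-1)).2 (n i u).
  by rewrite yv; exact: reflect_dot (n1 tb i u).
have -> : x.2 - (w (-1)).2 = (2 * dot x.2 (n i u)) *: n i u.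
  by rewrite E mulrN scaleNr {1}yv addrAC subrr sub0r.
rewrite enormZ (enorm_n (tb_ob tb i)) mulr1 normrM normr_nat ger0_norm//.
by rewrite ler_pM2l.
Qed.

Lemma angle_le1 (x : phase) i u : nonwandering K c x -> dot x.2 (n i u) <= 1.
Proof.
move=> [_ x1 _]; apply: le_trans (ler_norm _) _; apply: le_trans (dot_le _ _) _.
by rewrite x1 (enorm_n (tb_ob tb i)) mulr1.
Qed.

(** All angles lie in [0, acos s] with [s] from [angle_lower], so the supremum exists and lies there
    too. As [cos] decreases on [0, pi], it converts the supremum of the angles into a lower bound of
    the cosines. *)
Lemma cos_phi_max : (exists x, nonwandering K c x) ->
  0 < cos (phi_max K c) /\ forall (x : phase) i u, nonwandering K c x ->
    x.1 = c i u -> cos (phi_max K c) <= dot x.2 (n i u).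
Proof.
move=> [x0 nx0]; have [s s0 hs] := angle_lower.
set S := [set a | exists x i u, [/\ nonwandering K c x, x.1 = c i u
                               & a = acos (dot x.2 (normal (c i) u))]].
have s1 : s <= 1.
  have [[i [u [xc _]]] _ _] := nx0.
  exact: le_trans (hs _ _ _ nx0 xc) (angle_le1 i u nx0).
have rng (x : phase) i u : nonwandering K c x -> x.1 = c i u ->
    -1 <= dot x.2 (n i u) <= 1.
  move=> nx xc; rewrite angle_le1// andbT.
  by apply: le_trans (hs _ _ _ nx xc); apply: le_trans (ltW s0); rewrite oppr_le0.
have srng : -1 <= s <= 1.
  by rewrite s1 andbT; apply: le_trans (ltW s0); rewrite oppr_le0.
have ubS : ubound S (acos s).
  move=> _ [x [i [u [nx xc ->]]]]; rewrite (nE tb).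
  rewrite leNgt; apply/negP => lt.
  have := hs x i u nx xc; rewrite leNgt => /negP; apply.
  have A1 : acos s \in `[0, pi] by rewrite in_itv/= (acos_def srng).1.
  have A2 : acos (dot x.2 (n i u)) \in `[0, pi].
    by rewrite in_itv/= (acos_def (rng x i u nx xc)).1.
  by rewrite -[ltLHS](acos_def (rng x i u nx xc)).2 -[ltRHS](acos_def srng).2 ltr_cos.
have S0 : S !=set0.
  have [[i [u [xc _]]] _ _] := nx0.
  by exists (acos (dot x0.2 (normal (c i) u))), x0, i, u.
have hS : has_sup S by split=> //; exists (acos s).
have supub a : S a -> a <= sup S by move=> Sa; exact: sup_upper_bound.
have suple : sup S <= acos s by exact: ge_sup.
have sup0 : 0 <= sup S.
  have [a Sa] := S0; apply: le_trans (supub a Sa).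
  case: Sa => x [i [u [nx xc ->]]]; rewrite (nE tb) acos_ge0//.
  exact: rng.
have pis : acos s <= pi by exact: acos_lepi.
have cosmono x y : 0 <= x -> x <= y -> y <= pi -> cos y <= cos x.
  move=> x0' xy ypi; have xpi := le_trans xy ypi; have y0 := le_trans x0' xy.
  rewrite leNgt; apply/negP; rewrite ltr_cos ?in_itv/= ?x0' ?y0//.
  by rewrite ltNge xy.
split.
  apply: lt_le_trans s0 _; rewrite -[leLHS](acos_def srng).2; exact: cosmono.
move=> x i u nx xc; rewrite -[leRHS](acos_def (rng x i u nx xc)).2.
have Sx : S (acos (dot x.2 (n i u))) by exists x, i, u; rewrite (nE tb).
apply: cosmono; [|exact: supub|exact: le_trans suple pis].
by rewrite acos_ge0// rng.
Qed.

End extrema.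

(** * Dependence on the parameter *)

Definition window (R : realType) (I : set R) (a d : R) : set R :=
  [set x | I x /\ `|x - a| < d].

Lemma window_interval (R : realType) (I : set R) a d : is_interval I ->
  is_interval (window I a d).
Proof.
move=> iI x y [Ix xd] [Iy yd] z /andP[xz zy]; split.
  by apply: (iI x y) => //; rewrite xz zy.
by rewrite !ltr_norml in xd yd *; move/andP: xd => [? ?]; move/andP: yd => [? ?];
  apply/andP; split; lra.
Qed.

Lemma window_sub (R : realType) (I : set R) a d : window I a d `<=` I.
Proof. by move=> x []. Qed.

(** Without isolated points the filter of admissible increments is proper, so limits along it are
    unique and [derive_in] is determined. *)
Definition perfect_in (R : realType) (I : set R) : Prop :=
  forall x d, I x -> 0 < d -> exists2 y, I y & y != x /\ `|y - x| < d.

Lemma real_itv_interval (R : realType) (a b : \bar R) : is_interval (real_itv a b).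
Proof.
move=> x y [ax _] [_ yb] z /andP[xz zy]; split.
  by apply: le_trans ax _; rewrite lee_fin.
by apply: le_trans yb; rewrite lee_fin.
Qed.

Lemma real_itv_perfect (R : realType) (a b : \bar R) : (a < b)%E ->
  perfect_in (real_itv a b).
Proof.
move=> ab x d [ax xb] d0.
have d2 : 0 < d / 2 by rewrite divr_gt0.
have dd : d / 2 < d by rewrite [ltRHS](splitr d) ltrDl.
have up (t : R) : 0 < t -> (x%:E + t%:E <= b)%E -> t < d ->
    exists2 y, real_itv a b y & y != x /\ `|y - x| < d.
  move=> t0 tb td; exists (x + t).
    by split; [apply: le_trans ax _; rewrite lee_fin lerDl ltW|rewrite EFinD].
  by rewrite addrC addrK gtr0_norm//; split=> //; rewrite -subr_eq0 addrK gt_eqF.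
have dn (t : R) : 0 < t -> (a <= x%:E - t%:E)%E -> t < d ->
    exists2 y, real_itv a b y & y != x /\ `|y - x| < d.
  move=> t0 ta td; exists (x - t).
    by split; [rewrite EFinB|apply: le_trans xb; rewrite lee_fin gerBl ltW].
  rewrite addrAC subrr sub0r normrN gtr0_norm//; split=> //.
  by rewrite -subr_eq0 addrAC subrr sub0r oppr_eq0 gt_eqF.
case: b ab xb up dn => [b| |] ab xb up dn.
- rewrite lee_fin in xb; move: xb; rewrite le_eqVlt => /predU1P[xb|xb].
    subst b; case: a ab ax up dn => [a| |] ab ax up dn; last 2 first.
    + by move: ab; rewrite ltNge leey.
    + by apply: (dn (d / 2)) => //; rewrite leNye.
    rewrite lte_fin in ab.
    apply: (dn (Num.min (d / 2) (x - a))).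
    + by rewrite lt_min d2 subr_gt0.
    + rewrite -EFinB lee_fin lerBrDr addrC -lerBrDr.
      by rewrite ge_min lexx orbT.
    + by rewrite gt_min dd.
  apply: (up (Num.min (d / 2) (b - x))).
  + by rewrite lt_min d2 subr_gt0.
  + by rewrite -EFinD lee_fin addrC -lerBrDr ge_min lexx orbT.
  + by rewrite gt_min dd.
- by apply: (up (d / 2)) => //; rewrite leey.
- by move: xb.
Qed.

Section local_Ck.
Variables (R : realType) (I : set R).
Hypothesis pI : perfect_in I.
Notation inc x := (within [set h | I (h + x)] (0 : R)^').

Lemma perfect_proper x : I x -> ProperFilter (inc x).
Proof.
move=> Ix; apply: Build_ProperFilter_ex => P.
move=> /nbhs_ballP[d d0 hd]; have [y Iy [yx yd]] := pI Ix d0.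
exists (y - x); apply: hd; rewrite ?subr_eq0//=.
  by rewrite /ball/= sub0r normrN.
by rewrite subrK.
Qed.

Lemma diff_quot_cvg a d (f h : R -> R * R) x l : window I a d x ->
  (forall y, window I a d y -> h y = f y) -> vslope_lim (window I a d) f x l ->
  diff_quot_in I h x --> l.
Proof.
move=> [Ix xd] hf [s1 s2].
have key (g k : R -> R) m : (forall y, window I a d y -> k y = g y) ->
    slope_lim (window I a d) g x m ->
    (fun t => t^-1 * (k (t + x) - k x)) @ inc x --> m.
  move=> kg /slope_limP sg; apply/cvgrPdist_le => e e0.
  have [d1 d10 h1] := sg e e0.
  have r0 : 0 < d - `|x - a| by rewrite subr_gt0.
  apply/nbhs_ballP; exists (Num.min d1 (d - `|x - a|)); first by rewrite /= lt_min d10.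
  move=> t; rewrite /ball/= sub0r normrN lt_min => /andP[t1 t2] t0 It.
  have Wt : window I a d (t + x).
    split=> //; rewrite -addrA; apply: le_lt_trans (ler_normD _ _) _.
    by rewrite -ltrBrDr.
  have := h1 (t + x) Wt; rewrite addrK => /(_ t1).
  rewrite !kg//; move=> h2.
  rewrite -(ler_pM2r (_ : 0 < `|t|)) ?normr_gt0// -normrM.
  have -> : (m - t^-1 * (g (t + x) - g x)) * t = - (g (t + x) - g x - m * t).
    by field.
  by rewrite normrN.
apply: cvg_pairP.
  by apply: (key (fun y => (f y).1) (fun y => (h y).1) _ _ s1) => y /hf ->.
by apply: (key (fun y => (f y).2) (fun y => (h y).2) _ _ s2) => y /hf ->.
Qed.

Lemma derive_in_eq a d (f h : R -> R * R) x l : window I a d x ->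
  (forall y, window I a d y -> h y = f y) -> vslope_lim (window I a d) f x l ->
  derivable_in I h x /\ derive_in I h x = l.
Proof.
move=> Wx hf sl; have cv := diff_quot_cvg Wx hf sl.
have PF := perfect_proper Wx.1.
split; first by apply/cvg_ex; exists l.
apply: (@cvg_lim _ _ _ (diff_quot_in I h x)); last exact: cv.
exact: norm_hausdorff.
Qed.

Lemma UC_tower S k (f : unit -> R -> R) : UC S k f ->
  exists g : nat -> R -> R, [/\ forall x, g 0 x = f tt x,
    forall n, (n < k)%N -> is_der S (g n) (g n.+1)
  & forall n, (n <= k)%N -> cont_in S (g n)].
Proof.
elim: k f => [|k IH] f uf.
  exists (fun n => f tt); split=> // n _; exact: UC_cont uf.
have [_ [f' df uf']] := uf; have [g [g0 dg cg]] := IH f' uf'.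
exists (fun n => if n is n'.+1 then g n' else f tt); split=> //.
- move=> [_|n nk]; last exact: dg.
  by move=> x Sx; rewrite g0; exact: df.
- by move=> [_|n nk]; [exact: UC_cont uf|exact: cg].
Qed.

(** Near each [a] the iterated [derive_in] agree, by induction on the order, with a tower of
    explicit derivatives; this works because a window is relatively open in [I]. The tower may
    change with [a]. *)
Lemma local_Ck k (p : R -> R * R) :
  (forall a, I a -> exists2 d, 0 < d &
     UC (window I a d) k (fun _ : unit => fun x => (p x).1) /\
     UC (window I a d) k (fun _ : unit => fun x => (p x).2)) ->
  Ck_in I k p.
Proof.
move=> hp.
have key a : I a -> exists2 d, 0 < d & exists g : nat -> R -> R * R,
    [/\ forall n x, (n <= k)%N -> window I a d x -> derive_in_n I n p x = g n x,
      forall n, (n < k)%N -> derivable_in I (derive_in_n I n p) a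
    & forall n, (n <= k)%N -> cont_in (window I a d) (fun x => (g n x).1) /\
       cont_in (window I a d) (fun x => (g n x).2)].
  move=> Ia; have [d d0 [u1 u2]] := hp a Ia; exists d => //.
  have [g1 [g10 dg1 cg1]] := UC_tower u1; have [g2 [g20 dg2 cg2]] := UC_tower u2.
  pose g n x := (g1 n x, g2 n x).
  have Wa : window I a d a by split=> //; rewrite subrr normr0.
  have E n x : (n <= k)%N -> window I a d x -> derive_in_n I n p x = g n x.
    elim: n x => [|n IH] x nk Wx.
      by rewrite /= /g g10 g20 -surjective_pairing.
    have sl : vslope_lim (window I a d) (g n) x (g n.+1 x).
      by split; [exact: dg1|exact: dg2].
    have [_] := derive_in_eq Wx (fun y Wy => IH y (ltnW nk) Wy) sl.
    by move=> <-.
  exists g; split=> //.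
  - move=> n nk.
    have sl : vslope_lim (window I a d) (g n) a (g n.+1 a).
      by split; [exact: dg1|exact: dg2].
    by have [] := derive_in_eq Wa (fun y Wy => E n y (ltnW nk) Wy) sl.
  - by move=> n nk; split; [exact: cg1|exact: cg2].
split.
  by move=> n x nk /key[d d0 [g [_ dg _]]]; exact: dg.
move=> n nk; apply/subspace_continuousP => x Ix.
have [d d0 [g [E _ cg]]] := key x Ix; have [c1 c2] := cg n nk.
have Wx : window I x d x by split=> //; rewrite subrr normr0.
have conv (h k' : R -> R) : (forall y, window I x d y -> h y = k' y) ->
    cont_in (window I x d) k' -> h y @[y --> within I (nbhs x)] --> h x.
  move=> hk /(_ x Wx)/cvg_withinP ck; apply/cvg_withinP => e /ck[d1 d10 h1].
  exists (Num.min d d1); first by rewrite lt_min d0.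
  move=> y Iy; rewrite lt_min => /andP[y1 y2].
  have Wy : window I x d y by [].
  by rewrite !hk//; exact: h1.
apply: cvg_pairP.
  by apply: (conv (fun y => (derive_in_n I n p y).1) _ _ c1) => y Wy; rewrite E.
by apply: (conv (fun y => (derive_in_n I n p y).2) _ _ c2) => y Wy; rewrite E.
Qed.

End local_Ck.

(** * The reflection equation and its derivatives *)

Lemma cvg_dir (R : realType) (X : Type) (F : set_system X) {FF : Filter F}
    (f g : X -> R * R) (p q : R * R) : q != p -> f @ F --> p -> g @ F --> q ->
  dir (f t) (g t) @[t --> F] --> dir p q.
Proof.
move=> qp hf hg.
have h : (fun t => g t - f t) @ F --> q - p by exact: cvgB hg hf.
have n0 : enorm (q - p) != 0 by rewrite gt_eqF// enorm_gt0// subr_eq0.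
rewrite /dir; apply: cvgZ; last exact: h.
apply: cvgV; first exact: n0.
exact: (@cvg_enorm _ _ _ FF _ _ h).
Qed.

(** The derivative of V / |V|: only the component of [V'] across [V] turns the direction. The
    left-hand side is the form that the product, inverse and square root rules produce. *)
Lemma unit_derivative (R : realType) (V V' : R * R) (N : R) : 0 < N ->
  N ^+ 2 = dot V V ->
  (- ((dot V' V + dot V V') * (2 * N)^-1) * N^-1 * N^-1) *: V + N^-1 *: V' =
   - (det2 (N^-1 *: V) V' / N) *: rot (N^-1 *: V).
Proof.
case: V => a b; case: V' => a' b' N0 N2.
have key : N^-1 = (a * a + b * b) * N^-1 ^+ 3.
  by rewrite -/(dot (a, b) (a, b)) -N2; field; rewrite gt_eqF.
have e1 : N^-1 * a' = (a * a + b * b) * N^-1 ^+ 3 * a' by rewrite {1}key.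
have e2 : N^-1 * b' = (a * a + b * b) * N^-1 ^+ 3 * b' by rewrite {1}key.
rewrite det2Zl /det2 /rot /dot; congr pair.
  by rewrite /= /GRing.scale /= e1; field; rewrite gt_eqF.
by rewrite /= /GRing.scale /= e2; field; rewrite gt_eqF.
Qed.

Lemma vslope_lim_dir (R : realType) (S : set R) (f g : R -> R * R) x v w :
  g x != f x -> vslope_lim S f x v -> vslope_lim S g x w ->
  vslope_lim S (fun y => dir (f y) (g y)) x
    (- (det2 (dir (f x) (g x)) (w - v) / enorm (g x - f x)) *:
      rot (dir (f x) (g x))).
Proof.
move=> gf hf hg; have hV := vslope_limB hg hf.
have N0 : 0 < enorm (g x - f x) by rewrite enorm_gt0// subr_eq0.
have D0 : 0 < dot (g x - f x) (g x - f x) by rewrite -enorm_sqr exprn_gt0.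
have hN := slope_lim_sqrt (fun y _ => dot_ge0 (g y - f y)) D0
  (slope_lim_dot hV hV).
have hI := slope_limV (f := fun y => enorm (g y - f y)) (lt0r_neq0 N0) hN.
have := vslope_limZ hI hV; rewrite -/(enorm (g x - f x)).
by rewrite (unit_derivative _ N0 (enorm_sqr _)).
Qed.

(** The derivative of the length of the path [P1], [P2], [P3] when [P2] moves along [T2]. [gA], [gB]
    and [gC] are its partial derivatives in the three boundary parameters, [gD] that in the
    deformation parameter; [Q2] and [R2] are the derivatives of [T2] in its boundary parameter and
    in the deformation parameter, and the [A] are the parameter velocities of the points. *)
Definition gF (R : realType) (P1 P2 P3 T2 : R * R) : R :=
  dot T2 (dir P1 P2 - dir P2 P3).

Definition gA (R : realType) (P1 P2 T1 T2 : R * R) : R :=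
  - (det2 (dir P1 P2) T2 * det2 (dir P1 P2) T1 / enorm (P2 - P1)).

Definition gB (R : realType) (P1 P2 P3 T2 Q2 : R * R) : R :=
  dot Q2 (dir P1 P2 - dir P2 P3)
  + det2 (dir P1 P2) T2 * det2 (dir P1 P2) T2 / enorm (P2 - P1)
  + det2 (dir P2 P3) T2 * det2 (dir P2 P3) T2 / enorm (P3 - P2).

Definition gC (R : realType) (P2 P3 T2 T3 : R * R) : R :=
  - (det2 (dir P2 P3) T2 * det2 (dir P2 P3) T3 / enorm (P3 - P2)).

Definition gD (R : realType) (P1 P2 P3 T2 R2 A1 A2 A3 : R * R) : R :=
  dot R2 (dir P1 P2 - dir P2 P3)
  + det2 (dir P1 P2) T2 * det2 (dir P1 P2) (A2 - A1) / enorm (P2 - P1)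
  - det2 (dir P2 P3) T2 * det2 (dir P2 P3) (A3 - A2) / enorm (P3 - P2).

Lemma slope_lim_gF (R : realType) (S : set R) (p1 p2 p3 t2 : R -> R * R) x
    u1 u2 u3 b (T1 T3 Q2 R2 A1 A2 A3 : R * R) :
  p2 x != p1 x -> p3 x != p2 x ->
  vslope_lim S p1 x (u1 *: T1 + b *: A1) ->
  vslope_lim S p2 x (u2 *: t2 x + b *: A2) ->
  vslope_lim S p3 x (u3 *: T3 + b *: A3) ->
  vslope_lim S t2 x (u2 *: Q2 + b *: R2) ->
  slope_lim S (fun y => gF (p1 y) (p2 y) (p3 y) (t2 y)) x
    (gA (p1 x) (p2 x) T1 (t2 x) * u1 + gB (p1 x) (p2 x) (p3 x) (t2 x) Q2 * u2
     + gC (p2 x) (p3 x) (t2 x) T3 * u3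
     + gD (p1 x) (p2 x) (p3 x) (t2 x) R2 A1 A2 A3 * b).
Proof.
move=> h12 h23 d1 d2 d3 dt.
have := slope_lim_dot dt (vslope_limB (vslope_lim_dir h12 d1 d2)
  (vslope_lim_dir h23 d2 d3)).
congr slope_lim; rewrite /gA /gB /gC /gD.
move: (enorm (p2 x - p1 x)) (enorm (p3 x - p2 x)) => N1 N2.
move: (dir (p1 x) (p2 x)) (dir (p2 x) (p3 x)) (t2 x) => e f t.
rewrite /dot /det2 /rot /= /GRing.scale /=; ring.
Qed.

Definition UCv (R : realType) (J : Type) (S : set R) k (f : J -> R -> R * R) :=
  UC S k (fun j x => (f j x).1) /\ UC S k (fun j x => (f j x).2).

Section UCv.
Variables (R : realType) (J : Type) (S : set R) (k : nat).
Implicit Types f g : J -> R -> R * R.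

Lemma UCv_sub f g : UCv S k f -> UCv S k g -> UCv S k (fun j x => f j x - g j x).
Proof. by move=> [f1 f2] [g1 g2]; split; exact: UC_sub. Qed.

Lemma UC_dot f g : UCv S k f -> UCv S k g -> UC S k (fun j x => dot (f j x) (g j x)).
Proof. by move=> [f1 f2] [g1 g2]; apply: UC_add; exact: UC_mul. Qed.

Lemma UC_det2 f g : UCv S k f -> UCv S k g -> UC S k (fun j x => det2 (f j x) (g j x)).
Proof. by move=> [f1 f2] [g1 g2]; apply: UC_sub; exact: UC_mul. Qed.

Lemma UC_enormV f m : 0 < m -> (forall j x, S x -> m <= enorm (f j x)) ->
  UCv S k f -> UC S k (fun j x => (enorm (f j x))^-1).
Proof.
move=> m0 hm uf; apply: (@UC_inv _ _ _ _ _ m) => //.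
  by move=> j x Sx; rewrite ger0_norm ?enorm_ge0// hm.
apply: (@UC_sqrt _ _ _ _ _ (m ^+ 2)); first by rewrite exprn_gt0.
  by move=> j x Sx; rewrite -enorm_sqr ler_pXn2r ?nnegrE ?enorm_ge0 ?(ltW m0)// hm.
exact: UC_dot.
Qed.

Lemma UCv_dir f g m : 0 < m -> (forall j x, S x -> m <= enorm (g j x - f j x)) ->
  UCv S k f -> UCv S k g -> UCv S k (fun j x => dir (f j x) (g j x)).
Proof.
move=> m0 hm uf ug; have ud := UCv_sub ug uf.
have ui := UC_enormV m0 hm ud; have [u1 u2] := ud.
by split; exact: UC_mul.
Qed.

End UCv.

Lemma UCv_reindex (R : realType) (J J' : Type) (S : set R) k (s : J' -> J)
    (f : J -> R -> R * R) : UCv S k f -> UCv S k (fun j => f (s j)).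
Proof.
move=> [f1 f2]; split; first exact: (UC_reindex s f1).
exact: (UC_reindex s f2).
Qed.

(* Four real variables: three boundary parameters and the deformation parameter. *)
Definition cont_W (R : realType) (I : set R) (G : R * R * R * R -> R) : Prop :=
  forall w, I w.2 -> G z @[z --> within [set z | I z.2] (nbhs w)] --> G w.

(** The base points range over a compact box, which the perturbed points may leave. One [d] serves
    both as radius and as inverse of a bound, so that a single monotone constant enters
    [fin_uniform]. *)
Lemma uniform_near (R : realType) (I : set R) (a0 : R) (G : R * R * R * R -> R)
    (l1 l2 l3 e : R) : I a0 -> cont_W I G -> 0 < e ->
  exists2 d, 0 < d & forall v1 v2 v3 w1 w2 w3 b,
    0 <= v1 <= l1 -> 0 <= v2 <= l2 -> 0 <= v3 <= l3 -> I b ->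
    `|w1 - v1| < d -> `|w2 - v2| < d -> `|w3 - v3| < d -> `|b - a0| < d ->
    `|G (w1, w2, w3, b) - G (v1, v2, v3, a0)| <= e /\
    `|G (w1, w2, w3, b)| <= d^-1.
Proof.
move=> Ia cG e0.
pose X : set (R * R * R) := (`[(0 : R), l1]%classic : set R) `*`
  (`[(0 : R), l2]%classic : set R) `*` (`[(0 : R), l3]%classic : set R).
have cX : compact X.
  by do 2?apply: compact_setX; exact: segment_compact.
pose P (d : R) (v : R * R * R) := forall w1 w2 w3 b, I b ->
    `|w1 - v.1.1| < d -> `|w2 - v.1.2| < d -> `|w3 - v.2| < d -> `|b - a0| < d ->
    `|G (w1, w2, w3, b) - G (v, a0)| <= e.
have loc (v : R * R * R) (e' : R) : 0 < e' -> exists2 d, 0 < d &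
    forall w1 w2 w3 b, I b -> `|w1 - v.1.1| < d -> `|w2 - v.1.2| < d ->
    `|w3 - v.2| < d -> `|b - a0| < d -> `|G (w1, w2, w3, b) - G (v, a0)| <= e'.
  move=> e'0; have /cvgrPdist_le/(_ _ e'0) := cG (v, a0) Ia.
  move=> /nbhs_ballP[d d0 hd]; exists d => // w1 w2 w3 b Ib h1 h2 h3 h4.
  rewrite distrC; apply: hd => //=; rewrite distrC in h1.
  rewrite distrC in h2; rewrite distrC in h3; rewrite distrC in h4.
  by split=> //=; split=> //=; split.
have near : \forall d \near (0 : R)^'+, X `<=` P d.
  have /compact_near_coveringP := cX; apply => v _.
  have e2 : 0 < e / 2 by rewrite divr_gt0.
  have [d d0 hd] := loc v _ e2.
  have d2 : 0 < d / 2 by rewrite divr_gt0.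
  exists (ball v (d / 2), [set t | t < d / 2]).
    by split; [exact: nbhsx_ballx|exact: nbhs_right_lt].
  move=> [v' t] [/= [[b1 b2] b3] td] w1 w2 w3 b Ib h1 h2 h3 h4.
  have tri (x y z : R) : ball x (d / 2) y -> `|z - y| < t -> `|z - x| < d.
    rewrite /ball/= distrC => xy zy.
    have -> : z - x = (z - y) + (y - x) by ring.
    apply: le_lt_trans (ler_normD _ _) _; rewrite (splitr d) ltrD//.
    exact: lt_trans td.
  have near0 (x y : R) : ball x (d / 2) y -> `|y - x| < d.
    by rewrite /ball/= distrC => /lt_trans; apply; rewrite [ltRHS](splitr d) ltrDl.
  have -> : G (w1, w2, w3, b) - G (v', a0) = (G (w1, w2, w3, b) - G (v, a0)) -
    (G (v', a0) - G (v, a0)) by ring.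
  apply: le_trans (ler_normB _ _) _; rewrite (splitr e) lerD//.
    apply: hd => //; [exact: tri b1 h1|exact: tri b2 h2|exact: tri b3 h3|].
    by apply: lt_trans h4 (lt_trans td _); rewrite [ltRHS](splitr d) ltrDl.
  rewrite [v']surjective_pairing [v'.1]surjective_pairing.
  apply: hd => //; [exact: near0|exact: near0|exact: near0|].
  by rewrite subrr normr0.
have [B hB] : exists B, forall v, X v -> `|G (v, a0)| <= B.
  apply: compact_bounds => //; apply/subspace_continuousP => v _.
  apply/cvgrPdist_le => e' e'0; have [d d0 hd] := loc v _ e'0.
  apply/nbhs_ballP; exists d => // v' [[b1 b2] b3] _.
  rewrite distrC [v']surjective_pairing [v'.1]surjective_pairing.
  apply: hd => //; try by rewrite distrC.
  by rewrite subrr normr0.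
have Bp : 0 < `|B| + e + 1 by rewrite ltr_wpDl// addr_ge0// ltW.
have [d [d0 [hd dB]]] : exists d : R, 0 < d /\ X `<=` P d /\ d < (`|B| + e + 1)^-1.
  have near2 : \forall d \near (0 : R)^'+, d < (`|B| + e + 1)^-1.
    by apply: nbhs_right_lt; rewrite invr_gt0.
  have near3 : \forall d \near (0 : R)^'+, 0 < d by exact: nbhs_right_gt.
  by near (0 : R)^'+ => d; exists d; split; [|split]; near: d.
exists d => // v1 v2 v3 w1 w2 w3 b i1 i2 i3 Ib h1 h2 h3 h4.
have Xv : X (v1, v2, v3) by split; [split|]; rewrite /= in_itv.
have E := hd _ Xv w1 w2 w3 b Ib h1 h2 h3 h4; split=> //.
have -> : G (w1, w2, w3, b) = (G (w1, w2, w3, b) - G (v1, v2, v3, a0)) +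
  G (v1, v2, v3, a0) by ring.
apply: le_trans (ler_normD _ _) _; apply: le_trans (lerD E (hB _ Xv)) _.
apply: (@le_trans _ _ (`|B| + e + 1)).
  by have := ler_norm B; lra.
by rewrite -[leLHS]invrK lef_pV2 ?posrE ?invr_gt0// ltW.
Unshelve. all: by end_near. Qed.

Lemma eq_int_pred (j : int) : (j == j - 1) = false.
Proof. by apply/eqP; lia. Qed.

Lemma succ_eq_pred (j : int) : (j + 1 == j - 1) = false.
Proof. by apply/eqP; lia. Qed.

Lemma succ_eq_int (j : int) : (j + 1 == j) = false.
Proof. by apply/eqP; lia. Qed.

(** Of the gap [2 * kj] an amount [kl <= kj] is spent, one third on each quotient, and at least [kl]
    remains. *)
Lemma perturbed_dominance (R : realType) (xa xb xc ya yb yc kj kl B : R) :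
  ya + yc + 2 * kj = yb -> 0 <= ya -> 0 <= yc -> `|xb| <= B -> kl <= kj ->
  `|xb - yb| <= kl / 3 -> `|xc - yc| <= kl / 3 -> `|xa - ya| <= kl / 3 ->
  `|xa| + `|xc| + kl <= xb <= B.
Proof.
move=> E A1 C1 BB kj1; rewrite !ler_norml => /andP[k1 k2] /andP[k3 k4] /andP[k5 k6].
have na : `|xa| <= ya + kl / 3 by rewrite ler_norml; apply/andP; split; lra.
have nc : `|xc| <= yc + kl / 3 by rewrite ler_norml; apply/andP; split; lra.
by apply/andP; split; [lra|exact: le_trans (ler_norm xb) BB].
Qed.

(** * Solving the reflection equations near a given parameter *)

Section assembly.
Variables (R : realType) (m : nat) (I : set R) (r r' : nat) (a0 : R).
Variable H : 'I_m -> nat -> nat -> R -> R -> R * R.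
Hypothesis r2 : (2 <= r)%N.
Hypothesis r2' : (2 <= r')%N.
Hypothesis iI : is_interval I.
Hypothesis Ia : I a0.
Hypothesis sf1 : forall i, smooth_family I r r' (fun p q u b => (H i p q u b).1).
Hypothesis sf2 : forall i, smooth_family I r r' (fun p q u b => (H i p q u b).2).
Hypothesis disj : forall i k u v b, i != k -> I b -> H k 0 0 v b != H i 0 0 u b.
Notation W := (R * R * R * R)%type.

Let r1 : (1 <= r)%N. Proof. exact: ltnW. Qed.
Let r1' : (1 <= r')%N. Proof. exact: ltnW. Qed.
Let r0 : (0 < r)%N. Proof. exact: ltnW. Qed.
Let r0' : (0 < r')%N. Proof. exact: ltnW. Qed.

Lemma vslope_lim_H S i p q (u b : R -> R) x u' b' : (p < r)%N -> (q < r')%N ->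
  S x -> (forall y, S y -> I (b y)) -> slope_lim S u x u' -> slope_lim S b x b' ->
  vslope_lim S (fun y => H i p q (u y) (b y)) x
    (u' *: H i p.+1 q (u x) (b x) + b' *: H i p q.+1 (u x) (b x)).
Proof.
move=> pr qr Sx SI su sb; split.
  apply: slope_lim_val (slope_lim_comp2 (h := fun u b => (H i p q u b).1)
    (hu := fun u b => (H i p.+1 q u b).1) (hb := fun u b => (H i p q.+1 u b).1)
    iI Sx SI _ _ _ su sb) _.
  - by move=> c Ic; exact: (sf_u (sf1 i) pr (ltnW qr) Ic).
  - by move=> v; exact: (sf_a (v := v) iI (sf1 i) (ltnW pr) qr).
  - exact: (sf_cont (sf1 i) pr (ltnW qr)).
  - by rewrite /= /GRing.scale /=; ring.
apply: slope_lim_val (slope_lim_comp2 (h := fun u b => (H i p q u b).2)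
  (hu := fun u b => (H i p.+1 q u b).2) (hb := fun u b => (H i p q.+1 u b).2)
  iI Sx SI _ _ _ su sb) _.
- by move=> c Ic; exact: (sf_u (sf2 i) pr (ltnW qr) Ic).
- by move=> v; exact: (sf_a (v := v) iI (sf2 i) (ltnW pr) qr).
- exact: (sf_cont (sf2 i) pr (ltnW qr)).
- by rewrite /= /GRing.scale /=; ring.
Qed.

Lemma cvg_H i p q (pr : W -> R) w : (p <= r)%N -> (q <= r')%N -> I w.2 ->
  pr @ w --> pr w ->
  H i p q (pr z) z.2 @[z --> within [set z : W | I z.2] (nbhs w)]
    --> H i p q (pr w) w.2.
Proof.
move=> hp hq Iw cpr.
have key (h : R -> R -> R) : cont2_in I h ->
    h (pr z) z.2 @[z --> within [set z : W | I z.2] (nbhs w)] --> h (pr w) w.2.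
  move=> ch; apply/cvgrPdist_le => e e0; have [d d0 hd] := ch (pr w) _ Iw e e0.
  have n1 : \forall z \near w, `|pr w - pr z| < d.
    by move/cvgrPdist_lt : cpr; exact.
  have n2 : \forall z \near w, `|w.2 - z.2| < d.
    have : (fun z : W => z.2) @ w --> w.2 by exact: cvg_snd.
    by move/cvgrPdist_lt; exact.
  have : \forall z \near w, I z.2 -> `|h (pr w) w.2 - h (pr z) z.2| <= e.
    apply: filterS2 n1 n2 => z z1 z2 Iz; rewrite distrC.
    by apply: hd => //; rewrite distrC.
  by [].
apply: cvg_pairP.
  by apply: (key (fun u b => (H i p q u b).1)); exact: (sf_cont (sf1 i)).
by apply: (key (fun u b => (H i p q u b).2)); exact: (sf_cont (sf2 i)).
Qed.

Lemma cvg_pr1 (w : W) : (fun z : W => z.1.1.1) @ w --> w.1.1.1.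
Proof.
have h1 : (fun z : W => z.1) @ w --> w.1 by exact: cvg_fst.
exact: (cvg_fst_comp (cvg_fst_comp h1)).
Qed.

Lemma cvg_pr2 (w : W) : (fun z : W => z.1.1.2) @ w --> w.1.1.2.
Proof.
have h1 : (fun z : W => z.1) @ w --> w.1 by exact: cvg_fst.
exact: (cvg_snd_comp (cvg_fst_comp h1)).
Qed.

Lemma cvg_pr3 (w : W) : (fun z : W => z.1.2) @ w --> w.1.2.
Proof.
have h1 : (fun z : W => z.1) @ w --> w.1 by exact: cvg_fst.
exact: (cvg_snd_comp h1).
Qed.

(** Values at the previous, current and next boundary parameter. The coefficient functions built
    from them all take three obstacle indices, so that [at3] and [unif_triples] handle them
    alike. *)
Definition H1 i p q (w : W) := H i p q w.1.1.1 w.2.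
Definition H2 i p q (w : W) := H i p q w.1.1.2 w.2.
Definition H3 i p q (w : W) := H i p q w.1.2 w.2.

Definition Em i1 i2 (w : W) := dir (H1 i1 0 0 w) (H2 i2 0 0 w).
Definition Ep i2 i3 (w : W) := dir (H2 i2 0 0 w) (H3 i3 0 0 w).
Definition WF i1 i2 i3 w :=
  gF (H1 i1 0 0 w) (H2 i2 0 0 w) (H3 i3 0 0 w) (H2 i2 1 0 w).
Definition WA i1 i2 (i3 : 'I_m) w :=
  gA (H1 i1 0 0 w) (H2 i2 0 0 w) (H1 i1 1 0 w) (H2 i2 1 0 w).
Definition WB i1 i2 i3 w :=
  gB (H1 i1 0 0 w) (H2 i2 0 0 w) (H3 i3 0 0 w) (H2 i2 1 0 w) (H2 i2 2 0 w).
Definition WC (i1 : 'I_m) i2 i3 w :=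
  gC (H2 i2 0 0 w) (H3 i3 0 0 w) (H2 i2 1 0 w) (H3 i3 1 0 w).
Definition WD i1 i2 i3 w :=
  gD (H1 i1 0 0 w) (H2 i2 0 0 w) (H3 i3 0 0 w) (H2 i2 1 0 w) (H2 i2 1 1 w)
    (H1 i1 0 1 w) (H2 i2 0 1 w) (H3 i3 0 1 w).
(** [Wtau] and [Wsig] are the outward normal components of the incoming and outgoing directions.
    Their opposite signs separate reflections from straight passages, which solve [WF = 0] as
    well. *)
Definition Wtau i1 i2 (i3 : 'I_m) w := det2 (Em i1 i2 w) (H2 i2 1 0 w).
Definition Wsig (i1 : 'I_m) i2 i3 w := det2 (Ep i2 i3 w) (H2 i2 1 0 w).
Definition Wdist i1 i2 (i3 : 'I_m) w := enorm (H2 i2 0 0 w - H1 i1 0 0 w).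

Section cont.
Variables (i1 i2 i3 : 'I_m) (w : W).
Hypothesis i12 : i1 != i2.
Hypothesis i23 : i2 != i3.
Hypothesis Iw : I w.2.
Notation Fw := (within [set z : W | I z.2] (nbhs w)).

Let c1 p q : (p <= r)%N -> (q <= r')%N -> H1 i1 p q z @[z --> Fw] --> H1 i1 p q w.
Proof. by move=> ? ?; apply: cvg_H => //; exact: cvg_pr1. Qed.
Let c2 p q : (p <= r)%N -> (q <= r')%N -> H2 i2 p q z @[z --> Fw] --> H2 i2 p q w.
Proof. by move=> ? ?; apply: cvg_H => //; exact: cvg_pr2. Qed.
Let c3 p q : (p <= r)%N -> (q <= r')%N -> H3 i3 p q z @[z --> Fw] --> H3 i3 p q w.
Proof. by move=> ? ?; apply: cvg_H => //; exact: cvg_pr3. Qed.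
Let ne12 : H2 i2 0 0 w != H1 i1 0 0 w. Proof. exact: disj. Qed.
Let ne23 : H3 i3 0 0 w != H2 i2 0 0 w. Proof. exact: disj. Qed.
Let p1 : H1 i1 0 0 z @[z --> Fw] --> H1 i1 0 0 w. Proof. exact: c1. Qed.
Let p2 : H2 i2 0 0 z @[z --> Fw] --> H2 i2 0 0 w. Proof. exact: c2. Qed.
Let p3 : H3 i3 0 0 z @[z --> Fw] --> H3 i3 0 0 w. Proof. exact: c3. Qed.
Let t1 : H1 i1 1 0 z @[z --> Fw] --> H1 i1 1 0 w. Proof. exact: c1. Qed.
Let t2 : H2 i2 1 0 z @[z --> Fw] --> H2 i2 1 0 w. Proof. exact: c2. Qed.
Let t3 : H3 i3 1 0 z @[z --> Fw] --> H3 i3 1 0 w. Proof. exact: c3. Qed.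
Let q2 : H2 i2 2 0 z @[z --> Fw] --> H2 i2 2 0 w. Proof. exact: c2. Qed.
Let s2 : H2 i2 1 1 z @[z --> Fw] --> H2 i2 1 1 w. Proof. exact: c2. Qed.
Let b1 : H1 i1 0 1 z @[z --> Fw] --> H1 i1 0 1 w. Proof. exact: c1. Qed.
Let b2 : H2 i2 0 1 z @[z --> Fw] --> H2 i2 0 1 w. Proof. exact: c2. Qed.
Let b3 : H3 i3 0 1 z @[z --> Fw] --> H3 i3 0 1 w. Proof. exact: c3. Qed.
Let em : Em i1 i2 z @[z --> Fw] --> Em i1 i2 w.
Proof. exact: (cvg_dir ne12 p1 p2). Qed.
Let ep : Ep i2 i3 z @[z --> Fw] --> Ep i2 i3 w.
Proof. exact: (cvg_dir ne23 p2 p3). Qed.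
Let nm : (enorm (H2 i2 0 0 z - H1 i1 0 0 z))^-1 @[z --> Fw]
  --> (enorm (H2 i2 0 0 w - H1 i1 0 0 w))^-1.
Proof.
apply: cvgV; first by rewrite gt_eqF// enorm_gt0// subr_eq0.
exact: (cvg_enorm (cvgB p2 p1)).
Qed.
Let np : (enorm (H3 i3 0 0 z - H2 i2 0 0 z))^-1 @[z --> Fw]
  --> (enorm (H3 i3 0 0 w - H2 i2 0 0 w))^-1.
Proof.
apply: cvgV; first by rewrite gt_eqF// enorm_gt0// subr_eq0.
exact: (cvg_enorm (cvgB p3 p2)).
Qed.

Lemma cvg_WA : WA i1 i2 i3 z @[z --> Fw] --> WA i1 i2 i3 w.
Proof. exact: (cvgN (cvgM (cvgM (cvg_det2 em t2) (cvg_det2 em t1)) nm)). Qed.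
Lemma cvg_WB : WB i1 i2 i3 z @[z --> Fw] --> WB i1 i2 i3 w.
Proof.
exact: (cvgD (cvgD (cvg_dot q2 (cvgB em ep))
  (cvgM (cvgM (cvg_det2 em t2) (cvg_det2 em t2)) nm))
  (cvgM (cvgM (cvg_det2 ep t2) (cvg_det2 ep t2)) np)).
Qed.
Lemma cvg_WC : WC i1 i2 i3 z @[z --> Fw] --> WC i1 i2 i3 w.
Proof. exact: (cvgN (cvgM (cvgM (cvg_det2 ep t2) (cvg_det2 ep t3)) np)). Qed.
Lemma cvg_WD : WD i1 i2 i3 z @[z --> Fw] --> WD i1 i2 i3 w.
Proof.
exact: (cvgB (cvgD (cvg_dot s2 (cvgB em ep))
  (cvgM (cvgM (cvg_det2 em t2) (cvg_det2 em (cvgB b2 b1))) nm))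
  (cvgM (cvgM (cvg_det2 ep t2) (cvg_det2 ep (cvgB b3 b2))) np)).
Qed.
Lemma cvg_Wtau : Wtau i1 i2 i3 z @[z --> Fw] --> Wtau i1 i2 i3 w.
Proof. exact: (cvg_det2 em t2). Qed.
Lemma cvg_Wsig : Wsig i1 i2 i3 z @[z --> Fw] --> Wsig i1 i2 i3 w.
Proof. exact: (cvg_det2 ep t2). Qed.
Lemma cvg_Wdist : Wdist i1 i2 i3 z @[z --> Fw] --> Wdist i1 i2 i3 w.
Proof. exact: (cvg_enorm (cvgB p2 p1)). Qed.

End cont.

(** The four variables move along one segment, so the mean value theorem in one variable yields a
    common [t], as [cs_mv] demands. *)
Lemma WF_mv i1 i2 i3 v1 v2 v3 w1 w2 w3 al be : i1 != i2 -> i2 != i3 ->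
  I al -> I be ->
  exists t, 0 <= t <= 1 /\
    let z := (v1 + t * (w1 - v1), v2 + t * (w2 - v2), v3 + t * (w3 - v3),
              al + t * (be - al)) in
    WF i1 i2 i3 (w1, w2, w3, be) - WF i1 i2 i3 (v1, v2, v3, al) =
      WA i1 i2 i3 z * (w1 - v1) + WB i1 i2 i3 z * (w2 - v2) +
      WC i1 i2 i3 z * (w3 - v3) + WD i1 i2 i3 z * (be - al).
Proof.
move=> i12 i23 Ial Ibe.
pose S : set R := [set t | 0 <= t <= 1].
have iS : is_interval S.
  move=> x y /andP[x0 x1] /andP[y0 y1] z /andP[xz zy]; apply/andP; split.
    exact: le_trans xz.
  exact: le_trans y1.
pose z t : W := (v1 + t * (w1 - v1), v2 + t * (w2 - v2), v3 + t * (w3 - v3),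
              al + t * (be - al)).
have SI t : S t -> I (al + t * (be - al)) by move=> St; exact: between_S.
have aff v w t : slope_lim S (fun t => v + t * (w - v)) t (w - v).
  apply: slope_lim_val (slope_limD (slope_lim_cst _ v _)
    (slope_limM (slope_lim_id _ _) (slope_lim_cst _ (w - v) _))) _.
  by ring.
have der : is_der S (fun t => WF i1 i2 i3 (z t)) (fun t =>
      WA i1 i2 i3 (z t) * (w1 - v1) + WB i1 i2 i3 (z t) * (w2 - v2) +
      WC i1 i2 i3 (z t) * (w3 - v3) + WD i1 i2 i3 (z t) * (be - al)).
  move=> t St; have It := SI t St.
  apply: slope_lim_gF.
  - exact: disj.
  - exact: disj.
  - exact: (vslope_lim_H i1 r0 r0' St SI (aff v1 w1 t) (aff al be t)).
  - exact: (vslope_lim_H i2 r0 r0' St SI (aff v2 w2 t) (aff al be t)).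
  - exact: (vslope_lim_H i3 r0 r0' St SI (aff v3 w3 t) (aff al be t)).
  - exact: (vslope_lim_H i2 r2 r0' St SI (aff v2 w2 t) (aff al be t)).
have S0 : S 0 by rewrite /S /= lexx ler01.
have S1 : S 1 by rewrite /S /= ler01 lexx.
have [t [St _ _ E]] := MVT_in iS der S0 S1.
exists t; split=> //; move: E; rewrite /z !mul0r !addr0 !mul1r subr0 mulr1.
have A (x y : R) : x + (y - x) = y by ring.
by rewrite !A.
Qed.

Variable l : 'I_m -> R.

Lemma unif_triples (G : 'I_m -> 'I_m -> 'I_m -> W -> R) e :
  (forall i1 i2 i3, i1 != i2 -> i2 != i3 -> cont_W I (G i1 i2 i3)) -> 0 < e ->
  exists2 d, 0 < d & forall i1 i2 i3, i1 != i2 -> i2 != i3 ->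
    forall v1 v2 v3 w1 w2 w3 b,
    0 <= v1 <= l i1 -> 0 <= v2 <= l i2 -> 0 <= v3 <= l i3 -> I b ->
    `|w1 - v1| < d -> `|w2 - v2| < d -> `|w3 - v3| < d -> `|b - a0| < d ->
    `|G i1 i2 i3 (w1, w2, w3, b) - G i1 i2 i3 (v1, v2, v3, a0)| <= e /\
    `|G i1 i2 i3 (w1, w2, w3, b)| <= d^-1.
Proof.
move=> cG e0.
pose P (i : 'I_m * 'I_m * 'I_m) (d : R) := i.1.1 != i.1.2 -> i.1.2 != i.2 ->
    forall v1 v2 v3 w1 w2 w3 b,
    0 <= v1 <= l i.1.1 -> 0 <= v2 <= l i.1.2 -> 0 <= v3 <= l i.2 -> I b ->
    `|w1 - v1| < d -> `|w2 - v2| < d -> `|w3 - v3| < d -> `|b - a0| < d ->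
    `|G i.1.1 i.1.2 i.2 (w1, w2, w3, b) - G i.1.1 i.1.2 i.2 (v1, v2, v3, a0)| <= e /\
    `|G i.1.1 i.1.2 i.2 (w1, w2, w3, b)| <= d^-1.
have [||d d0 hd] := @fin_uniform R _ P.
- move=> [[i1 i2] i3]; rewrite /P /=.
  have [i12|] := boolP (i1 != i2); last by exists 1.
  have [i23|] := boolP (i2 != i3); last by exists 1.
  have [d d0 hd] := uniform_near (l i1) (l i2) (l i3) Ia (cG _ _ _ i12 i23) e0.
  by exists d.
- move=> i d d' d'0 dd' Pd h1 h2 v1 v2 v3 w1 w2 w3 b k1 k2 k3 Ib e1 e2 e3 e4.
  have [||||q1 q2] := Pd h1 h2 v1 v2 v3 w1 w2 w3 b k1 k2 k3 Ib.
  + exact: lt_le_trans dd'. + exact: lt_le_trans dd'.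
  + exact: lt_le_trans dd'. + exact: lt_le_trans dd'.
  + split=> //; apply: le_trans q2 _.
    by rewrite lef_pV2 ?posrE// (lt_le_trans d'0).
by exists d => // i1 i2 i3; exact: (hd ((i1, i2), i3)).
Qed.

(** Coefficients in rescaled unknowns: a boundary parameter is [v + x / s], and the division by [c]
    is the chain rule factor of the column. *)
Lemma cont4_scaled (S : set R) (G : W -> R) q c sl s1 s2 s3 v1 v2 v3 :
  S `<=` I -> cont_W I G -> 0 < sl -> sl <= s1 -> sl <= s2 -> sl <= s3 ->
  cont4_in q S (fun x1 x2 x3 b =>
    G (v1 + x1 / s1, v2 + x2 / s2, v3 + x3 / s3, b) / c).
Proof.
move=> SI cG sl0 h1 h2 h3 x1 x2 x3 al _ _ _ Sal e e0.
have e1 : 0 < e / (`|c^-1| + 1) by rewrite divr_gt0// ltr_wpDl.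
set w : W := (v1 + x1 / s1, v2 + x2 / s2, v3 + x3 / s3, al).
have /cvgrPdist_le/(_ _ e1) := cG w (SI _ Sal).
move=> /nbhs_ballP[d d0 hd].
pose d' := Num.min d (d * sl).
exists d'; first by rewrite lt_min d0 mulr_gt0.
move=> y1 y2 y3 be _ _ _ Sbe; rewrite !lt_min.
move=> /andP[_ y1d] /andP[_ y2d] /andP[_ y3d] /andP[bd _].
have sc (s x y v : R) : sl <= s -> `|y - x| < d * sl ->
    `|(v + x / s) - (v + y / s)| < d.
  move=> ls xy; have s0 : 0 < s by exact: lt_le_trans ls.
  have -> : (v + x / s) - (v + y / s) = - ((y - x) / s) by ring.
  rewrite normrN normrM normfV (gtr0_norm s0) ltr_pdivrMr//.
  by apply: lt_le_trans xy _; rewrite ler_pM2l.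
rewrite -mulrBl normrM.
have : `|G w - G (v1 + y1 / s1, v2 + y2 / s2, v3 + y3 / s3, be)| <= e / (`|c^-1| + 1).
  apply: hd; last exact: SI.
  split; last by rewrite /ball/= distrC.
  split; last exact: (sc s3 x3 y3 v3 h3 y3d).
  by split; [exact: (sc s1 x1 y1 v1 h1 y1d)|exact: (sc s2 x2 y2 v2 h2 y2d)].
rewrite distrC => h; have c0 := normr_ge0 c^-1.
apply: (@le_trans _ _ (e / (`|c^-1| + 1) * `|c^-1|)); first by rewrite ler_wpM2r.
rewrite mulrAC ler_pdivrMr ?ltr_wpDl// ler_pM2l// lerDl//.
Qed.

Variable xi : int -> 'I_m.
Hypothesis hxi : Sigma xi.
Variables (u0 s kap : int -> R) (sl kl dl : R).
Hypothesis sl0 : 0 < sl.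
Hypothesis kl0 : 0 < kl.
Hypothesis dl0 : 0 < dl.
Hypothesis u0l : forall j, 0 <= u0 j <= l (xi j).

Definition at3 (G : 'I_m -> 'I_m -> 'I_m -> W -> R) (u : int -> R) (b : R) (j : int) :=
  G (xi (j - 1)) (xi j) (xi (j + 1)) (u (j - 1), u j, u (j + 1), b).

Hypothesis s01 : forall j, sl <= s j <= 1.
Hypothesis base_sig : forall j, at3 Wsig u0 a0 j = s j.
Hypothesis base_tau : forall j, at3 Wtau u0 a0 j = - s j.
Hypothesis base_curv : forall j, dot (H (xi j) 2 0 (u0 j) a0)
  (dir (H (xi (j - 1)) 0 0 (u0 (j - 1)) a0) (H (xi j) 0 0 (u0 j) a0) -
   dir (H (xi j) 0 0 (u0 j) a0) (H (xi (j + 1)) 0 0 (u0 (j + 1)) a0))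
  = 2 * kap j * s j.
Hypothesis kapl : forall j, kl <= kap j.
Hypothesis base_F : forall j, at3 WF u0 a0 j = 0.
Hypothesis base_dist : forall j, dl <= at3 Wdist u0 a0 j.

Let ne1 j : xi (j - 1) != xi j.
Proof. by have := hxi (j - 1); rewrite subrK. Qed.
Let ne2 j : xi j != xi (j + 1). Proof. exact: hxi. Qed.
Let s_gt0 j : 0 < s j.
Proof. by have /andP[h _] := s01 j; exact: lt_le_trans h. Qed.

(** With flight lengths [N], the off-diagonal entries are s_j s_(j-1) / N_j and s_j s_(j+1) /
    N_(j+1), and the diagonal one is 2 kap_j s_j + s_j^2 / N_j + s_j^2 / N_(j+1). Dividing each
    column by its own [s] makes the flight terms cancel exactly. *)
Lemma base_dom j : [/\ 0 <= at3 WA u0 a0 j, 0 <= at3 WC u0 a0 j &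
  at3 WA u0 a0 j / s (j - 1) + at3 WC u0 a0 j / s (j + 1) + 2 * kap j =
  at3 WB u0 a0 j / s j].
Proof.
pose N i := at3 Wdist u0 a0 i.
have N0 i : 0 < N i by apply: lt_le_trans (base_dist i).
have A : at3 WA u0 a0 j = s j * s (j - 1) / N j.
  have := base_sig (j - 1); have := base_tau j.
  rewrite /at3 /Wsig /Wtau /Ep /WA /gA /H1 /H2 /H3 /= subrK /Em /H1 /H2 /=.
  by move=> -> ->; rewrite !mulNr opprK.
have C : at3 WC u0 a0 j = s j * s (j + 1) / N (j + 1).
  have := base_sig j; have := base_tau (j + 1).
  rewrite /N /at3 /Wsig /Wtau /Wdist /Em /WC /gC /H1 /H2 /H3 /= addrK /Ep /H2 /H3 /=.
  by move=> -> ->; rewrite mulrN mulNr opprK.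
have B : at3 WB u0 a0 j = 2 * kap j * s j + s j * s j / N j + s j * s j / N (j + 1).
  have := base_sig j; have := base_tau j; have := base_curv j.
  rewrite /N /at3 /Wsig /Wtau /Wdist /WB /gB /Em /Ep /H1 /H2 /H3 /= addrK.
  by move=> -> -> ->; rewrite mulrNN.
have sj := s_gt0 j; have sm := s_gt0 (j - 1); have sp := s_gt0 (j + 1).
split.
- by rewrite A divr_ge0 ?mulr_ge0 ?(ltW (N0 _))// ltW.
- by rewrite C divr_ge0 ?mulr_ge0 ?(ltW (N0 _))// ltW.
rewrite A B C; have := N0 j; have := N0 (j + 1).
move: (N j) (N (j + 1)) => x y y0 x0.
by field; rewrite !gt_eqF.
Qed.

Section coef_UC.
Variables (S : set R) (u : int -> R -> R) (n : nat) (d : R).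
Hypothesis SI : S `<=` I.
Hypothesis bH1 : forall p q, (p <= r)%N -> (q <= r')%N ->
  ubounded S (fun j y => (H (xi j) p q (u j y) y).1).
Hypothesis bH2 : forall p q, (p <= r)%N -> (q <= r')%N ->
  ubounded S (fun j y => (H (xi j) p q (u j y) y).2).
Hypothesis d0 : 0 < d.
Hypothesis hd : forall j y, S y -> d <= at3 Wdist (u ^~ y) y j.
Hypothesis uu : UC S n u.

Lemma UCv_H p q : (p + n <= r)%N -> (q + n <= r')%N ->
  UCv S n (fun j y => H (xi j) p q (u j y) y).
Proof.
move=> pr qr; split.
  exact: (UC_comp (H := fun j p q u b => (H (xi j) p q u b).1) iI SI
    (fun j => sf1 (xi j)) bH1 pr qr uu).
exact: (UC_comp (H := fun j p q u b => (H (xi j) p q u b).2) iI SI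
  (fun j => sf2 (xi j)) bH2 pr qr uu).
Qed.

Hypothesis nr : (n.+2 <= r)%N.
Hypothesis nr' : (n.+2 <= r')%N.

(** Orders 2 and 1 are the largest that occur in the coefficients, in [WB] and [WD] respectively. *)
Let uH p q : (p <= 2)%N -> (q <= 1)%N -> UCv S n (fun j y => H (xi j) p q (u j y) y).
Proof.
move=> p2 q1; apply: UCv_H.
  by apply: leq_trans nr; rewrite -addn2 addnC leq_add2l.
by apply: leq_trans nr'; rewrite -addn2 addnC leq_add2l (leq_trans q1).
Qed.

Let uM p q : (p <= 2)%N -> (q <= 1)%N ->
  UCv S n (fun j y => H (xi (j - 1)) p q (u (j - 1) y) y).
Proof.
by move=> p2 q1; exact: (UCv_reindex (fun j => j - 1) (uH p2 q1)).
Qed.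

Let uP p q : (p <= 2)%N -> (q <= 1)%N ->
  UCv S n (fun j y => H (xi (j + 1)) p q (u (j + 1) y) y).
Proof.
by move=> p2 q1; exact: (UCv_reindex (fun j => j + 1) (uH p2 q1)).
Qed.

Let dm j y : S y ->
  d <= enorm (H (xi j) 0 0 (u j y) y - H (xi (j - 1)) 0 0 (u (j - 1) y) y).
Proof. exact: hd. Qed.

Let dp j y : S y ->
  d <= enorm (H (xi (j + 1)) 0 0 (u (j + 1) y) y - H (xi j) 0 0 (u j y) y).
Proof.
by move=> Sy; have := hd (j + 1) Sy; rewrite /at3 /Wdist /H1 /H2 /= addrK.
Qed.

Let em : UCv S n (fun j y =>
  dir (H (xi (j - 1)) 0 0 (u (j - 1) y) y) (H (xi j) 0 0 (u j y) y)).
Proof. exact: (UCv_dir d0 dm (uM _ _) (uH _ _)). Qed.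

Let ep : UCv S n (fun j y =>
  dir (H (xi j) 0 0 (u j y) y) (H (xi (j + 1)) 0 0 (u (j + 1) y) y)).
Proof. exact: (UCv_dir d0 dp (uH _ _) (uP _ _)). Qed.

Let nm := UC_enormV d0 dm (UCv_sub (@uH 0 0 isT isT) (@uM 0 0 isT isT)).
Let np := UC_enormV d0 dp (UCv_sub (@uP 0 0 isT isT) (@uH 0 0 isT isT)).
Let tm := UC_det2 em (@uH 1 0 isT isT).
Let tp := UC_det2 ep (@uH 1 0 isT isT).

Lemma UC_WA : UC S n (fun j y => at3 WA (u ^~ y) y j).
Proof. exact: (UC_opp (UC_mul (UC_mul tm (UC_det2 em (@uM 1 0 isT isT))) nm)). Qed.

Lemma UC_WC : UC S n (fun j y => at3 WC (u ^~ y) y j).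
Proof. exact: (UC_opp (UC_mul (UC_mul tp (UC_det2 ep (@uP 1 0 isT isT))) np)). Qed.

Lemma UC_WB : UC S n (fun j y => at3 WB (u ^~ y) y j).
Proof.
exact: (UC_add (UC_add (UC_dot (@uH 2 0 isT isT) (UCv_sub em ep))
  (UC_mul (UC_mul tm tm) nm)) (UC_mul (UC_mul tp tp) np)).
Qed.

Lemma UC_WD : UC S n (fun j y => at3 WD (u ^~ y) y j).
Proof.
have bm := UCv_sub (@uH 0 1 isT isT) (@uM 0 1 isT isT).
have bp := UCv_sub (@uP 0 1 isT isT) (@uH 0 1 isT isT).
exact: (UC_sub (UC_add (UC_dot (@uH 1 1 isT isT) (UCv_sub em ep))
  (UC_mul (UC_mul tm (UC_det2 em bm)) nm)) (UC_mul (UC_mul tp (UC_det2 ep bp)) np)).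
Qed.

End coef_UC.

Lemma unif_near G e :
  (forall i1 i2 i3, i1 != i2 -> i2 != i3 -> cont_W I (G i1 i2 i3)) -> 0 < e ->
  exists2 d, 0 < d & forall (w : int -> R) b j, I b -> `|b - a0| < d ->
    (forall i, `|w i - u0 i| < d) ->
    `|at3 G w b j - at3 G u0 a0 j| <= e /\ `|at3 G w b j| <= d^-1.
Proof.
move=> cG e0; have [d d0 hd] := unif_triples cG e0; exists d => // w b j Ib bd hw.
by apply: hd.
Qed.

Lemma unif_bounds : exists2 d, 0 < d & forall p q (w : int -> R) b j,
  (p <= r)%N -> (q <= r')%N -> I b -> `|b - a0| < d ->
  (forall i, `|w i - u0 i| < d) ->
  `|(H (xi j) p q (w j) b).1| <= d^-1 /\ `|(H (xi j) p q (w j) b).2| <= d^-1.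
Proof.
pose P (pq : 'I_r.+1 * 'I_r'.+1) d := forall (w : int -> R) b j,
  I b -> `|b - a0| < d -> (forall i, `|w i - u0 i| < d) ->
  `|(H (xi j) pq.1 pq.2 (w j) b).1| <= d^-1 /\
  `|(H (xi j) pq.1 pq.2 (w j) b).2| <= d^-1.
have [||d d0 hd] := @fin_uniform R _ P.
- move=> [p q]; rewrite /P /=.
  have hp : (p <= r)%N by rewrite -ltnS.
  have hq : (q <= r')%N by rewrite -ltnS.
  have [|d1 d10 h1] := @unif_near (fun _ i _ w => (H2 i p q w).1) 1 _ ltr01.
    move=> i1 i2 i3 _ _ w Iw; apply: cvg_fst_comp.
    by apply: cvg_H => //; exact: cvg_pr2.
  have [|d2 d20 h2] := @unif_near (fun _ i _ w => (H2 i p q w).2) 1 _ ltr01.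
    move=> i1 i2 i3 _ _ w Iw; apply: cvg_snd_comp.
    by apply: cvg_H => //; exact: cvg_pr2.
  have m0 : 0 < Num.min d1 d2 by rewrite lt_min d10.
  exists (Num.min d1 d2) => // w b j Ib; rewrite lt_min => /andP[b1 b2] hw.
  have hw1 i : `|w i - u0 i| < d1.
    by apply: lt_le_trans (hw i) _; rewrite ge_min lexx.
  have hw2 i : `|w i - u0 i| < d2.
    by apply: lt_le_trans (hw i) _; rewrite ge_min lexx orbT.
  have [_ q1] := h1 w b j Ib b1 hw1; have [_ q2] := h2 w b j Ib b2 hw2.
  split.
    by apply: le_trans q1 _; rewrite lef_pV2 ?posrE// ge_min lexx.
  by apply: le_trans q2 _; rewrite lef_pV2 ?posrE// ge_min lexx orbT.
- move=> i d d' d'0 dd' Pd w b j Ib bd hw.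
  have [|k|q1 q2] := Pd w b j Ib.
  + exact: lt_le_trans dd'.
  + exact: lt_le_trans (hw k) dd'.
  + have dd : d^-1 <= d'^-1 by rewrite lef_pV2 ?posrE// (lt_le_trans d'0).
    by split; [exact: le_trans dd|exact: le_trans dd].
exists d => // p q w b j hp hq Ib bd hw.
have hp' : (p < r.+1)%N by []. have hq' : (q < r'.+1)%N by [].
exact: (hd (Ordinal hp', Ordinal hq') w b j).
Qed.

Lemma base_WB_bounded : exists B, forall j, `|at3 WB u0 a0 j| <= B.
Proof.
have cB i1 i2 i3 : i1 != i2 -> i2 != i3 -> cont_W I (WB i1 i2 i3).
  by move=> h1 h2 w Iw; exact: cvg_WB.
have [d d0 hd] := unif_near cB ltr01; exists d^-1 => j.
have z (x : R) : `|x - x| < d by rewrite subrr normr0.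
by have [_] := hd u0 a0 j Ia (z _) (fun i => z _).
Qed.

Lemma u0_bounded : exists B, forall j, `|u0 j| <= B.
Proof.
exists (\sum_i `|l i|) => j; have /andP[h1 h2] := u0l j.
rewrite ger0_norm//; apply: le_trans h2 _; apply: le_trans (ler_norm _) _.
by rewrite (bigD1 (xi j))//= lerDl sumr_ge0.
Qed.

(** The chain is solved in the unknowns x j = s j * (u j - u0 j). The strict signs accompany the
    solution so that it can be recognised as a billiard orbit. *)
Theorem assembly_sol : exists2 d, 0 < d & exists u : int -> R -> R,
  [/\ forall j, u j a0 = u0 j,
    forall j y, window I a0 d y -> [/\ at3 WF (u ^~ y) y j = 0,
      at3 Wtau (u ^~ y) y j < 0 & 0 < at3 Wsig (u ^~ y) y j],
    forall K, (K < r)%N -> (K < r')%N ->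
      UCv (window I a0 d) K (fun j y => H (xi j) 0 0 (u j y) y)
  & exists u' : int -> R, [/\ forall j, slope_lim (window I a0 d) (u j) a0 (u' j),
      exists B, forall j, `|u' j| <= B
    & forall j, at3 WA u0 a0 j * u' (j - 1) + at3 WB u0 a0 j * u' j +
        at3 WC u0 a0 j * u' (j + 1) + at3 WD u0 a0 j = 0]].
Proof.
have cA i1 i2 i3 : i1 != i2 -> i2 != i3 -> cont_W I (WA i1 i2 i3).
  by move=> h1 h2 w Iw; exact: cvg_WA.
have cB i1 i2 i3 : i1 != i2 -> i2 != i3 -> cont_W I (WB i1 i2 i3).
  by move=> h1 h2 w Iw; exact: cvg_WB.
have cC i1 i2 i3 : i1 != i2 -> i2 != i3 -> cont_W I (WC i1 i2 i3).
  by move=> h1 h2 w Iw; exact: cvg_WC.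
have cD i1 i2 i3 : i1 != i2 -> i2 != i3 -> cont_W I (WD i1 i2 i3).
  by move=> h1 h2 w Iw; exact: cvg_WD.
have ct i1 i2 i3 : i1 != i2 -> i2 != i3 -> cont_W I (Wtau i1 i2 i3).
  by move=> h1 h2 w Iw; exact: cvg_Wtau.
have cs i1 i2 i3 : i1 != i2 -> i2 != i3 -> cont_W I (Wsig i1 i2 i3).
  by move=> h1 h2 w Iw; exact: cvg_Wsig.
have cd i1 i2 i3 : i1 != i2 -> i2 != i3 -> cont_W I (Wdist i1 i2 i3).
  by move=> h1 h2 w Iw; exact: cvg_Wdist.
(* A coefficient within [eta] of its base value is within [kl / 3] of it after division by a cosine
   that is at least [sl], as [perturbed_dominance] requires. *)
pose eta := kl * sl / 3.
have eta0 : 0 < eta by rewrite divr_gt0// mulr_gt0.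
have sl2 : 0 < sl / 2 by rewrite divr_gt0.
have dl2 : 0 < dl / 2 by rewrite divr_gt0.
have [dA dA0 hA] := unif_near cA eta0; have [dB dB0 hB] := unif_near cB eta0.
have [dC dC0 hC] := unif_near cC eta0; have [dD dD0 hD] := unif_near cD eta0.
have [dt dt0 ht] := unif_near ct sl2; have [ds ds0 hs] := unif_near cs sl2.
have [dd dd0 hdd] := unif_near cd dl2; have [dH dH0 hH] := unif_bounds.
pose e := \big[Num.min/1]_(x <- [:: dA; dB; dC; dD; dt; ds; dd; dH]) x.
have e0 : 0 < e.
  by rewrite /e !big_cons big_nil !lt_min dA0 dB0 dC0 dD0 dt0 ds0 dd0 dH0 ltr01.
have [eA eB eC eD] : [/\ e <= dA, e <= dB, e <= dC & e <= dD].
  by rewrite /e !big_cons big_nil; split; rewrite !ge_min lexx ?orbT.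
have [et es ed eH] : [/\ e <= dt, e <= ds, e <= dd & e <= dH].
  by rewrite /e !big_cons big_nil; split; rewrite !ge_min lexx ?orbT.
(* Since [sl <= s j], a rescaled unknown of size [q] moves a boundary parameter by at most
   [e / 2]. *)
pose q := e * sl / 2.
have q0 : 0 < q by rewrite divr_gt0// mulr_gt0.
pose Db := dD^-1.
have Db0 : 0 < Db by rewrite invr_gt0.
(* The second term is the smallness condition [cs_small]. *)
pose d := Num.min e (kl * q / Db).
have d0 : 0 < d by rewrite lt_min e0 divr_gt0// mulr_gt0.
pose S := window I a0 d.
have SI : S `<=` I by exact: window_sub.
have Sa : S a0 by split=> //; rewrite subrr normr0.
have Se y : S y -> `|y - a0| < e.
  by move=> [_ h]; apply: lt_le_trans h _; rewrite ge_min lexx.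
pose V j x := u0 j + x / s j.
have sls j : sl <= s j by have /andP[] := s01 j.
have Vnear j x : `|x| <= q -> `|V j x - u0 j| < e.
  move=> xq; rewrite /V addrC addKr normrM normfV (gtr0_norm (s_gt0 j)).
  rewrite ltr_pdivrMr//; apply: le_lt_trans xq _.
  rewrite /q -mulrA ltr_pM2l//; apply: lt_le_trans (sls j).
  by rewrite [ltRHS](splitr sl) ltrDl.
(* a sequence equal to the given values at [j-1, j, j+1] and to [u0] elsewhere *)
pose ext (j : int) (x1 x2 x3 : R) (i : int) : R :=
  if i == j - 1 then V i x1 else if i == j then V i x2
  else if i == j + 1 then V i x3 else u0 i.
have extE G j x1 x2 x3 b : at3 G (ext j x1 x2 x3) b j =
    G (xi (j - 1)) (xi j) (xi (j + 1)) (V (j - 1) x1, V j x2, V (j + 1) x3, b).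
  by rewrite /at3 /ext eq_int_pred succ_eq_pred succ_eq_int !eqxx.
have extn j x1 x2 x3 : `|x1| <= q -> `|x2| <= q -> `|x3| <= q ->
    forall i, `|ext j x1 x2 x3 i - u0 i| < e.
  move=> h1 h2 h3 i; rewrite /ext.
  case: ifP => _; first exact: Vnear.
  case: ifP => _; first exact: Vnear.
  case: ifP => _; first exact: Vnear.
  by rewrite subrr normr0.
have near_le (d1 : R) (w : int -> R) : e <= d1 -> (forall i, `|w i - u0 i| < e) ->
    forall i, `|w i - u0 i| < d1.
  by move=> h hw i; exact: lt_le_trans (hw i) h.
pose F3 (G : 'I_m -> 'I_m -> 'I_m -> W -> R) (c : int -> R) j x1 x2 x3 b :=
  G (xi (j - 1)) (xi j) (xi (j + 1)) (V (j - 1) x1, V j x2, V (j + 1) x3, b) / c j.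
pose B := dB^-1 / sl.
have sys : chain_system S q kl B Db a0 (F3 WF (fun=> 1))
    (F3 WA (fun j => s (j - 1))) (F3 WB s) (F3 WC (fun j => s (j + 1)))
    (F3 WD (fun=> 1)).
  split=> //.
  - exact: ltW.
  - exact: window_interval.
  - move=> j x1 x2 x3 y1 y2 y3 al be _ _ _ _ _ _ Sal Sbe.
    have [t [t01 E]] := WF_mv (V (j - 1) x1) (V j x2) (V (j + 1) x3)
      (V (j - 1) y1) (V j y2) (V (j + 1) y3) (ne1 j) (ne2 j) (SI _ Sal) (SI _ Sbe).
    exists t; split=> //; rewrite /F3 /=; rewrite /= in E.
    have VE i x y : V i x + t * (V i y - V i x) = V i (x + t * (y - x)).
      by rewrite /V; ring.
    rewrite !VE in E.
    have VD i x y : V i y - V i x = (y - x) / s i by rewrite /V; ring.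
    rewrite !VD in E; rewrite !divr1 E.
    by congr (_ + _ + _ + _); rewrite mulrA mulrAC.
  - move=> j x1 x2 x3 al h1 h2 h3 Sal.
    have hn := extn j x1 x2 x3 h1 h2 h3.
    have [] := hA _ al j (SI _ Sal) (lt_le_trans (Se _ Sal) eA) (near_le _ _ eA hn).
    have [] := hB _ al j (SI _ Sal) (lt_le_trans (Se _ Sal) eB) (near_le _ _ eB hn).
    have [] := hC _ al j (SI _ Sal) (lt_le_trans (Se _ Sal) eC) (near_le _ _ eC hn).
    rewrite !extE /F3.
    have [A0 C0 E] := base_dom j.
    have sm := sls (j - 1); have sp := sls (j + 1); have sj := sls j.
    have sm0 := s_gt0 (j - 1); have sp0 := s_gt0 (j + 1); have sj0 := s_gt0 j.
    set XA := WA _ _ _ _; set XB := WB _ _ _ _; set XC := WC _ _ _ _.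
    move: (at3 WA u0 a0 j) (at3 WB u0 a0 j) (at3 WC u0 a0 j) A0 C0 E => A0 B0 C0.
    move=> A00 C00 E hc _ hb hb2 ha _.
    have quo (x x0 t : R) : sl <= t -> `|x - x0| <= eta -> `|x / t - x0 / t| <= kl / 3.
      move=> st h; have t0 : 0 < t by exact: lt_le_trans st.
      rewrite -mulrBl normrM normfV (gtr0_norm t0) ler_pdivrMr//.
      apply: le_trans h _; rewrite /eta mulrAC ler_pM2l// divr_gt0//.
    have := quo _ _ _ sm ha; have := quo _ _ _ sp hc; have := quo _ _ _ sj hb.
    have A1 : 0 <= A0 / s (j - 1) by rewrite divr_ge0// ltW.
    have C1 : 0 <= C0 / s (j + 1) by rewrite divr_ge0// ltW.
    have BB : `|XB / s j| <= B.
      rewrite normrM normfV (gtr0_norm sj0) /B.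
      by apply: ler_pM; rewrite ?invr_ge0 ?(ltW sj0)// lef_pV2 ?posrE.
    move=> k1 k2 k3; exact: (perturbed_dominance E A1 C1 BB (kapl j) k1 k2 k3).
  - move=> j x1 x2 x3 al h1 h2 h3 Sal.
    have hn := extn j x1 x2 x3 h1 h2 h3.
    have [_] := hD _ al j (SI _ Sal) (lt_le_trans (Se _ Sal) eD) (near_le _ _ eD hn).
    by rewrite extE /F3 divr1.
  - by move=> j; rewrite /F3 /V !mul0r !addr0 divr1; exact: base_F.
  - move=> y [_ yd].
    have : `|y - a0| <= kl * q / Db.
      by apply: ltW; apply: lt_le_trans yd _; rewrite ge_min lexx orbT.
    by rewrite ler_pdivlMr// mulrC.
  - move=> j; exact: (cont4_scaled (q := q) (s (j - 1)) (u0 (j - 1)) (u0 j)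
      (u0 (j + 1)) SI (cA _ _ _ (ne1 j) (ne2 j)) sl0 (sls _) (sls _) (sls _)).
  - move=> j; exact: (cont4_scaled (q := q) (s j) (u0 (j - 1)) (u0 j)
      (u0 (j + 1)) SI (cB _ _ _ (ne1 j) (ne2 j)) sl0 (sls _) (sls _) (sls _)).
  - move=> j; exact: (cont4_scaled (q := q) (s (j + 1)) (u0 (j - 1)) (u0 j)
      (u0 (j + 1)) SI (cC _ _ _ (ne1 j) (ne2 j)) sl0 (sls _) (sls _) (sls _)).
  - move=> j; exact: (cont4_scaled (q := q) (1) (u0 (j - 1)) (u0 j)
      (u0 (j + 1)) SI (cD _ _ _ (ne1 j) (ne2 j)) sl0 (sls _) (sls _) (sls _)).
have [x hx] := chain_exists sys.
have x0 := chain_sol0 sys hx.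
pose u j y := V j (x j y).
have ua j : u j a0 = u0 j by rewrite /u x0 /V mul0r addr0.
have un y i : S y -> `|u i y - u0 i| < e.
  by move=> Sy; apply: Vnear; have [] := hx y Sy i.
have bH p q' : (p <= r)%N -> (q' <= r')%N -> forall j y, S y ->
    `|(H (xi j) p q' (u j y) y).1| <= dH^-1 /\ `|(H (xi j) p q' (u j y) y).2| <= dH^-1.
  move=> hp hq j y Sy; apply: (hH p q' (u ^~ y) y j hp hq (SI _ Sy)).
    exact: lt_le_trans (Se _ Sy) eH.
  by move=> i; apply: lt_le_trans (un y i Sy) eH.
have hdist j y : S y -> dl / 2 <= at3 Wdist (u ^~ y) y j.
  move=> Sy; have [+ _] := hdd (u ^~ y) y j (SI _ Sy) (lt_le_trans (Se _ Sy) ed)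
    (near_le _ _ ed (fun i => un y i Sy)).
  by rewrite ler_norml => /andP[k1 _]; have := base_dist j; lra.
have uUC n : UC S n x -> UC S n u.
  move=> ux; apply: UC_add; first by apply: UC_cst; exact: u0_bounded.
  apply: UC_mul => //; apply: UC_cst; exists sl^-1 => j.
  by rewrite normfV (gtr0_norm (s_gt0 j)) lef_pV2 ?posrE.
have bV1 (t : int -> int) : exists B0, forall j, `|(s (t j))^-1| <= B0.
  by exists sl^-1 => j; rewrite normfV (gtr0_norm (s_gt0 _)) lef_pV2 ?posrE.
have bH1 p q' : (p <= r)%N -> (q' <= r')%N ->
    ubounded S (fun j y => (H (xi j) p q' (u j y) y).1).
  by move=> hp hq; exists dH^-1 => j y Sy; have [] := bH p q' hp hq j y Sy.
have bH2 p q' : (p <= r)%N -> (q' <= r')%N ->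
    ubounded S (fun j y => (H (xi j) p q' (u j y) y).2).
  by move=> hp hq; exists dH^-1 => j y Sy; have [] := bH p q' hp hq j y Sy.
exists d => //; exists u; split=> //.
- move=> j y Sy.
  have nu := fun i => un y i Sy.
  have [_] := hx y Sy j; rewrite /along /F3 divr1 => E; split=> //.
  + have [+ _] := ht (u ^~ y) y j (SI _ Sy) (lt_le_trans (Se _ Sy) et) (near_le _ _ et nu).
    rewrite base_tau ler_norml => /andP[_]; have := sls j; lra.
  + have [+ _] := hs (u ^~ y) y j (SI _ Sy) (lt_le_trans (Se _ Sy) es) (near_le _ _ es nu).
    rewrite base_sig ler_norml => /andP[+ _]; have := sls j; lra.
- move=> K Kr Kr'.
  have ux : UC S K x.
    apply: (chain_smooth sys hx) => n nK ux.
    have uu := uUC n ux.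
    (* Here n < K < r: the two derivatives consumed by the coefficients at order [n] are available,
       which is why [u] reaches one class less than the data. *)
    have nr : (n.+2 <= r)%N by rewrite (leq_trans _ Kr).
    have nr' : (n.+2 <= r')%N by rewrite (leq_trans _ Kr').
    split.
    + apply: UC_mul; first exact: (UC_WA SI bH1 bH2 dl2 hdist uu nr nr').
      by apply: UC_cst; exact: (bV1 (fun j => j - 1)).
    + apply: UC_mul; first exact: (UC_WB SI bH1 bH2 dl2 hdist uu nr nr').
      by apply: UC_cst; exact: (bV1 id).
    + apply: UC_mul; first exact: (UC_WC SI bH1 bH2 dl2 hdist uu nr nr').
      by apply: UC_cst; exact: (bV1 (fun j => j + 1)).
    + apply: UC_mul; first exact: (UC_WD SI bH1 bH2 dl2 hdist uu nr nr').
      by apply: UC_cst; exists 1 => _; rewrite invr1 normr1.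
  by apply: (UCv_H SI bH1 bH2 (uUC K ux)); rewrite add0n ltnW.
- have [x' [dx bx' hr]] := chain_derivable sys hx.
  exists (fun j => x' j a0 / s j); split.
  + move=> j; apply: slope_lim_val (slope_limD (slope_lim_cst _ (u0 j) _)
      (slope_limM (dx j a0 Sa) (slope_lim_cst _ (s j)^-1 _))) _.
    by rewrite mulr0 addr0 add0r.
  + exists (Db / kl / sl) => j; rewrite normrM.
    apply: ler_pM => //; first exact: bx'.
    by rewrite normfV (gtr0_norm (s_gt0 j)) lef_pV2 ?posrE.
  + move=> j; have := hr j a0 Sa; rewrite /row /along /F3 !x0 /V !mul0r !addr0 divr1.
    by rewrite /at3 => <-; congr (_ + _ + _ + _); rewrite mulrA mulrAC.
Qed.

End assembly.

(** * The explicit bound on the derivative *)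

Lemma drift_bound (R : realType) (dm N1 N2 : R) (S2 e1 e2 T b1 b2 b3 : R * R) :
  0 < dm -> dm <= N1 -> dm <= N2 -> enorm e1 = 1 -> enorm e2 = 1 -> enorm T = 1 ->
  `|dot S2 (e1 - e2) + det2 e1 T * det2 e1 (b2 - b1) / N1
    - det2 e2 T * det2 e2 (b3 - b2) / N2| <=
  2 * enorm S2 + enorm (b2 - b1) / dm + enorm (b3 - b2) / dm.
Proof.
move=> dm0 h1 h2 n1 n2 nT.
have tm (N : R) (e b : R * R) : dm <= N -> enorm e = 1 ->
    `|det2 e T * det2 e b / N| <= enorm b / dm.
  move=> hN ne; have N0 : 0 < N by exact: lt_le_trans hN.
  rewrite !normrM normfV (gtr0_norm N0).
  apply: ler_pM; [by rewrite mulr_ge0| by rewrite invr_ge0 ltW| |]; last first.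
    by rewrite lef_pV2 ?posrE.
  rewrite -[leRHS]mul1r; apply: ler_pM => //.
    by apply: le_trans (det2_le _ _) _; rewrite ne nT mulr1.
  by apply: le_trans (det2_le _ _) _; rewrite ne mul1r.
apply: le_trans (ler_normB _ _) _; apply: lerD; last exact: tm.
apply: le_trans (ler_normD _ _) _; apply: lerD; last exact: tm.
apply: le_trans (dot_le _ _) _; rewrite mulrC ler_wpM2r ?enorm_ge0//.
have := enormD e1 (- e2); rewrite enormN n1 n2; apply: le_trans.
exact: lexx.
Qed.

Section core.
Variables (R : realType) (m : nat) (I : set R) (r r' : nat) (a0 : R).
Variable H : 'I_m -> nat -> nat -> R -> R -> R * R.
Hypothesis r2 : (2 <= r)%N.
Hypothesis r2' : (2 <= r')%N.
Hypothesis iI : is_interval I.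
Hypothesis Ia : I a0.
Hypothesis sf1 : forall i, smooth_family I r r' (fun p q u b => (H i p q u b).1).
Hypothesis sf2 : forall i, smooth_family I r r' (fun p q u b => (H i p q u b).2).
Variables (K : R -> 'I_m -> set (R * R)) (c : R -> 'I_m -> R -> R * R).
Variable L : 'I_m -> R.
Hypothesis tb : forall b, I b -> exists L' T Q, table (K b) L' (c b) T Q.
Hypothesis tb0 : table (K a0) L (c a0) (fun i u => H i 1 0 u a0)
  (fun i u => H i 2 0 u a0).
Hypothesis cH : forall i u, c a0 i u = H i 0 0 u a0.
Hypothesis HK : forall b i u, I b -> K b i (H i 0 0 u b).
Hypothesis Hccw : forall b i u y, I b -> K b i y ->
  0 <= det2 (H i 1 0 u b) (y - H i 0 0 u b).
Hypothesis Hunit : forall b i u, I b -> dot (H i 1 0 u b) (H i 1 0 u b) = 1.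
Variable i0 : 'I_m.
Hypothesis H01 : forall i u, i != i0 -> H i 0 1 u a0 = 0.
Hypothesis H11 : forall i u, i != i0 -> H i 1 1 u a0 = 0.
Variables C01 C11 : R.
Hypothesis hC01 : forall i u, 0 <= u <= L i -> enorm (H i 0 1 u a0) <= C01.
Hypothesis hC11 : forall i u, 0 <= u <= L i -> enorm (H i 1 1 u a0) <= C11.
Variable xi : int -> 'I_m.
Hypothesis hxi : Sigma xi.

Let disj i k u v b : i != k -> I b -> H k 0 0 v b != H i 0 0 u b.
Proof.
move=> ik Ib; have [L' [T [Q tbb]]] := tb Ib.
exact: (table_neq tbb ik (HK i u Ib) (HK k v Ib)).
Qed.

(** [WF = 0] makes the turn normal to the boundary and the signs make it outward, while the obstacle
    lies on the inner side of its tangent. Of [H] only points and tangents enter, so a frozen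
    parametrization serves as well. *)
Lemma solution_coded (u : int -> R) b : I b ->
  (forall j, [/\ at3 xi (WF H) u b j = 0, at3 xi (Wtau H) u b j < 0
    & 0 < at3 xi (Wsig H) u b j]) ->
  coded_orbit (K b) xi (fun j => H (xi j) 0 0 (u j) b).
Proof.
move=> Ib h j; split; first exact: HK.
move=> y Ky; have [] := h j; have := Hccw (u j) Ib Ky; have := Hunit (xi j) (u j) Ib.
rewrite /at3 /WF /Wtau /Wsig /Em /Ep /gF /H1 /H2 /H3 /orbit_dir subrK /=.
set T := H (xi j) 1 0 (u j) b; set P := H (xi j) 0 0 (u j) b.
set e1 := dir _ P; set e2 := dir P _.
clearbody T P e1 e2 => T1 c1 F0 t0 s0.
rewrite (unit_decomp (e2 - e1) T1).
have -> : dot (e2 - e1) T = 0.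
  by rewrite dotC -opprB dotNr F0 oppr0.
rewrite scale0r add0r dotZl.
have -> : dot (T.2, - T.1) (y - P) = - det2 T (y - P).
  by rewrite dotC dot_rot det2C.
have -> : det2 (e2 - e1) T = det2 e2 T - det2 e1 T by rewrite /det2 /=; ring.
rewrite mulrN oppr_le0 mulr_ge0// subr_ge0 ltW// (lt_trans t0)//.
Qed.

Notation dm := (d_min (K a0) (c a0)).
Notation km := (kappa_min (K a0) (c a0)).
Notation cp := (cos (phi_max (K a0) (c a0))).

(** Smoothness is obtained with constants from compactness. The bound is computed at [a0] itself,
    where the coded orbit is non-wandering and therefore obeys the sharp constants [dm], [km] and
    [cp]. *)
Theorem reflection_point_smooth j : exists2 d, 0 < d &
  let p b := reflection_point (K b) (c b) xi j in
  (forall k, (k < r)%N -> (k < r')%N ->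
     UC (window I a0 d) k (fun _ : unit => fun x => (p x).1) /\
     UC (window I a0 d) k (fun _ : unit => fun x => (p x).2)) /\
  exists f v, [/\ forall y, window I a0 d y -> p y = f y,
    vslope_lim (window I a0 d) f a0 v &
    enorm v <= cp^-1 * ((C01 + C11 * dm) / (km * dm)) + C01].
Proof.
have [p0 hp0] := coded_exists tb0 hxi.
have [sl sl0 hsl] := turn_gap tb0.
have /choice[u0 hu0] := coded_reflect tb0 hxi hp0 sl0 hsl.
have u0l i : 0 <= u0 i <= L (xi i).
  by have [/andP[h1 h2] _ _ _ _] := hu0 i; rewrite h1 ltW.
have P0 i : H (xi i) 0 0 (u0 i) a0 = p0 i by rewrite -cH; have [] := hu0 i.
have c0 i : p0 i = c a0 (xi i) (u0 i) by have [] := hu0 i.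
pose s i := dot (orbit_dir p0 i) (rot (H (xi i) 1 0 (u0 i) a0)).
have T1 i u : enorm (H i 1 0 u a0) = 1.
  by rewrite /enorm Hunit// sqrtr1.
have e1 i : enorm (orbit_dir p0 i) = 1.
  by apply: enorm_dir; exact: (coded_ne tb0 hxi hp0).
have s01 i : sl <= s i <= 1.
  have [_ _ h _ _] := hu0 i; rewrite h /=.
  apply: le_trans (ler_norm _) _; rewrite /s /rot dot_rot.
  by apply: le_trans (det2_le _ _) _; rewrite e1 T1 mulr1.
have s0 i : 0 < s i by have /andP[h _] := s01 i; exact: lt_le_trans h.
have em i : dir (H (xi (i - 1)) 0 0 (u0 (i - 1)) a0) (H (xi i) 0 0 (u0 i) a0) =
    orbit_dir p0 (i - 1) by rewrite !P0 /orbit_dir subrK.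
have ep i : dir (H (xi i) 0 0 (u0 i) a0) (H (xi (i + 1)) 0 0 (u0 (i + 1)) a0) =
    orbit_dir p0 i by rewrite !P0.
have base_sig i : at3 xi (Wsig H) u0 a0 i = s i.
  by rewrite /at3 /Wsig /Ep /H2 /H3 /= ep /s /rot dot_rot.
have base_tau i : at3 xi (Wtau H) u0 a0 i = - s i.
  rewrite /at3 /Wtau /Em /H1 /H2 /= em /s.
  by have [_ _ _ <- _] := hu0 i; rewrite /rot dot_rot.
have jump i : orbit_dir p0 (i - 1) - orbit_dir p0 i =
    (- (2 * s i)) *: rot (H (xi i) 1 0 (u0 i) a0).
  by have [_ _ _ _ h] := hu0 i; rewrite -opprB h scaleNr.
pose kap i := det2 (H (xi i) 1 0 (u0 i) a0) (H (xi i) 2 0 (u0 i) a0).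
have base_curv i : dot (H (xi i) 2 0 (u0 i) a0)
  (dir (H (xi (i - 1)) 0 0 (u0 (i - 1)) a0) (H (xi i) 0 0 (u0 i) a0) -
   dir (H (xi i) 0 0 (u0 i) a0) (H (xi (i + 1)) 0 0 (u0 (i + 1)) a0))
  = 2 * kap i * s i.
  rewrite em ep jump dotZr.
  have -> := curv_vec (tb_ob tb0 (xi i)) (u0 i).
  rewrite dotZl (dot_nn (tb_ob tb0 (xi i))) mulr1 /kap; ring.
have [kl kl0 hkl] := curvature_lower tb0.
have [dl dl0 hdl] := separation tb0.
have base_F i : at3 xi (WF H) u0 a0 i = 0.
  rewrite /at3 /WF /gF /H1 /H2 /H3 /= em ep jump dotZr /rot dot_rot det2xx mulr0 //.
have ne i : xi (i - 1) != xi i by have := hxi (i - 1); rewrite subrK.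
have Kp i : K a0 (xi i) (p0 i) by have [] := hp0 i.
have base_dist i : dl <= at3 xi (Wdist H) u0 a0 i.
  by rewrite /at3 /Wdist /H1 /H2 /= !P0; exact: hdl (ne i) (Kp _) (Kp _).
have kapl i : kl <= kap i by exact: hkl.
have [d d0 [u [ua hsol hUC [u' [du' [Bu hBu] hrow]]]]] :=
  assembly_sol r2 r2' iI Ia sf1 sf2 disj hxi sl0 kl0 dl0 u0l s01 base_sig base_tau
    base_curv kapl base_F base_dist.
have pE y : window I a0 d y -> reflection_point (K y) (c y) xi j =
    H (xi j) 0 0 (u j y) y.
  move=> Wy; have Iy := Wy.1; have [L' [T [Q tby]]] := tb Iy.
  exact: (reflection_point_coded tby hxi (solution_coded Iy (fun i => hsol i y Wy))).
exists d => //=; split.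
  move=> k kr kr'; have [h1 h2] := hUC k kr kr'; split.
    apply: UC_eq (UC_reindex (fun _ : unit => j) h1).
    by move=> _ y Wy; rewrite pE.
  apply: UC_eq (UC_reindex (fun _ : unit => j) h2).
  by move=> _ y Wy; rewrite pE.
have W0 : window I a0 d a0 by split=> //; rewrite subrr normr0.
exists (fun y => H (xi j) 0 0 (u j y) y),
  (u' j *: H (xi j) 1 0 (u0 j) a0 + 1 *: H (xi j) 0 1 (u0 j) a0); split.
- exact: pE.
- have := vslope_lim_H iI sf1 sf2 (xi j) (ltnW r2) (ltnW r2') W0 (fun y h => h.1)
    (du' j) (slope_lim_id _ _).
  by rewrite ua.
have nw i := coded_nonwandering tb0 hxi hp0 i.
have ex : exists x, nonwandering (K a0) (c a0) x by exists (p0 0, orbit_dir p0 0).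
have dm0 : 0 < dm by exact: (d_min_gt0 tb0 ex).
have km0 : 0 < km by exact: (kappa_min_gt0 tb0 ex).
have [cp0 hcp] := cos_phi_max tb0 ex.
have hkm i : km <= kap i.
  by apply: (kappa_min_le tb0 (nw i)); rewrite /= c0.
have hcps i : cp <= s i by exact: (hcp _ _ _ (nw i) (c0 i)).
have hdm i : dm <= enorm (p0 (i + 1) - p0 i).
  exact: (d_min_le tb0 (nw i) (nw (i + 1)) (coded_next tb0 hxi hp0 i)).
have [B hB] := base_WB_bounded r2 Ia sf1 sf2 disj hxi u0l.
have C01_0 : 0 <= C01 by apply: le_trans (enorm_ge0 _) (hC01 (u0l 0)).
have C11_0 : 0 <= C11 by apply: le_trans (enorm_ge0 _) (hC11 (u0l 0)).
pose E := (C01 + C11 * dm) / (km * dm).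
have E0 : 0 <= E.
  by rewrite divr_ge0 ?addr_ge0 ?mulr_ge0 ?(ltW dm0) ?(ltW km0).
have dominance : dominant (2 * km) (B / sl)
    (fun i => at3 xi (WA H) u0 a0 i / s (i - 1))
    (fun i => at3 xi (WB H) u0 a0 i / s i)
    (fun i => at3 xi (WC H) u0 a0 i / s (i + 1)).
  move=> i; have [A0 C0 D] :=
    base_dom sl0 dl0 s01 base_sig base_tau base_curv base_dist i.
  apply/andP; split.
    rewrite -D !ger0_norm ?divr_ge0 ?(ltW (s0 _))//.
    by rewrite lerD2l ler_pM2l.
  apply: le_trans (ler_norm _) _; rewrite normrM normfV (gtr0_norm (s0 i)).
  apply: ler_pM => //; first by rewrite invr_ge0 ltW.
  by rewrite lef_pV2 ?posrE//; have /andP[] := s01 i.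
have drift i : `|at3 xi (WD H) u0 a0 i| <= 2 * km * E.
  have -> : 2 * km * E = 2 * C11 + (C01 / dm + C01 / dm).
    by rewrite /E; field; rewrite !gt_eqF.
  rewrite /at3 /WD /gD /H1 /H2 /H3 /= em ep !P0.
  have dm1 : dm <= enorm (p0 i - p0 (i - 1)) by have := hdm (i - 1); rewrite subrK.
  apply: le_trans (drift_bound _ _ _ _ dm0 dm1 (hdm i) (e1 _) (e1 _) (T1 _ _)) _.
  have dV : 0 <= dm^-1 by rewrite invr_ge0 ltW.
  have enorm0 : enorm (0 : R * R) = 0 by rewrite /enorm dot0l sqrtr0.
  (* If [xi i] moves, its neighbours are frozen and each flight term carries one [C01]. If it does
     not, its own derivatives vanish and each flight term sees the motion of its other end at
     most. *)
  have [xi0|xi0] := eqVneq (xi i) i0.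
    have nm : xi (i - 1) != i0 by rewrite -xi0.
    have np : xi (i + 1) != i0 by rewrite -xi0 eq_sym; exact: hxi.
    rewrite (H01 _ nm) (H01 _ np) subr0 sub0r enormN -addrA.
    apply: lerD; first by rewrite ler_pM2l ?hC11.
    by apply: lerD; rewrite ler_wpM2r ?hC01.
  rewrite (H01 _ xi0) (H11 _ xi0) subr0 sub0r enormN enorm0 mulr0 add0r -[leLHS]add0r.
  apply: lerD; first by rewrite mulr_ge0.
  by apply: lerD; rewrite ler_wpM2r ?hC01.
have km2 : 0 < 2 * km by rewrite mulr_gt0.
(* The bound of the drift divided by the gap [2 * km] is [E]. *)
have wE i : `|s i * u' i| <= E.
  apply: (dominant_le km2 dominance E0 (w := fun i => s i * u' i) (W := Bu)).
    move=> k; rewrite normrM (gtr0_norm (s0 k)) -[leRHS]mul1r.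
    by apply: ler_pM => //; [exact: ltW|have /andP[] := s01 k].
  move=> k; rewrite /row.
  have dv (x y t : R) : 0 < t -> x / t * (t * y) = x * y.
    by move=> t0; rewrite mulrA divfK// gt_eqF.
  rewrite !dv//.
  have -> : at3 xi (WA H) u0 a0 k * u' (k - 1) + at3 xi (WB H) u0 a0 k * u' k +
      at3 xi (WC H) u0 a0 k * u' (k + 1) = - at3 xi (WD H) u0 a0 k.
    by apply/eqP; rewrite -subr_eq0 opprK hrow.
  by rewrite normrN; exact: drift.
(* The velocity splits into motion along the boundary, of size |u' j| <= E / cp, and motion of the
   boundary itself, at most [C01]. *)
apply: le_trans (enormD _ _) _; rewrite !enormZ T1 mulr1 normr1 mul1r.
apply: lerD; last exact: hC01.
rewrite -/E ler_pdivlMl//; apply: le_trans (wE j).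
by rewrite normrM (gtr0_norm (s0 j)) ler_wpM2r.
Qed.

End core.

(** * From the deformation to the abstract hypotheses *)

Lemma diff_quot_slope (R : realType) (S : set R) (f : R -> R * R) x l :
  (h^-1 *: (f (h + x) - f x)) @[h --> within [set h | S (h + x)] (0 : R)^'] --> l ->
  vslope_lim S f x l.
Proof.
move=> cf.
have key (g : R -> R) m :
    (h^-1 * (g (h + x) - g x)) @[h --> within [set h | S (h + x)] (0 : R)^'] --> m ->
    slope_lim S g x m.
  move=> /cvgrPdist_le hm; apply/slope_limP => e e0.
  have /nbhs_ballP[d d0 hd] := hm e e0.
  exists d => // y Sy yd.
  have [->|yx] := eqVneq y x; first by rewrite !subrr mulr0 subr0 normr0 mulr0.
  have yx0 : y - x != 0 by rewrite subr_eq0.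
  have := hd (y - x); rewrite /ball/= sub0r normrN subrK => /(_ yd yx0 Sy) {}hd.
  have -> : g y - g x - m * (y - x) = - ((m - (y - x)^-1 * (g y - g x)) * (y - x)).
    by field.
  by rewrite normrN normrM ler_pM2r// normr_gt0.
by split; apply: key; [exact: (cvg_fst_comp cf)|exact: (cvg_snd_comp cf)].
Qed.

Lemma derivable_slope (R : realType) (f : R -> R * R) u :
  derivable f u 1 -> vslope_lim setT f u (derive1 f u).
Proof.
move=> df; apply: diff_quot_slope.
have E : (fun h => h^-1 *: ((f \o shift u) (h *: 1) - f u)) =
    (fun h : R => h^-1 *: (f (h + u) - f u)).
  by apply/funext => h; rewrite /= /GRing.scale /= mulr1.
move: df; rewrite /derivable E => df.
apply: cvg_trans; last exact: df.
by apply: cvg_app; exact: cvg_within.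
Qed.

Lemma derivable_in_slope (R : realType) (I : set R) (f : R -> R * R) u :
  derivable_in I f u -> vslope_lim I f u (derive_in I f u).
Proof. by move=> df; apply: diff_quot_slope; exact: df. Qed.

Lemma within_cont2 (R : realType) (I : set R) (f : R * R -> R * R) :
  {within [set z : R * R | I z.2], continuous f} ->
  cont2_in I (fun u b => (f (u, b)).1) /\ cont2_in I (fun u b => (f (u, b)).2).
Proof.
move=> /subspace_continuousP cf.
have key (g : R * R -> R) : (forall z : R * R, I z.2 ->
    g t @[t --> within [set z : R * R | I z.2] (nbhs z)] --> g z) ->
    cont2_in I (fun u b => g (u, b)).
  move=> cg u a Ia e e0; have /cvgrPdist_le/(_ e e0) := cg (u, a) Ia.
  move=> /nbhs_ballP[d d0 hd]; exists d => // v b Ib vu ba; rewrite distrC.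
  by apply: hd => //; split; rewrite /ball/= distrC.
split.
  by apply: (key (fun z => (f z).1)) => z Iz; exact: cvg_fst_comp (cf z Iz).
by apply: (key (fun z => (f z).2)) => z Iz; exact: cvg_snd_comp (cf z Iz).
Qed.

Lemma cont2_in_slice (R : realType) (I : set R) (h : R -> R -> R) a : I a ->
  cont2_in I h -> continuous (h ^~ a).
Proof.
move=> Ia ch u; apply/cvgrPdist_le => e e0; have [d d0 hd] := ch u a Ia e e0.
apply/nbhs_ballP; exists d => // v; rewrite /ball/= distrC => vu; rewrite distrC.
by apply: hd => //; rewrite subrr normr0.
Qed.

Section pderiv.
Variables (R : realType) (I : set R) (r r' : nat).

(** [pderiv] differentiates in the parameter first, so the steps in [u] are immediate at every order
    and those in the parameter at [p = 0], matching the fields of [smooth_family]. *)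
Lemma pderiv_smooth (f : R -> R -> R * R) : CAB I r r' f ->
  smooth_family I r r' (fun p q u b => (pderiv I p q f u b).1) /\
  smooth_family I r r' (fun p q u b => (pderiv I p q f u b).2).
Proof.
move=> [da du cf].
have hu p q c u : (p < r)%N -> (q <= r')%N -> I c ->
    vslope_lim setT (pderiv I p q f ^~ c) u (pderiv I p.+1 q f u c).
  by move=> pr qr Ic; exact: derivable_slope (du p q u c pr qr Ic).
have ha q v b : (q < r')%N -> I b ->
    vslope_lim I (pderiv I 0 q f v) b (pderiv I 0 q.+1 f v b).
  by move=> qr Ib; exact: derivable_in_slope (da q v b qr Ib).
have hc p q (pr : (p <= r)%N) (qr : (q <= r')%N) := within_cont2 (cf p q pr qr).
split; split.
- by move=> p q pr qr c Ic u _; have [] := hu p q c u pr qr Ic.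
- by move=> q v qr b Ib; have [] := ha q v b qr Ib.
- by move=> p q pr qr; have [] := hc p q pr qr.
- by move=> p q pr qr c Ic u _; have [] := hu p q c u pr qr Ic.
- by move=> q v qr b Ib; have [] := ha q v b qr Ib.
- by move=> p q pr qr; have [] := hc p q pr qr.
Qed.

(** For an obstacle fixed as a set this family still runs along its boundary at every parameter,
    whatever sliding the original parametrization does. *)
Definition frozen (V : zmodType) (a : R) (G : nat -> nat -> R -> R -> V)
    (p q : nat) (u b : R) : V :=
  if q == 0%N then G p 0%N u a else 0.

Lemma frozen_smooth (a : R) (G : nat -> nat -> R -> R -> R) : I a ->
  smooth_family I r r' G -> smooth_family I r r' (frozen a G).
Proof.
move=> Ia [du da cG]; split.
- move=> p [|q] pr qr c Ic u _; first exact: (du p 0%N pr (leq0n _) a Ia u).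
  exact: slope_lim_cst.
- by move=> [|q] v qr b Ib; exact: slope_lim_cst.
- move=> p [|q] pr qr u b Ib e e0.
    have [d d0 hd] := cG p 0%N pr (leq0n _) u a Ia e e0.
    exists d => // v b' _ vu _; rewrite /frozen /=.
    by apply: hd => //; rewrite subrr normr0.
  by exists 1 => // v b' _ _ _; rewrite /frozen /= subrr normr0 ltW.
Qed.

End pderiv.

Section convexity.
Variable R : realType.
Local Open Scope convex_scope.

Lemma convex_segment (A : set (R * R)) (x y : R * R) (t : R) :
  @convex_set R (R * R)%type A -> A x -> A y -> 0 <= t <= 1 ->
  A (x + t *: (y - x)).
Proof.
move=> cA Ax Ay /andP[t0 t1].
have := cA y x (Itv01 t0 t1); rewrite !inE => /(_ Ay Ax).
rewrite [X in A X](_ : _ = x + t *: (y - x))//.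
rewrite /conv /= scalerBl scale1r scalerBr addrC -addrA; congr (_ + _).
by rewrite addrC.
Qed.

Lemma convex_hull_segment (A : set (R * R)) (x y : R * R) (t : R) :
  A x -> A y -> 0 <= t <= 1 -> convex_hull A (x + t *: (y - x)).
Proof.
by move=> Ax Ay t01 B [cB AB]; apply: convex_segment => //; exact: AB.
Qed.

End convexity.

Section deformation.
Variables (R : realType) (m r r' : nat) (I : set R).
Variables (K : 'I_m -> R -> set (R * R)) (L : 'I_m -> R -> R).
Variables (phi : 'I_m -> R -> R -> R * R) (C : nat -> nat -> R -> R).
Hypothesis hK : billiard_deformation r r' I K L phi C.
Hypothesis r2 : (2 <= r)%N.

Lemma deformation_table b : I b ->
  table (obstacles_at K b) (L ^~ b) (boundaries_at phi b)
    (fun i u => pderiv I 1 0 (phi i) u b) (fun i u => pderiv I 2 0 (phi i) u b).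
Proof.
move=> Ib; split; last 2 first.
- move=> i j p ij Ki Kj; have := bd_disjoint hK Ib ij.
  by move/seteqP => [/(_ p)] h _; apply: h.
- move=> i j k x y t ij jk ik Kx Ky t01 Kk.
  have := bd_no_eclipse hK Ib ij jk ik.
  move/seteqP => [/(_ (x + t *: (y - x)))] h _; apply: h; split=> //.
  by apply: convex_hull_segment => //; [left|right].
move=> i; have [sm1 sm2] := pderiv_smooth (bd_smooth hK i).
have r1 : (1 <= r)%N by exact: ltnW.
have d p u : (p < r)%N ->
    vslope_lim setT (pderiv I p 0 (phi i) ^~ b) u (pderiv I p.+1 0 (phi i) u b).
  move=> pr; split; first exact: (sf_u sm1 pr (leq0n _) Ib Logic.I).
  exact: (sf_u sm2 pr (leq0n _) Ib Logic.I).
have ct p : (p <= r)%N -> continuous (pderiv I p 0 (phi i) ^~ b).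
  move=> pr u; apply: cvg_pairP.
    exact: (cont2_in_slice Ib (sf_cont sm1 pr (leq0n _))).
  exact: (cont2_in_slice Ib (sf_cont sm2 pr (leq0n _))).
split.
- exact: (bd_arclength hK i Ib).
- by [].
- by [].
- exact: (bd_compact hK Ib).
- by move=> x y t; exact: (convex_segment (bd_convex hK Ib)).
- by move=> u; exact: (d 0%N).
- by move=> u; exact: (d 1%N).
- by move=> u; exact: (bd_curvature hK i u Ib).
- exact: ct.
- by move=> u; exact: (cvg_det2 (ct 1%N r1 u) (ct 2%N r2 u)).
Qed.

Hypothesis r2' : (2 <= r')%N.
Hypothesis iI : is_interval I.
Variable xi : int -> 'I_m.
Hypothesis hxi : Sigma xi.

(** The freezing is done afresh at each [a]; the conclusion concerns a window around [a] and the
    derivative at [a] alone. *)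
Lemma reflection_point_local a j : I a -> exists2 d, 0 < d &
  let p b := reflection_point (obstacles_at K b) (boundaries_at phi b) xi j in
  (forall k, (k < r)%N -> (k < r')%N ->
     UC (window I a d) k (fun _ : unit => fun x => (p x).1) /\
     UC (window I a d) k (fun _ : unit => fun x => (p x).2)) /\
  exists f v, [/\ forall y, window I a d y -> p y = f y,
    vslope_lim (window I a d) f a v & enorm v <= C_p K phi C a].
Proof.
move=> Ia; have [i0 hi0] := bd_one_moves hK.
pose H i p q u b := if i == i0 then pderiv I p q (phi i) u b
  else frozen a (fun p q => pderiv I p q (phi i)) p q u b.
have H0 i p u : H i p 0%N u a = pderiv I p 0 (phi i) u a.
  by rewrite /H /frozen; case: ifP.
have sf1 i : smooth_family I r r' (fun p q u b => (H i p q u b).1).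
  have [h _] := pderiv_smooth (bd_smooth hK i).
  rewrite /H; case: eqP => // _; have := frozen_smooth Ia h.
  by congr smooth_family; apply/funext => p; apply/funext => -[|q].
have sf2 i : smooth_family I r r' (fun p q u b => (H i p q u b).2).
  have [_ h] := pderiv_smooth (bd_smooth hK i).
  rewrite /H; case: eqP => // _; have := frozen_smooth Ia h.
  by congr smooth_family; apply/funext => p; apply/funext => -[|q].
have tb0 : table (obstacles_at K a) (L ^~ a) (boundaries_at phi a)
    (fun i u => H i 1%N 0%N u a) (fun i u => H i 2%N 0%N u a).
  have := deformation_table Ia; congr table.
    by apply/funext => i; apply/funext => u; rewrite H0.
  by apply/funext => i; apply/funext => u; rewrite H0.
(* [H i] runs along the boundary of [K i b] even when [i] is frozen *)
have site b i : I b -> exists2 a', I a' & K i b = K i a' /\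
    forall p u, H i p 0%N u b = pderiv I p 0 (phi i) u a'.
  move=> Ib; rewrite /H /frozen; have [_|ne] := eqVneq i i0; first by exists b.
  by exists a => //; split=> //; exact: hi0.
have HK b i u : I b -> obstacles_at K b i (H i 0%N 0%N u b).
  move=> Ib; have [a' Ia' [Kb HE]] := site b i Ib.
  rewrite /obstacles_at Kb HE.
  exact: (c_in (tb_ob (deformation_table Ia') i) u).
have Hccw b i u y : I b -> obstacles_at K b i y ->
    0 <= det2 (H i 1%N 0%N u b) (y - H i 0%N 0%N u b).
  move=> Ib; have [a' Ia' [Kb HE]] := site b i Ib.
  rewrite /obstacles_at Kb !HE.
  exact: (ob_ccw (tb_ob (deformation_table Ia') i) u).
have Hunit b i u : I b -> dot (H i 1%N 0%N u b) (H i 1%N 0%N u b) = 1.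
  move=> Ib; have [a' Ia' [Kb HE]] := site b i Ib; rewrite HE.
  exact: (dot_TT (tb_ob (deformation_table Ia') i) u).
have bound p q i u : (p <= r)%N -> (q.+1 <= r')%N -> 0 <= u <= L i a ->
    enorm (H i p q.+1 u a) <= C p q.+1 a.
  have ne : (p, q.+1) != (0%N, 0%N) by rewrite xpair_eqE andbF.
  move=> pr qr ul; have b1 := bd_bound hK Ia pr qr ne ul.
  rewrite /H /frozen; case: eqP => // _.
  by rewrite /enorm dot0l sqrtr0; exact: le_trans (enorm_ge0 _) b1.
have frz p q i u : i != i0 -> H i p q.+1 u a = 0.
  by rewrite /H /frozen => /negbTE ->.
have [d d0 h] := @reflection_point_smooth R m I r r' a H r2 r2' iI Ia sf1 sf2
  (obstacles_at K) (boundaries_at phi) (L ^~ a)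
  (fun b Ib => ex_intro _ _ (ex_intro _ _ (ex_intro _ _ (deformation_table Ib))))
  tb0 (fun i u => esym (H0 i 0%N u)) HK Hccw Hunit i0
  (fun i u => @frz 0%N 0%N i u) (fun i u => @frz 1%N 0%N i u)
  (C 0%N 1%N a) (C 1%N 1%N a)
  (fun i u => bound 0%N 0%N i u (leq0n _) (ltnW r2'))
  (fun i u => bound 1%N 0%N i u (ltnW r2) (ltnW r2')) xi hxi j.
by exists d.
Qed.

End deformation.

Theorem corollary6p6 (R : realType) (m r r' : nat) (a b : \bar R)
    (K : 'I_m -> R -> set (R * R)) (L : 'I_m -> R -> R)
    (phi : 'I_m -> R -> R -> R * R) (C : nat -> nat -> R -> R)
    (hm : (3 <= m)%N) (hr : (2 <= r)%N) (hr' : (2 <= r')%N)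
    (hab : (a < b)%E)
    (hK : billiard_deformation r r' (real_itv a b) K L phi C)
    (xi : int -> 'I_m) (hxi : Sigma xi) (j : int) :
  let I := real_itv a b in
  let p := fun alpha : R =>
    reflection_point (obstacles_at K alpha) (boundaries_at phi alpha) xi j in
  Ck_in I (minn r.-1 r'.-1) p /\
  (forall alpha : R, I alpha ->
     enorm (derive_in I p alpha) <= C_p K phi C alpha).
Proof.
have pI := real_itv_perfect hab; have iI := @real_itv_interval R a b.
split.
  apply: (local_Ck pI) => al Ial.
  have [d d0 [hU _]] := reflection_point_local hK hr hr' iI hxi j Ial.
  exists d => //; apply: hU.
    by rewrite (leq_ltn_trans (geq_minl _ _))// prednK// ltnW.
  by rewrite (leq_ltn_trans (geq_minr _ _))// prednK// ltnW.
move=> al Ial.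
have [d d0 [_ [f [v [fE sv hv]]]]] := reflection_point_local hK hr hr' iI hxi j Ial.
have Wal : window (real_itv a b) al d al by split=> //; rewrite subrr normr0.
by have [_ ->] := derive_in_eq pI Wal fE sv.
Qed.
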